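(* Suppose that $V$ is an $n\times n$ unitary matrix with distinct eigenvalues $e^{i\lambda_k}$, $1\le k\le n$. Then there is a self-adjoint differential operator of the form $$\tau f(t)=R(t)^{-1}\begin{pmatrix}0&-\frac{d}{dt}\\ \frac{d}{dt}&0\end{pmatrix}f(t),$$ acting on functions $f$ mapping an interval to $\mathbb R^2$, with $R(t)$ a positive definite matrix valued function, whose spectrum is equal to the set $\Lambda=\{n\lambda_k+2\pi nj:\ 1\le k\le n,\ j\in\mathbb Z\}$. Moreover, there is a hyperbolic carousel driven by a piecewise constant path that produces the same point sequence $\Lambda$.
   Context: Self-adjoint operator: let $J=\begin{pmatrix}0&-1\\1&0\end{pmatrix}$, so $\tau f=R^{-1}Jf'$ on an interval $[0,T)$, where $R(t)$ is a real positive definite $2\times2$ matrix for each $t$. Let $L^2_R$ be the Hilbert space of functions on $[0,T)$ with inner product $\langle v,w\rangle_R=\int_0^Tv(t)^tR(t)w(t)\,dt$. When $\|R\|$ is integrable on $[0,T)$, the domain of $\tau$ with boundary conditions given by nonzero vectors $u_0,u_1\in\mathbb R^2$ consists of the locally absolutely continuous $v\in L^2_R$ with $\tau v\in L^2_R$, $v(0)^tJu_0=0$ and $\lim_{s\to T}v(s)^tJu_1=0$; if $\|R\|$ is not integrable, the last condition is dropped. Self-adjointness is with respect to $\langle\cdot,\cdot\rangle_R$ on such a domain. Hyperbolic carousel: let $\gamma(t)$, $t\in[0,T)$, be a measurable, locally bounded path in the hyperbolic plane, represented here by the Poincaré disk $\{|z|<1\}$. Let $\eta_0,\eta_1$ be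 two distinct boundary points (points of the unit circle), and let $f$ be a positive, locally integrable function on $[0,T)$. For each $\lambda\in\mathbb R$ let the moving boundary point $r_\lambda(t)=e^{i\phi_\lambda(t)}$ start at $r_\lambda(0)=\eta_0$ and be rotated (by hyperbolic rotation) about $\gamma(t)$ continuously with rate $2\lambda f(t)$, i.e. $\phi_\lambda'=2f\lambda\frac{|e^{i\phi_\lambda}-\gamma|^2}{1-|\gamma|^2}$. Let $N(\cdot)$ be the right-continuous version of $\lambda\mapsto\operatorname{sgn}(\lambda)\cdot|\{t\in[0,T):r_\lambda(t)=\eta_1\}|$. If $N$ is a finite function, the set produced by the hyperbolic carousel associated to $(\gamma,\eta_0,\eta_1,f)$ is the set of points in $\mathbb R$ whose counting function is $N$; otherwise it is undefined. The carousel is said to be driven by the path $\gamma$.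
   Formalization: The carousel claim is stated only when 0 is not in Λ (1 is not an eigenvalue of V): since η0 ≠ η1, a carousel driven by a path with finitely many constant pieces and finite N never produces the point 0, e.g. V=(1), Λ=2πZ. *)

(* Defs.v *)
From HB Require Import structures.
From mathcomp Require Import all_boot all_order all_algebra spectral.
From mathcomp Require Import complex.
From mathcomp Require Import all_classical all_reals all_analysis.
Set Implicit Arguments.
Unset Strict Implicit.
Unset Printing Implicit Defensive.
Import Order.TTheory GRing.Theory Num.Theory.
Import numFieldNormedType.Exports.
Local Open Scope classical_set_scope.
Local Open Scope complex_scope.
Local Open Scope ring_scope.

Definition expi (R : realType) (x : R) : R[i] := cos x +i* sin x.

(* |z| as an element of R; the generic norm `|z| lives in R[i]. *)
Definition cabs (R : realType) (z : R[i]) : R := ComplexField.Normc.normc z.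

Definition unitary_points (R : realType) (n : nat) (lam : 'I_n -> R) : set R :=
  [set x | exists (k : 'I_n) (j : int),
             x = n%:R * lam k + 2 * pi * n%:R * j%:~R].

Definition intv (R : realType) (T : \bar R) : set R :=
  [set t | 0 <= t /\ (t%:E < T)%E].

(* The filter s -> T; the value at -oo is irrelevant. *)
Definition left_end (R : realType) (T : \bar R) : set_system R :=
  if T is t%:E then t^'- else +oo.

Definition ae_on (R : realType) (T : \bar R) (P : R -> Prop) : Prop :=
  {ae @lebesgue_measure R, forall t, intv T t -> P t}.

Definition abs_continuous (R : realType) (a b : R) (f : R -> R) : Prop :=
  forall eps : R, 0 < eps -> exists2 delta : R, 0 < delta &
    forall (m : nat) (x y : 'I_m -> R),
      (forall i, [&& a <= x i, x i <= y i & y i <= b]) ->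
      (forall i j, i != j -> y i <= x j \/ y j <= x i) ->
      \sum_i (y i - x i) < delta -> \sum_i `|f (y i) - f (x i)| < eps.

Definition loc_abs_continuous (R : realType) (T : \bar R) (f : R -> R) : Prop :=
  forall s, intv T s -> abs_continuous 0 s f.

Definition loc_integrable (R : realType) (T : \bar R) (f : R -> R) : Prop :=
  forall s, intv T s ->
    (@lebesgue_measure R).-integrable `[0, s] (fun t => (f t)%:E).

(* The breakpoints are finitely many; the path is constant on every [c, d)
   between consecutive breakpoints. *)
Definition piecewise_constant (R : realType) (T : \bar R) (C : Type)
    (g : R -> C) : Prop :=
  exists brk : seq R, forall s t, intv T s -> intv T t -> s <= t ->
    (forall c, c \in brk -> ~~ (s < c <= t)) -> g s = g t.

Definition Jmx (R : realType) : 'M[R]_2 :=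
  \matrix_(i < 2, j < 2) ((j < i)%N%:R - (i < j)%N%:R).

Definition posdefmx (R : realType) (A : 'M[R]_2) : Prop :=
  A^T = A /\ forall x : 'cV[R]_2, x != 0 -> 0 < (x^T *m A *m x) ord0 ord0.

(* Measurability of the weight is what gives the weighted inner product a
   meaning. *)
Definition dirac_data (R : realType) (T : \bar R) (W : R -> 'M[R]_2)
    (u0 u1 : 'cV[R]_2) : Prop :=
  [/\ (0 < T)%E,
      forall i j, measurable_fun (intv T) (fun t => W t i j),
      forall t, intv T t -> posdefmx (W t),
      u0 != 0 & u1 != 0].

Definition wdot (R : realType) (W : R -> 'M[R]_2) (v w : R -> 'cV[R]_2)
    (t : R) : R := ((v t)^T *m W t *m w t) ord0 ord0.

(* Elements of L^2_W are represented by functions; equality in L^2_W is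
   equality almost everywhere on [0, T). *)
Definition L2 (R : realType) (T : \bar R) (W : R -> 'M[R]_2)
    (v : R -> 'cV[R]_2) : Prop :=
  (forall i, measurable_fun (intv T) (fun t => v t i ord0)) /\
  (@lebesgue_measure R).-integrable (intv T) (fun t => (wdot W v v t)%:E).

Definition L2_eq (R : realType) (T : \bar R) (v w : R -> 'cV[R]_2) : Prop :=
  ae_on T (fun t => v t = w t).

Definition ip (R : realType) (T : \bar R) (W : R -> 'M[R]_2)
    (v w : R -> 'cV[R]_2) : R :=
  (\int[@lebesgue_measure R]_(t in intv T) wdot W v w t)%R.

Definition boundary_cond (R : realType) (T : \bar R) (W : R -> 'M[R]_2)
    (u0 u1 : 'cV[R]_2) (v : R -> 'cV[R]_2) : Prop :=
  ((v 0)^T *m Jmx R *m u0) ord0 ord0 = 0 /\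
  ((@lebesgue_measure R).-integrable (intv T) (fun t => (`|W t|)%:E) ->
   ((v s)^T *m Jmx R *m u1) ord0 ord0 @[s --> left_end T] --> (0 : R)).

(* [w] represents W^-1 J v'; [v] itself is the locally absolutely continuous
   representative. *)
Definition dirac_pre (R : realType) (T : \bar R) (W : R -> 'M[R]_2)
    (u0 u1 : 'cV[R]_2) (v w : R -> 'cV[R]_2) : Prop :=
  [/\ forall i, loc_abs_continuous T (fun t => v t i ord0),
      L2 T W v, L2 T W w,
      ae_on T (fun t => derivable v t 1 /\
                        w t = invmx (W t) *m Jmx R *m v^`()%classic t) &
      boundary_cond T W u0 u1 v].

(* The graph of the operator in L^2_W x L^2_W, saturated for equality almost
   everywhere. *)
Definition dirac_op (R : realType) (T : \bar R) (W : R -> 'M[R]_2)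
    (u0 u1 : 'cV[R]_2) (v w : R -> 'cV[R]_2) : Prop :=
  L2 T W v /\
  exists2 v0 : R -> 'cV[R]_2, L2_eq T v v0 & dirac_pre T W u0 u1 v0 w.

Definition densely_defined (R : realType) (T : \bar R) (W : R -> 'M[R]_2)
    (A : (R -> 'cV[R]_2) -> (R -> 'cV[R]_2) -> Prop) : Prop :=
  forall g, L2 T W g -> forall eps : R, 0 < eps ->
    exists v w, A v w /\
      ip T W (fun t => g t - v t) (fun t => g t - v t) < eps.

(* The graph of the adjoint: <A v, g> = <v, h> for all v in the domain. *)
Definition adjoint_op (R : realType) (T : \bar R) (W : R -> 'M[R]_2)
    (A : (R -> 'cV[R]_2) -> (R -> 'cV[R]_2) -> Prop)
    (g h : R -> 'cV[R]_2) : Prop :=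
  [/\ L2 T W g, L2 T W h &
      forall v w, A v w -> ip T W w g = ip T W v h].

Definition self_adjoint (R : realType) (T : \bar R) (W : R -> 'M[R]_2)
    (A : (R -> 'cV[R]_2) -> (R -> 'cV[R]_2) -> Prop) : Prop :=
  densely_defined T W A /\ (forall g h, A g h <-> adjoint_op T W A g h).

(* [A - l] is a bijection from the domain of A onto L^2_W with bounded
   inverse. *)
Definition resolvent_set (R : realType) (T : \bar R) (W : R -> 'M[R]_2)
    (A : (R -> 'cV[R]_2) -> (R -> 'cV[R]_2) -> Prop) : set R :=
  [set l | [/\
    forall v w, A v w -> L2_eq T (fun t => w t - l *: v t) (fun=> 0) ->
      L2_eq T v (fun=> 0),
    forall g, L2 T W g ->
      exists v w, A v w /\ L2_eq T (fun t => w t - l *: v t) g &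
    exists C : R, forall v w, A v w ->
      ip T W v v <=
      C * ip T W (fun t => w t - l *: v t) (fun t => w t - l *: v t)]].

(* L^2_W is a real Hilbert space, so the spectrum is a set of reals. *)
Definition spectrum (R : realType) (T : \bar R) (W : R -> 'M[R]_2)
    (A : (R -> 'cV[R]_2) -> (R -> 'cV[R]_2) -> Prop) : set R :=
  ~` resolvent_set T W A.

(* The local bound is with respect to the hyperbolic distance, i.e. the path
   stays in a smaller disk on every [0, s] with s < T. *)
Definition carousel_data (R : realType) (T : \bar R) (g : R -> R[i])
    (eta0 eta1 : R[i]) (f : R -> R) : Prop :=
  [/\ (0 < T)%E,
      [/\ measurable_fun (intv T) (fun t => complex.Re (g t)),
          measurable_fun (intv T) (fun t => complex.Im (g t)),
          forall t, intv T t -> cabs (g t) < 1 &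
          forall s, intv T s -> exists2 r : R, r < 1 &
            forall t, 0 <= t <= s -> cabs (g t) <= r],
      [/\ cabs eta0 = 1, cabs eta1 = 1 & eta0 != eta1],
      forall t, intv T t -> 0 < f t &
      loc_integrable T f].

(* [phi l] is a continuous lift of the argument of the moving boundary point
   with parameter l. *)
Definition carousel_phase (R : realType) (T : \bar R) (g : R -> R[i])
    (eta0 : R[i]) (f : R -> R) (phi : R -> R -> R) : Prop :=
  forall l : R,
    [/\ expi (phi l 0) = eta0,
        loc_abs_continuous T (phi l) &
        ae_on T (fun t => is_derive t (1 : R) (phi l)
          (2 * f t * l * cabs (expi (phi l t) - g t) ^+ 2
             / (1 - cabs (g t) ^+ 2)))].

Definition signed_hits (R : realType) (T : \bar R) (eta1 : R[i])
    (phi : R -> R -> R) (l : R) : \bar R :=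
  ((Num.sg l)%:E * counting [set t | intv T t /\ expi (phi l t) = eta1])%E.

(* [N] is the right-continuous version of the signed number of hits; having
   values in R, it is a finite function. *)
Definition carousel_counting (R : realType) (T : \bar R) (g : R -> R[i])
    (eta0 eta1 : R[i]) (f : R -> R) (N : R -> R) : Prop :=
  exists2 phi : R -> R -> R, carousel_phase T g eta0 f phi &
    forall l : R, signed_hits T eta1 phi x @[x --> l^'+] --> (N l)%:E.

Definition is_counting_function (R : realType) (X : set R) (N : R -> R) : Prop :=
  forall a b : R, a < b -> counting (X `&` `]a, b]) = (N b - N a)%:E.

(* The point r_0 never moves and eta0 <> eta1; if moreover the path is piecewise
   constant and N is finite, then f is integrable, r_l does not reach eta1 for
   small l, and N vanishes near 0.  So 0 is never a produced point then. *)
Definition carousel_produces (R : realType) (T : \bar R) (g : R -> R[i])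
    (eta0 eta1 : R[i]) (f : R -> R) (X : set R) : Prop :=
  exists2 N : R -> R, carousel_counting T g eta0 eta1 f N &
    is_counting_function X N.

(* Main.v *)
(* Put equal weights at the points [z_k = e^(i lambda_k)] of the unit circle and
   let [P = prod (z - z_k)].  By Gauss-Lucas [P' / n] has its zeros in the open
   disk, so the inverse Szego recursion (the Schur-Cohn test) yields points
   [a_0, ..., a_(n-1)] of the disk such that, starting from [E = 1] and rotating
   successively about the [a_k] by the angle [2 arg w], [|w| = 1], one lands on
   the line [R e] for a fixed [e] exactly when [w^2] is some [z_k].  Let the path
   sit at [a_k] during [[k, k + 1)] and take [w = e^(i lambda / 2n)].

   For the weight matrix of this path, solutions of [tau f = lambda f] undergo
   these very rotations, so [lambda] is an eigenvalue iff it lies in [Lambda].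
   Weight and inverse are bounded, hence variation of constants solves
   [(tau - lambda) v = g] boundedly for every other [lambda]; being symmetric
   and densely defined, [tau] is self-adjoint with spectrum [Lambda].

   The carousel point is [E / conj E].  Its lifted angle at time [n] increases
   strictly and continuously with [lambda], while for fixed [lambda] it is
   monotone in time; both counting problems therefore reduce to counting the
   integers between two values of a monotone function. *)

Require Import Defs.
From HB Require Import structures.
From mathcomp Require Import all_boot all_order all_algebra spectral.
From mathcomp Require Import complex.
From mathcomp Require Import all_classical all_reals all_analysis.
From mathcomp Require Import measurable_realfun ring lra zify.
Set Implicit Arguments.
Unset Strict Implicit.
Unset Printing Implicit Defensive.
Import Order.TTheory GRing.Theory Num.Theory.
Import numFieldNormedType.Exports.
Local Open Scope classical_set_scope.
Local Open Scope ring_scope.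

(** * Absolute continuity and primitives *)

(** The points of the circle enter only through [inverse_spectral], which delivers the centres [a]
    and the target axis [e]. The rest realises the recursion [hrot] twice. For the operator it
    becomes a real symplectic matrix, so the transfer matrix is an explicit finite product. For the
    carousel a point of the circle is not enough: counting hits needs an angle on the real line, and
    [center_lift] gives one by a closed formula with [atan]. The constants come from the double
    cover: [E] is turned by [l / (2n)] per unit of time, [E / conj E] by [l / n], whence the period
    [2 pi n] in [l]. The polynomial [P] is reached from [P' / n] by one more recursion step, but
    with a parameter of modulus one. Such a step is no rotation about a point of the disk; it turns
    into the boundary condition [e]. The domain is defined by absolute continuity and almost
    everywhere equations on a half-open interval, so the operator part rests on a fundamental
    theorem of calculus and on density. Injectivity of [tau - l] does not come from uniqueness for
    the differential equation: it follows from symmetry and solvability, and so does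
    self-adjointness. *)

Section AbsolutelyContinuous.
Context {R : realType}.
Implicit Types (a b : R) (f g h : R -> R).
Local Notation mu := (@lebesgue_measure R).

Lemma abs_continuousS a b a' b' f : a <= a' -> b' <= b ->
  abs_continuous a b f -> abs_continuous a' b' f.
Proof.
move=> aa bb acf e e0; have [d d0 H] := acf e e0; exists d => // m x y xy.
apply: H => i; have /and3P[h1 -> h3] := xy i.
by rewrite (le_trans aa h1) (le_trans h3 bb).
Qed.

Lemma eq_abs_continuous a b f g : {in `[a, b], f =1 g} ->
  abs_continuous a b f -> abs_continuous a b g.
Proof.
move=> fg acf e e0; have [d d0 H] := acf e e0; exists d => // m x y xy dis sm.
rewrite (eq_bigr (fun i => `|f (y i) - f (x i)|)); first exact: H.
move=> i _; have /and3P[h1 h2 h3] := xy i.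
by rewrite !fg// in_itv/= ?h1 ?h3 (le_trans h1, le_trans h2).
Qed.

Lemma lipschitz_abs_continuous a b f K :
  (forall x y, a <= x -> x <= y -> y <= b -> `|f y - f x| <= K * (y - x)) ->
  abs_continuous a b f.
Proof.
move=> lip e e0.
have K0 : 0 < `|K| + 1 by rewrite ltr_wpDl.
exists (e / (`|K| + 1)) => [|m x y xy _]; first by rewrite divr_gt0.
rewrite ltr_pdivlMr// => sm; apply: le_lt_trans sm.
rewrite mulr_suml; apply: ler_sum => i _; have /and3P[h1 h2 h3] := xy i.
rewrite (le_trans (lip _ _ h1 h2 h3))// mulrC ler_wpM2l ?subr_ge0//.
by rewrite (le_trans (ler_norm K))// lerDl.
Qed.

Lemma abs_continuous_pt a b f : abs_continuous a b f -> forall e, 0 < e ->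
  exists2 d, 0 < d & forall x y, a <= x <= b -> a <= y <= b ->
    `|y - x| < d -> `|f y - f x| < e.
Proof.
move=> acf e e0; have [d d0 H] := acf e e0; exists d => // x y.
wlog xy : x y / x <= y => [hw|].
  move=> hx hy; case: (leP x y) => xy; first exact: hw.
  by rewrite distrC [X in _ -> X < _]distrC; apply: hw => //; exact: ltW.
move=> /andP[ax xb] /andP[ay yb]; rewrite ger0_norm ?subr_ge0// => yx.
have := H 1%N (fun=> x) (fun=> y); rewrite !big_ord1; apply => //.
  by move=> _; rewrite ax xy yb.
by move=> i j; rewrite !ord1 eqxx.
Qed.

Lemma abs_continuous_within a b f : abs_continuous a b f ->
  {within `[a, b], continuous f}.
Proof.
move=> acf; apply/subspace_continuousP => x; rewrite /= in_itv/= => xab.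
apply/cvgrPdist_lt => e e0.
have [d d0 H] := abs_continuous_pt acf e0.
rewrite near_withinE; apply/nbhs_ballP; exists d => // y.
rewrite /ball/= distrC in_itv/= => yd yab.
by rewrite distrC; exact: H.
Qed.

Lemma within_bounded f a b : {within `[a, b], continuous f} ->
  exists2 M, 0 <= M & forall x, a <= x <= b -> `|f x| <= M.
Proof.
move=> cf; case: (leP a b) => ab; last first.
  exists 0 => // x /andP[ax xb]; by move: (le_trans ax xb); rewrite leNgt ab.
have cn : {within `[a, b], continuous (fun x => `|f x|)}.
  move=> x; apply: (@cvg_comp _ _ _ _ Num.norm); first exact: cf.
  exact: norm_continuous.
have [c _ H] := EVT_max ab cn.
by exists `|f c| => // x xab; apply: H; rewrite in_itv.
Qed.

Lemma abs_continuous_bounded a b f : abs_continuous a b f ->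
  exists2 M, 0 <= M & forall x, a <= x <= b -> `|f x| <= M.
Proof. by move=> /abs_continuous_within/within_bounded. Qed.

Lemma abs_continuousD a b f g : abs_continuous a b f -> abs_continuous a b g ->
  abs_continuous a b (f \+ g).
Proof.
move=> acf acg e e0; have e2 : 0 < e / 2 by rewrite divr_gt0.
have [d d0 H] := acf _ e2; have [d' d'0 H'] := acg _ e2.
exists (Num.min d d') => [|m x y xy dis]; first by rewrite lt_min d0.
rewrite lt_min => /andP[sd sd'].
have := H _ _ _ xy dis sd; have := H' _ _ _ xy dis sd' => h1 h2.
rewrite (splitr e); apply: le_lt_trans (ltrD h2 h1).
rewrite -big_split/=; apply: ler_sum => i _.
by rewrite opprD addrACA ler_normD.
Qed.

Lemma abs_continuousM a b f g : abs_continuous a b f -> abs_continuous a b g ->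
  abs_continuous a b (f \* g).
Proof.
move=> acf acg e e0.
have [M M0 fM] := abs_continuous_bounded acf.
have [N N0 gN] := abs_continuous_bounded acg.
have e2 : 0 < e / 2 by rewrite divr_gt0.
have M1 : 0 < M + 1 by rewrite ltr_wpDl.
have N1 : 0 < N + 1 by rewrite ltr_wpDl.
have [d d0 H] := acf (e / 2 / (N + 1)) ltac:(by rewrite divr_gt0).
have [d' d'0 H'] := acg (e / 2 / (M + 1)) ltac:(by rewrite divr_gt0).
exists (Num.min d d') => [|m x y xy dis]; first by rewrite lt_min d0.
rewrite lt_min => /andP[sd sd'].
have := H _ _ _ xy dis sd; have := H' _ _ _ xy dis sd'.
rewrite ltr_pdivlMr// => h1; rewrite ltr_pdivlMr// => h2.
rewrite (splitr e); apply: le_lt_trans (ltrD h2 h1).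
rewrite !mulr_suml -big_split/=; apply: ler_sum => i _.
have /and3P[p1 p2 p3] := xy i.
have -> : f (y i) * g (y i) - f (x i) * g (x i) =
  (f (y i) - f (x i)) * g (y i) + (g (y i) - g (x i)) * f (x i) by ring.
apply: le_trans (ler_normD _ _) _; rewrite !normrM.
apply: lerD; apply: ler_wpM2l => //; apply: ltW.
  by apply: le_lt_trans (gN _ _) _; rewrite ?ltrDl// p3 (le_trans p1).
by apply: le_lt_trans (fM _ _) _; rewrite ?ltrDl// p1 (le_trans p2).
Qed.

Lemma abs_continuous_cst a b k : abs_continuous a b (fun=> k).
Proof.
apply: (@lipschitz_abs_continuous _ _ _ 0) => x y _ _ _.
by rewrite subrr normr0 mul0r.
Qed.

Lemma abs_continuousZ a b k f : abs_continuous a b f ->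
  abs_continuous a b (fun t => k * f t).
Proof. by move=> acf; exact: abs_continuousM (@abs_continuous_cst a b k) acf. Qed.

Lemma abs_continuousB a b f g : abs_continuous a b f -> abs_continuous a b g ->
  abs_continuous a b (f \- g).
Proof.
move=> acf acg; apply: eq_abs_continuous (abs_continuousD acf
  (abs_continuousZ (-1) acg)) => x _ /=.
by rewrite mulN1r.
Qed.

(* Cousin's covering argument, phrased as an induction along [[a, b]]. *)
Lemma cousin_ind a b (P : R -> Prop) : a <= b ->
  (forall t, a <= t <= b -> exists2 r, 0 < r &
    forall s s', a <= s -> t - r < s -> s <= t -> t <= s' -> s' < t + r ->
      s' <= b -> P s -> P s') ->
  P a -> P b.
Proof.
move=> ab H Pa; pose A := [set s | a <= s <= b /\ P s].
have Aa : A a by split => //; rewrite lexx.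
have supA : has_sup A by split; [exists a|exists b => s [/andP[]]].
have ub : ubound A (sup A) by apply: ub_le_sup; case: supA.
have asup : a <= sup A by exact: ub.
have supb : sup A <= b by apply: ge_sup; [exists a|move=> s [/andP[]]].
have [r r0 Hr] := H (sup A) ltac:(by rewrite asup).
have [s [/andP[as_ sb] Ps] sr] := sup_adherent r0 supA.
have ss : s <= sup A by apply: ub; split => //; rewrite as_.
have step s' : sup A <= s' -> s' < sup A + r -> s' <= b -> P s'.
  by move=> h1 h2 h3; exact: (Hr s).
case: (ltP (sup A) b) => [sltb|]; last first.
  by move=> bs; apply: step => //; rewrite (le_lt_trans bs)// ltrDl.
pose s' := Num.min b (sup A + r / 2).
have s's : sup A < s' by rewrite lt_min sltb ltrDl divr_gt0.
have s'r : s' < sup A + r.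
  by rewrite gt_min ltrD2l ltr_pdivrMr// mulr_natr mulr2n ltrDl r0 orbT.
have s'b : s' <= b by rewrite ge_min lexx.
have : s' <= sup A.
  apply: ub; split; last by apply: step => //; exact: ltW.
  by rewrite s'b (le_trans asup)// ltW.
by rewrite leNgt s's.
Qed.

Lemma is_derive0_ball f t e : 0 < e -> is_derive t (1 : R) f 0 ->
  exists2 r, 0 < r & forall y, `|y - t| < r -> `|f y - f t| <= e * `|y - t|.
Proof.
move=> e0 [df f't].
have : h^-1 *: (f (h + t) - f t) @[h --> 0^'] --> (0 : R).
  have := df => /cvg_ex[l]; rewrite /= => hl.
  have ll : l = 0 by rewrite -f't; apply/esym/cvg_lim.
  suff -> : (fun x : R => x^-1 *: (f (x + t) - f t)) =
      (fun x : R => x^-1 *: (f (x *: 1 + t) - f t)) by move: hl; rewrite ll.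
  by apply/funext => x; rewrite [x *: 1]mulr1.
move=> /cvgrPdist_le /(_ e e0); rewrite near_withinE => /nbhs_ballP[r r0 Hr].
exists r => // y yr; have [->|yt] := eqVneq y t.
  by rewrite !subrr !normr0 mulr0.
have yt0 : y - t != 0 by rewrite subr_eq0.
have := Hr (y - t); rewrite /ball/= sub0r normrN => /(_ yr yt0).
by rewrite sub0r normrN subrK normrM normfV ler_pdivrMl ?normr_gt0// mulrC.
Unshelve. all: by end_near. Qed.

Lemma negligible_countable (A : set R) : countable A -> mu.-negligible A.
Proof.
move=> cA; apply/negligibleP; last exact: countable_lebesgue_measure0.
exact: countable_measurable.
Qed.

(** The set where the derivative may differ from 0 is null, so it lies in an open [U] of measure
    below the [d] that absolute continuity attaches to [e / 2]. Increments across [U] total at most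
    [e / 2], and elsewhere [f] grows at a small rate [k]; [cousin_ind] glues these local
    estimates. *)
Lemma abs_continuous_deriv0 a b f : a <= b -> abs_continuous a b f ->
  {ae mu, forall t, a < t < b -> is_derive t (1 : R) f 0} -> f b = f a.
Proof.
move=> ab acf aef.
suff H e : 0 < e -> `|f b - f a| <= e.
  apply/eqP; rewrite -subr_eq0 -normr_le0; apply/ler_addgt0Pr => e e0.
  by rewrite add0r H.
move=> e0; have e2 : 0 < e / 2 by rewrite divr_gt0.
have [d d0 Hd] := acf _ e2.
(* The endpoints join the exceptional set because nothing is assumed about the derivative there. *)
have : mu.-negligible (~` [set t | a < t < b -> is_derive t (1 : R) f 0] `|`
    [set a; b]).
  by apply: negligibleU => //; apply/negligible_countable/finite_set_countable.
move=> [N [mN N0 NA]].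
have [|U [oU NU UNd]] := lebesgue_regularity_outer mN _ d0; first by rewrite [X in (X < _)%E]N0.
have mU : measurable U by exact: measurable_realfun.open_measurable.
have Ud : (mu U < d%:E)%E.
  apply: le_lt_trans UNd; rewrite -[leRHS]adde0 -N0.
  rewrite -[leRHS]measureU//; last 2 first.
  - exact: measurableD.
  - by rewrite setDE -setIA (setIC (~` N)) setICr setI0.
  by rewrite setUC setDUK// le_measure ?inE.
have Ufin : mu U \is a fin_num by rewrite ge0_fin_numE// (lt_trans Ud) ?ltry.
(* [v s] will be the length of [U] to the left of [s], the budget for the recorded intervals;
   half-open cuts make it additive in [v_step]. *)
pose V s := U `&` `[a, s[%classic.
have mV s : measurable (V s) by exact: measurableI.
have VUle s : (mu (V s) <= mu U)%E.
  apply: le_measure; [apply/mem_set; exact: (mV s)|exact: mem_set|exact: subIsetl].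
have Vfin s : mu (V s) \is a fin_num.
  by rewrite ge0_fin_numE// (le_lt_trans (VUle s))// (lt_trans Ud) ?ltry.
pose v s := fine (mu (V s)).
have v_mono s s' : s <= s' -> v s <= v s'.
  move=> ss; rewrite fine_le//; apply: le_measure.
  - by apply: mem_set; exact: (mV s).
  - by apply: mem_set; exact: (mV s').
  - by apply: setIS; apply: subset_itvl; rewrite bnd_simp.
have v_step s s' : a <= s -> s <= s' -> `[s, s'[ `<=` U -> v s + (s' - s) <= v s'.
  move=> as_ ss sU.
  rewrite -lee_fin EFinD /v !fineK//.
  have -> : (s' - s)%:E = mu `[s, s'[%classic.
    rewrite lebesgue_measure_itv/= lte_fin; case: ltgtP ss => // ->.
    by rewrite subrr.
  rewrite -measureU; last 3 first.
  - exact: (mV s).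
  - exact: measurable_itv.
  - apply/seteqP; split => // x [[_ /=]]; rewrite !in_itv/= => /andP[_ xs].
    by move=> /andP[]; rewrite leNgt xs.
  apply: le_measure.
  - apply/mem_set/measurableU; [exact: (mV s)|exact: measurable_itv].
  - by apply: mem_set; exact: (mV s').
  move=> x [[Ux /=]|/= xs]; rewrite /V /= in_itv/=.
    by rewrite in_itv/= => /andP[-> xs]; split => //; rewrite (lt_le_trans xs).
  split; first exact: sU.
  by move: xs; rewrite in_itv/= => /andP[h1 ->]; rewrite (le_trans as_).
have ba1 : 0 < b - a + 1 by rewrite ltr_wpDl// subr_ge0.
pose k := e / 2 / (b - a + 1).
have k0 : 0 < k by rewrite divr_gt0.
(* Off the exceptional set [f] grows at rate at most [k]; inside its open
   neighbourhood [U] we only record the intervals crossed, whose total length is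
   at most [v s] < d. *)
pose P s := exists (m : nat) (X Y : 'I_m -> R),
  [/\ forall i, [&& a <= X i, X i <= Y i & Y i <= s],
      forall i j, i != j -> Y i <= X j \/ Y j <= X i,
      \sum_i (Y i - X i) <= v s &
      `|f s - f a| <= k * (s - a) + \sum_i `|f (Y i) - f (X i)|].
have Pa : P a.
  exists 0%N, (fun=> a), (fun=> a); split => //; try by case.
  - by rewrite big_ord0; exact: fine_ge0.
  - by rewrite big_ord0 !subrr normr0 mulr0 addr0.
have [m [X [Y [XY dis sv fv]]]] : P b; last first.
  rewrite (splitr e); apply: le_trans fv _; apply: lerD.
    rewrite /k -mulrA ler_piMr//; first exact: ltW.
    by rewrite ler_pdivrMl// mulr1 lerDl.
  apply/ltW/(Hd _ _ _ XY dis)/(le_lt_trans sv).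
  by rewrite -lte_fin /v fineK// (le_lt_trans _ Ud).
apply: cousin_ind Pa => // t /andP[at_ tb].
have [tU|tU] := pselect (U t).
  have /nbhs_ballP[r r0 rU] := open_nbhs_nbhs (conj oU tU).
  exists r => // s s' as_ ts st ts' s'r s'b [m [X [Y [XY dis sv fv]]]].
  have ss' : s <= s' by exact: le_trans ts'.
  pose X' (i : 'I_m.+1) := oapp X s (unlift ord0 i).
  pose Y' (i : 'I_m.+1) := oapp Y s' (unlift ord0 i).
  exists m.+1, X', Y'; split.
  - move=> i; rewrite /X' /Y'; case: unliftP => [j _|_] /=.
      have /and3P[-> -> /=] := XY j; move=> h; exact: le_trans ss'.
    by rewrite as_ ss' lexx.
  - move=> i j ij; rewrite /X' /Y'.
    case: unliftP ij => [i' ->|->]; case: unliftP => [j' ->|->] //=.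
    + by rewrite (inj_eq lift_inj); exact: dis.
    + by move=> _; left; have /and3P[] := XY i'.
    + by move=> _; right; have /and3P[] := XY j'.
  - rewrite big_ord_recl /X' /Y' unlift_none /=.
    under eq_bigr do rewrite liftK.
    have sub : `[s, s'[ `<=` U.
      move=> x; rewrite /= in_itv/= => /andP[sx xs']; apply: rU.
      by rewrite /ball/= ltr_norml; apply/andP; split; lra.
    by apply: le_trans (v_step _ _ as_ ss' sub); rewrite addrC lerD2r.
  - rewrite big_ord_recl /X' /Y' unlift_none /=.
    under eq_bigr do rewrite liftK.
    have -> : f s' - f a = (f s' - f s) + (f s - f a) by ring.
    apply: le_trans (ler_normD _ _) _; rewrite addrCA lerD2l.
    apply: le_trans fv _; rewrite lerD2r ler_pM2l// lerD2r//.
have [tab df] : a < t < b /\ is_derive t (1 : R) f 0.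
  have tN : ~ N t by move=> /NU.
  have tab : a < t < b.
    rewrite !lt_neqAle at_ tb !andbT; apply/andP; split; apply/eqP => E;
      apply: tN; apply: NA; right; [left|right]; rewrite /= E//.
  split => //; apply: contrapT => h; apply: tN; apply: NA; left => /=.
  by move=> /(_ tab).
have [r r0 rf] := is_derive0_ball k0 df.
exists r => // s s' as_ ts st ts' s'r s'b [m [X [Y [XY dis sv fv]]]].
have ss' : s <= s' by exact: le_trans ts'.
exists m, X, Y; split => //.
- move=> i; have /and3P[-> -> /=] := XY i; move=> h; exact: le_trans ss'.
- by rewrite (le_trans sv)// v_mono.
- have -> : f s' - f a = (f s' - f t) - (f s - f t) + (f s - f a) by ring.
  have -> : k * (s' - a) = k * (s' - t) + k * (t - s) + k * (s - a) by ring.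
  apply: le_trans (ler_normD _ _) _; rewrite -[leRHS]addrA; apply: lerD => //.
  apply: le_trans (ler_normB _ _) _; apply: lerD.
    rewrite -[leRHS]ger0_norm; last by rewrite mulr_ge0// ?subr_ge0// ltW.
    rewrite normrM (ger0_norm (ltW k0)); apply: rf; rewrite ger0_norm; lra.
  rewrite (_ : t - s = `|s - t|); last by rewrite ler0_norm ?opprB ?subr_le0.
  by apply: rf; rewrite ler0_norm; lra.
Qed.

Lemma ae_sub (P Q : R -> Prop) : (forall t, P t -> Q t) ->
  {ae mu, forall t, P t} -> {ae mu, forall t, Q t}.
Proof.
by move=> PQ; apply: filterS; [exact: (ae_filter_ringOfSetsType mu)|exact: PQ].
Qed.

Lemma ae_sub2 (P Q S : R -> Prop) : (forall t, P t -> Q t -> S t) ->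
  {ae mu, forall t, P t} -> {ae mu, forall t, Q t} -> {ae mu, forall t, S t}.
Proof.
by move=> PQS; apply: filterS2; [exact: (ae_filter_ringOfSetsType mu)|exact: PQS].
Qed.

(** Absolute continuity of the Lebesgue integral, applied to the union [D] of the intervals. Cutting
    them as []X i, Y i]] makes intervals with a common endpoint disjoint. *)
Lemma Rintegral_abs_continuous h b : mu.-integrable setT (EFin \o h) ->
  abs_continuous 0 b (fun t => \int[mu]_(x in `[0, t]) h x).
Proof.
move=> ih e e0; have [d [d0 Hd]] := integral_normr_continuous ih e0.
exists d => // m X Y XY dis sd.
pose A i := `]X i, Y i]%classic.
have mA i : measurable (A i : set (measurableTypeR R)) by exact: measurable_itv.
have tA : trivIset [set` index_enum 'I_m] A.
  move=> i j _ _ [z []]; rewrite /A /= !in_itv/= => /andP[z1 z2] /andP[z3 z4].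
  apply: contrapT => /eqP ij; have [h1|h1] := dis _ _ ij.
    by move: (le_lt_trans h1 z3); rewrite ltNge z2.
  by move: (le_lt_trans h1 z1); rewrite ltNge z4.
pose D := \big[setU/set0]_(i < m) A i.
have mD : measurable (D : set (measurableTypeR R)) by exact: bigsetU_measurable.
have iD (B : set (measurableTypeR R)) : measurable B ->
    mu.-integrable B (EFin \o h).
  by move=> mB; exact: integrableS ih.
have muA i : mu (A i) = (Y i - X i)%:E.
  rewrite lebesgue_measure_itv/= lte_fin.
  have /and3P[_ + _] := XY i; rewrite le_eqVlt => /orP[/eqP ->|->//].
  by rewrite ltxx subrr.
have muD : (mu D < d%:E)%E.
  rewrite -[mu D]mul1e -integral_cst//.
  rewrite (ge0_integral_bigsetU _ mA)//; last exact: index_enum_uniq.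
  rewrite (eq_bigr (fun i => (Y i - X i)%:E)) ?sumEFin ?lte_fin// => i _.
  by rewrite integral_cst// mul1e -muA.
apply: le_lt_trans (Hd D mD muD).
rewrite -lee_fin -sumEFin /Rintegral fineK; last first.
  by apply: integrable_fin_num => //; exact/integrable_norm/iD.
rewrite (ge0_integral_bigsetU _ mA)//; last 2 first.
- exact: index_enum_uniq.
- by apply: (measurable_int mu); exact/integrable_norm/iD.
apply: lee_sum => i _; have /and3P[p1 p2 p3] := XY i.
rewrite -/(Rintegral mu _ h) -/(Rintegral mu _ h) Rintegral_itvB ?bnd_simp//; last first.
  by apply: iD; exact: measurable_itv.
rewrite EFin_normr_Rintegral//; last exact: iD.
apply: le_trans (le_abse_integral _ _ _) _ => //.
by apply: (measurable_int mu); exact: iD.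
Qed.

Lemma Rintegral_is_derive h : mu.-integrable setT (EFin \o h) ->
  {ae mu, forall t : R, 0 < t ->
    is_derive t (1 : R) (fun t => \int[mu]_(x in `[0, t]) h x) (h t)}.
Proof.
move=> ih.
have lh : locally_integrable [set: R] h.
  by have := integrable_locally measurableT ih; rewrite patch_setT.
have iD (y : R) : mu.-integrable `[0, y] (EFin \o h).
  by apply: integrableS ih => //; exact: measurable_itv.
have := FTC1 iD lh; apply: ae_sub => t ht t0.
have [d1 d2] := ht t0; split; [exact: d1|by rewrite -derive1E; exact: d2].
Qed.

Lemma primitive_ex T h : mu.-integrable `[0, T] (EFin \o h) ->
  exists F : R -> R, [/\ abs_continuous 0 T F, F 0 = 0,
    forall t, t <= T -> F t = \int[mu]_(x in `[0, t]) h x &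
    {ae mu, forall t : R, 0 < t < T -> is_derive t (1 : R) F (h t)}].
Proof.
(* Extension by zero yields an integrand on the whole line, the setting of the two preceding
   lemmas. *)
move=> ih; pose h' := h \_ `[0, T].
have ih' : mu.-integrable setT (EFin \o h').
  move/integrable_mkcond : ih => /(_ (measurable_itv _)).
  by rewrite restrict_EFin.
exists (fun t => \int[mu]_(x in `[0, t]) h' x); split.
- exact: Rintegral_abs_continuous.
- by rewrite set_itv1 Rintegral_set1.
- move=> t tT; apply: eq_Rintegral => x; rewrite inE/= in_itv/= => /andP[x0 xt].
  by rewrite /h' patchE mem_set//= in_itv/= x0 (le_trans xt).
- have := Rintegral_is_derive ih'; apply: ae_sub => t ht /andP[t0 tT].
  have := ht t0; rewrite {2}/h' patchE mem_set//= in_itv/= !ltW//.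
Qed.

(** Subtracting a primitive of [h] leaves an absolutely continuous function with derivative 0 almost
    everywhere. *)
Lemma abs_continuous_FTC T f h : 0 < T -> abs_continuous 0 T f ->
  mu.-integrable `[0, T] (EFin \o h) ->
  {ae mu, forall t : R, 0 < t < T -> is_derive t (1 : R) f (h t)} ->
  forall s, 0 <= s <= T -> f s = f 0 + \int[mu]_(x in `[0, s]) h x.
Proof.
move=> T0 acf ih df s /andP[s0 sT]; have [F [acF F0 FE dF]] := primitive_ex ih.
have : (f \- F) s = (f \- F) 0.
  apply: abs_continuous_deriv0 => //.
    by apply: abs_continuousB; exact: abs_continuousS (lexx 0) sT _.
  apply: ae_sub2 df dF => t dft dFt /andP[t0 ts].
  have tT : 0 < t < T by rewrite t0 (lt_le_trans ts).
  have := dft tT; have := dFt tT => ? ?.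
  by apply: is_derive_eq; rewrite subrr.
by rewrite /= F0 subr0 FE// => <-; rewrite subrK.
Qed.

End AbsolutelyContinuous.

(** * Density in L2 *)

Section TruncationApproximation.
Context {R : realType}.
Implicit Types (a b : R) (f g h : R -> R).
Local Notation mu := (@lebesgue_measure R).

Lemma ecvg0_lt (u : nat -> \bar R) (e : R) : u @ \oo --> (0 : \bar R)%E -> 0 < e ->
  exists n, (u n < e%:E)%E.
Proof.
move=> /fine_cvgP[uf u0] e0.
have [n [un ue]] := filter_ex (filterI uf (cvgr_lt _ u0 _ e0)).
by exists n; rewrite -(fineK un) lte_fin.
Qed.

Variable T : R.
Hypothesis T0 : 0 < T.
Local Notation D := (`[0, T[%classic : set (measurableTypeR R)).
Local Notation mfun f := (measurable_fun D (f : measurableTypeR R -> R)).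

Let mD : measurable D. Proof. exact: measurable_itv. Qed.

Lemma muD : mu D = T%:E.
Proof. by rewrite lebesgue_measure_itv/= lte_fin T0 sube0. Qed.

Lemma muDy : (mu D < +oo)%E.
Proof. by rewrite muD ltry. Qed.

(** Convergence is asked on the open interval only, since the cutoffs of [smooth_approx] vanish at
    0; a single point is null. *)
Lemma dominated_convergence_lt (u : nat -> R -> R) (B : R -> R) e :
  (forall n, mfun (u n)) -> mu.-integrable D (EFin \o B) ->
  (forall x, 0 < x < T -> u ^~ x @ \oo --> (0 : R)) ->
  (forall n x, D x -> 0 <= u n x <= B x) -> 0 < e ->
  exists n, (\int[mu]_(x in D) (u n x)%:E < e%:E)%E.
Proof.
move=> mu_ iB u0 uB e0.
have [||||_ _] := @dominated_convergence _ _ _ mu D mD (fun n x => (u n x)%:E)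
  (fun=> 0%E) (EFin \o B) _ _ _ iB _.
- by move=> n; exact/measurable_EFinP.
- by [].
- exists [set 0]; split; [exact: measurable_set1|exact: lebesgue_measure_set1|].
  move=> x /= nx; apply: contrapT => /eqP x0; apply: nx; rewrite in_itv/=.
  move=> /andP[x0' xT]; apply: cvg_EFin; [exact: nearW|apply: u0].
  by rewrite lt_neqAle eq_sym x0 x0'.
- apply: aeW => x n Dx /=; have /andP[h1 h2] := uB n x Dx.
  by rewrite lee_fin ger0_norm.
by rewrite integral0 => /ecvg0_lt; exact.
Qed.

(** Squared distance in L2, kept in the extended reals so that the triangle estimates hold for
    merely measurable functions. *)
Definition sqd f g := (\int[mu]_(x in D) ((f x - g x) ^+ 2)%:E)%E.

Lemma measurable_sqd f g : mfun f -> mfun g ->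
  measurable_fun D (fun x => ((f x - g x) ^+ 2)%:E).
Proof.
by move=> mf mg; apply/measurable_EFinP/measurable_funX/measurable_funB.
Qed.

Lemma sqd_tri f g v : mfun f -> mfun g -> mfun v ->
  (sqd f v <= 2%:E * sqd f g + 2%:E * sqd g v)%E.
Proof.
move=> mf mg mv; rewrite /sqd -!ge0_integralZl_EFin//; last 4 first.
- by move=> x _; rewrite lee_fin sqr_ge0.
- exact: measurable_sqd.
- by move=> x _; rewrite lee_fin sqr_ge0.
- exact: measurable_sqd.
rewrite -ge0_integralD//; last 4 first.
- by move=> x _; rewrite -EFinM lee_fin mulr_ge0// sqr_ge0.
- by apply: measurable_funeM; exact: measurable_sqd.
- by move=> x _; rewrite -EFinM lee_fin mulr_ge0// sqr_ge0.
- by apply: measurable_funeM; exact: measurable_sqd.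
apply: ge0_le_integral => //.
- by move=> x _; rewrite lee_fin sqr_ge0.
- exact: measurable_sqd.
- by apply: emeasurable_funD; apply: measurable_funeM; exact: measurable_sqd.
- move=> x _; rewrite -!EFinM -EFinD lee_fin.
  rewrite -subr_ge0.
  have -> : 2 * (f x - g x) ^+ 2 + 2 * (g x - v x) ^+ 2 - (f x - v x) ^+ 2 =
    (f x - g x - (g x - v x)) ^+ 2 by ring.
  exact: sqr_ge0.
Qed.

Lemma sqd_lt_tri f g v e : mfun f -> mfun g -> mfun v -> 0 < e ->
  (sqd f g < (e / 4)%:E)%E -> (sqd g v < (e / 4)%:E)%E -> (sqd f v < e%:E)%E.
Proof.
move=> mf mg mv e0 fg gv; apply: le_lt_trans (sqd_tri mf mg mv) _.
have fgn : sqd f g \is a fin_num.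
  rewrite ge0_fin_numE ?(lt_trans fg) ?ltry//.
  by apply: integral_ge0 => x _; rewrite lee_fin sqr_ge0.
have gvn : sqd g v \is a fin_num.
  rewrite ge0_fin_numE ?(lt_trans gv) ?ltry//.
  by apply: integral_ge0 => x _; rewrite lee_fin sqr_ge0.
move: fg gv; rewrite -(fineK fgn) -(fineK gvn) -!EFinM -EFinD !lte_fin.
by lra.
Qed.

Let clamp (M y : R) := Num.max (- M) (Num.min M y).

Lemma clamp_le M y : 0 <= M -> `|clamp M y| <= M.
Proof.
move=> M0; rewrite /clamp /Num.max /Num.min.
by case: (ltP M y) => h1; case: ltP => h2; rewrite ler_norml; lra.
Qed.

Lemma clamp_id M y : `|y| <= M -> clamp M y = y.
Proof.
move=> /ler_normlP[h1 h2]; rewrite /clamp /Num.max /Num.min.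
by case: (ltP M y) => h3; case: ltP => h4; lra.
Qed.

Lemma clamp_lip M y z : 0 <= M -> `|clamp M y - clamp M z| <= `|y - z|.
Proof.
move=> M0; rewrite /clamp /Num.max /Num.min.
have := ler_norm (y - z); have := ler_norm (z - y); rewrite [`|z - y|]distrC.
by case: (ltP M y) => h1; case: (ltP M z) => h2; case: ltP => h3;
  case: ltP => h4; rewrite ler_norml; lra.
Qed.

Lemma measurable_clamp M f : mfun f -> mfun (fun x => clamp M (f x)).
Proof.
move=> mf; apply: measurable_maxr => //; exact: measurable_minr.
Qed.

Lemma truncate_approx f e : mfun f ->
  mu.-integrable D (fun x => (f x ^+ 2)%:E) -> 0 < e ->
  exists2 M, 0 <= M & (sqd f (fun x => clamp M (f x)) < e%:E)%E.
Proof.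
move=> mf f2 e0.
have [|||n hn] := @dominated_convergence_lt (fun n x => (f x - clamp n%:R (f x)) ^+ 2)
  (fun x => f x ^+ 2) e _ f2 _ _ e0.
- move=> n; apply/measurable_funX/measurable_funB => //.
  exact: measurable_clamp.
- move=> x _; apply/cvgrPdist_lt => d d0; near=> n.
  rewrite clamp_id ?subrr ?expr0n/= ?subr0 ?normr0//.
  by near: n; exact: nbhs_infty_ger.
- move=> n x _; rewrite sqr_ge0/= -real_normK ?num_real//.
  rewrite -[leRHS]real_normK ?num_real// ler_sqr ?nnegrE//.
  have n0 : 0 <= n%:R :> R by [].
  move: (f x) (n%:R : R) n0 => y M M0; rewrite /clamp /Num.max /Num.min.
  have := ler_norm y; have := ler_norm (- y); rewrite normrN => a1 a2.
  by case: (ltP M y) => h1; case: ltP => h2; rewrite ler_norml; lra.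
by exists n%:R.
Unshelve. all: by end_near. Qed.

(** Continuous functions are dense in L1. Clamping the approximant to [[- M, M]] keeps it continuous
    and brings it no farther from [f], and then [(f - g) ^+ 2 <= 2 * M * |f - g|] turns L1 closeness
    into L2 closeness. *)
Lemma continuous_approx f M e : mfun f -> 0 <= M ->
  (forall x, `|f x| <= M) -> 0 < e ->
  exists g, [/\ continuous g, forall x, `|g x| <= M & (sqd f g < e%:E)%E].
Proof.
move=> mf M0 fM e0.
have fi : mu.-integrable D (EFin \o f).
  apply: measurable_bounded_integrable => //; first exact: muDy.
  by exists M; split; [exact: num_real|move=> k Mk x _; exact/(le_trans (fM _))/ltW].
have [g_ [cg ig]] := approximation_continuous_integrable mD muDy fi.
have e1 : 0 < e / (2 * M + 1) by rewrite divr_gt0// ltr_wpDl// mulr_ge0.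
move=> /ecvg0_lt /(_ e1) [n hn].
pose g x := clamp M (g_ n x).
have cgc : continuous g.
  move=> x; apply/cvgrPdist_lt => d d0.
  have /cvgrPdist_lt/(_ _ d0) := cg n x; apply: filterS => y.
  exact/le_lt_trans/clamp_lip.
exists g; split => //; first by move=> x; exact: clamp_le.
have mg : mfun g by apply: measurable_funTS; exact: continuous_measurable_fun.
have mgn : mfun (g_ n) by apply: measurable_funTS; exact: continuous_measurable_fun.
have M1 : 0 <= 2 * M by rewrite mulr_ge0.
have mn : measurable_fun D (fun z => `|(f z - g_ n z)%:E|%E).
  by apply: measurableT_comp => //; exact/measurable_EFinP/measurable_funB.
apply: (@le_lt_trans _ _ ((2 * M)%:E * \int[mu]_(z in D) `|(f z - g_ n z)%:E|)%E).
  rewrite -ge0_integralZl_EFin//; apply: ge0_le_integral => //.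
  - by move=> x _; rewrite lee_fin sqr_ge0.
  - exact: measurable_sqd.
  - exact: measurable_funeM.
  - move=> x _; rewrite -EFinM lee_fin -real_normK ?num_real// expr2.
    apply: ler_pM => //.
      apply: le_trans (ler_normB _ _) _; have := fM x.
      by have := clamp_le (g_ n x) M0; rewrite /g; lra.
    by rewrite /g -{1}(clamp_id (fM x)) clamp_lip.
have fin : (\int[mu]_(z in D) `|(f z - g_ n z)%:E|)%E \is a fin_num.
  by rewrite ge0_fin_numE ?(lt_trans hn) ?ltry//; exact: integral_ge0.
move: hn; rewrite -(fineK fin) -EFinM !lte_fin ltr_pdivlMr; last first.
  by rewrite ltr_wpDl.
apply: le_lt_trans; rewrite mulrC ler_wpM2l ?lerDl//.
by rewrite fine_ge0//; exact: integral_ge0.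
Qed.

End TruncationApproximation.

(** * Smooth approximants vanishing at both endpoints *)

Section SmoothApproximation.
Context {R : realType}.
Implicit Types (a b : R) (f g h : R -> R).
Local Notation mu := (@lebesgue_measure R).

Lemma continuous_primitive g b : continuous g ->
  exists F : R -> R, forall x, 0 <= x <= b -> is_derive x (1 : R) F (g x).
Proof.
(* The base point -1 keeps [x = 0] in the interior, so the derivative there is two-sided. *)
move=> cg; exists (fun x => \int[mu]_(t in `[-1, x]) g t) => x /andP[x0 xb].
have ig : mu.-integrable `[-1, x + 1] (EFin \o g).
  apply: continuous_compact_integrable; first exact: segment_compact.
  by apply: continuous_subspaceT.
have [|||d1 d2] := @continuous_FTC1 R g (BLeft (-1)) x (x + 1) _ ig.
- by rewrite ltrDl.
- by rewrite /= lte_fin; lra.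
- exact: cg.
by split; [exact: d1|rewrite -derive1E; exact: d2].
Qed.

Lemma is_derive_continuous f df x : is_derive x (1 : R) f df ->
  {for x, continuous f}.
Proof.
move=> d; apply: differentiable_continuous; apply/derivable1_diffP.
exact: ex_derive.
Qed.

Lemma is_derive_within f df a b :
  (forall x, a <= x <= b -> is_derive x (1 : R) f (df x)) ->
  {within `[a, b], continuous f}.
Proof.
move=> d; apply: continuous_in_subspaceT => x; rewrite inE/= in_itv/= => xab.
exact: is_derive_continuous (d x xab).
Qed.

Lemma is_derive_abs_continuous f df a b K :
  (forall x, a <= x <= b -> is_derive x (1 : R) f (df x)) ->
  (forall x, a <= x <= b -> `|df x| <= K) -> abs_continuous a b f.
Proof.
move=> d dK; apply: (@lipschitz_abs_continuous _ _ _ _ K) => x y ax xy yb.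
have sub z : x <= z <= y -> a <= z <= b.
  by move=> /andP[xz zy]; rewrite (le_trans ax xz) (le_trans zy yb).
have [|z] := @MVT_segment _ f df x y xy _
  (is_derive_within (fun z hz => d z (sub z hz))).
  by move=> z; rewrite in_itv/= => /andP[z1 z2]; apply: d; apply: sub;
    rewrite !ltW.
rewrite in_itv/= => /sub zab ->; rewrite normrM (ger0_norm (_ : 0 <= y - x)).
  by rewrite ler_wpM2r ?subr_ge0// dK.
by rewrite subr_ge0.
Qed.

Variable T : R.
Hypothesis T0 : 0 < T.
Local Notation D := (`[0, T[%classic : set (measurableTypeR R)).
Local Notation mfun f := (measurable_fun D (f : measurableTypeR R -> R)).

Lemma abs_continuous_measurable f : abs_continuous 0 T f -> mfun f.
Proof.
move=> acf; apply: (@measurable_funS _ _ _ _ `[0, T]%classic).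
- exact: measurable_itv.
- by apply: subset_itvl; rewrite bnd_simp.
apply: subspace_continuous_measurable_fun; first exact: measurable_itv.
exact: abs_continuous_within.
Qed.

(** A polynomial cutoff: the even power equals 1 at [t = 0] and [t = T] and tends to 0 strictly
    between, so [chi n] vanishes at both ends and increases to 1 inside. *)
Let chi n : {poly R} := 1 - (1 - (2 / T) *: 'X) ^+ n.+1.*2.

Let chiE n t : (chi n).[t] = 1 - (1 - 2 / T * t) ^+ n.+1.*2.
Proof. by rewrite /chi !hornerE. Qed.

Let tT t : 0 <= t <= T -> `|1 - 2 / T * t| <= 1.
Proof.
move=> /andP[t0 tT]; have h : 0 <= t / T <= 1.
  by rewrite ler_pdivrMr// mul1r tT andbT divr_ge0// ltW.
by rewrite mulrAC -mulrA ler_norml; lra.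
Qed.

Let chi01 n t : 0 <= t <= T -> 0 <= (chi n).[t] <= 1.
Proof.
move=> h; rewrite chiE -mul2n exprM -real_normK ?num_real//.
rewrite -exprM.
have := tT h; set y := `|_| => y1.
by apply/andP; split; [rewrite subr_ge0 exprn_ile1//|rewrite gerBl exprn_ge0//]; apply: normr_ge0.
Qed.

(** The approximant is the cutoff [chi n] times the mean [q n] of [g] over [[t, t + k n]]. The mean
    has a bounded derivative, a difference quotient of [g], and stays below [M] by the mean value
    theorem. Vanishing at both ends will satisfy any boundary condition. *)
Lemma smooth_approx g M e : continuous g -> (forall x, `|g x| <= M) -> 0 < e ->
  exists v h, [/\ abs_continuous 0 T v, v 0 = 0 /\ v T = 0,
    forall t, 0 < t < T -> is_derive t (1 : R) v (h t),
    mfun h /\ exists K, forall t, 0 <= t <= T -> `|h t| <= K &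
    (sqd T g v < e%:E)%E].
Proof.
move=> cg gM e0.
have M0 : 0 <= M by exact: le_trans (gM 0).
(* The means reach beyond [T] by [k n], at most 1. *)
have [F dF] := @continuous_primitive g (T + 1) cg.
pose k n : R := n.+1%:R^-1.
have k0 n : 0 < k n by rewrite invr_gt0.
have k1 n : k n <= 1 by rewrite invf_le1// ler1n.
pose q n t := n.+1%:R * (F (t + k n) - F t).
have qE n t : 0 <= t <= T -> exists2 c, t <= c <= t + k n & q n t = g c.
  move=> /andP[t0 tleT].
  have sub z : t <= z <= t + k n -> 0 <= z <= T + 1.
    by move=> /andP[z1 z2]; have := k1 n; lra.
  have [||c cin qc] := @MVT_segment _ F g t (t + k n) _ _
    (is_derive_within (fun z hz => dF z (sub z hz))).
  - by rewrite lerDl ltW.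
  - by move=> z; rewrite in_itv/= => /andP[z1 z2]; apply: dF; apply: sub;
      rewrite !ltW.
  exists c; first by move: cin; rewrite in_itv.
  by rewrite /q qc addrAC subrr add0r mulrCA divff ?mulr1// pnatr_eq0.
have q_der n t : 0 <= t <= T ->
    is_derive t (1 : R) (q n) (n.+1%:R * (g (t + k n) - g t)).
  move=> /andP[t0 tleT].
  have d1 : is_derive t (1 : R) F (g t) by apply: dF; lra.
  have d2 : is_derive (t + k n) (1 : R) F (g (t + k n)).
    by apply: dF; have := k0 n; have := k1 n; lra.
  have d3 : is_derive t (1 : R) (shift (k n)) 1 by exact: is_derive_shift.
  have d4 := @is_derive1_comp _ F (shift (k n)) t _ _ d2 d3.
  rewrite mulr1 in d4.
  exact: (@is_deriveZ _ _ _ (F \o shift (k n) - F) n.+1%:R t 1 _ _).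
have q_le n t : 0 <= t <= T -> `|q n t| <= M.
  by move=> /(qE n)[c _ ->].
have q_cvg t : 0 <= t <= T -> q ^~ t @ \oo --> g t.
  move=> ht; apply/cvgrPdist_lt => d d0.
  have /cvgrPdist_lt/(_ _ d0) := cg t => /nbhs_ballP[r r0 Hr].
  near=> n; have [c /andP[tc ck] ->] := qE n t ht.
  apply: Hr; rewrite /ball/= distrC ger0_norm ?subr_ge0//.
  rewrite ltrBlDl (le_lt_trans ck)// ltrD2l.
  by near: n; exact: (near_infty_natSinv_lt (PosNum r0)).
have q_ac n : abs_continuous 0 T (q n).
  apply: is_derive_abs_continuous (q_der n) _ => t _.
  have : `|n.+1%:R * (g (t + k n) - g t)| <= n.+1%:R * (M + M).
    rewrite normrM ger0_norm// ler_wpM2l//.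
    by rewrite (le_trans (ler_normB _ _))// lerD.
  exact.
have chi_ac n : abs_continuous 0 T (horner (chi n)).
  have [K _ HK] : exists2 K, 0 <= K &
      forall t, 0 <= t <= T -> `|((chi n)^`()).[t]| <= K.
    have cn : {within `[0, T], continuous (horner ((chi n)^`()))}.
      by apply: continuous_subspaceT; exact: continuous_horner.
    exact: within_bounded cn.
  by apply: is_derive_abs_continuous HK => t _; exact: is_derive_poly.
pose v n t := (chi n).[t] * q n t.
pose h n t := (chi n).[t] * (n.+1%:R * (g (t + k n) - g t)) +
  q n t * ((chi n)^`()).[t].
have v_ac n : abs_continuous 0 T (v n) by exact: abs_continuousM.
have [||||n hn] := @dominated_convergence_lt R T (fun n t => (g t - v n t) ^+ 2)
   (fun=> (2 * M) ^+ 2) e _ _ _ _ e0.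
- move=> n; apply/measurable_funX/measurable_funB.
    by apply: measurable_funTS; exact: continuous_measurable_fun.
  exact: abs_continuous_measurable.
- apply: measurable_bounded_integrable => //.
  + exact: muDy.
  + by exists ((2 * M) ^+ 2); split; [exact: num_real|move=> K MK x _;
      rewrite ger0_norm ?sqr_ge0// ltW].
- move=> t t0T; have ht : 0 <= t <= T by case/andP: t0T => ? ?; rewrite !ltW.
  have chi1 : (fun n => (chi n).[t]) @ \oo --> (1 : R).
    pose y : R := (1 - 2 / T * t) ^+ 2.
    have y1 : `|y| < 1.
      have [t0 tltT] := andP t0T.
      have s0 : 0 < t / T by rewrite divr_gt0.
      have s1 : t / T < 1 by rewrite ltr_pdivrMr// mul1r.
      rewrite normrX expr_lt1// mulrAC -mulrA ltr_norml; lra.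
    have -> : (fun n => (chi n).[t]) = (fun n => 1 - y * y ^+ n).
      by apply/funext => n; rewrite chiE -mul2n exprM exprS.
    rewrite -[X in _ --> X]subr0; apply: cvgB; first exact: cvg_cst.
    rewrite -(mulr0 y); apply: cvgM; [exact: cvg_cst|exact: cvg_expr].
  have vt : (fun n => v n t) @ \oo --> g t.
    by rewrite -[g t]mul1r; apply: cvgM => //; exact: q_cvg.
  have dt : (fun n => g t - v n t) @ \oo --> (0 : R).
    by rewrite -(subrr (g t)); apply: cvgB => //; exact: cvg_cst.
  rewrite -[0](mul0r 0); exact: cvgM.
- move=> n t; rewrite /= in_itv/= => /andP[t0 /ltW tT'].
  have ht : 0 <= t <= T by rewrite t0.
  rewrite sqr_ge0/= -real_normK ?num_real// ler_sqr ?nnegrE ?mulr_ge0//.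
  rewrite (le_trans (ler_normB _ _))// mulr_natl mulr2n lerD//.
  rewrite /v normrM -[leRHS]mul1r ler_pM ?q_le//.
  by have /andP[c0 c1] := chi01 n ht; rewrite ger0_norm.
exists (v n), (h n); split => //.
- rewrite /v !chiE mulr0 subr0 expr1n subrr mul0r; split => //.
  rewrite divfK ?gt_eqF//.
  have -> : (1 - 2 : R) = -1 by lra.
  by rewrite -mul2n exprM sqrrN !expr1n subrr mul0r.
- move=> t t0T; have ht : 0 <= t <= T by case/andP: t0T => ? ?; rewrite !ltW.
  have := q_der n t ht => dq.
  exact: (@is_deriveM _ _ (horner (chi n)) (q n) t 1 _ _ _ dq).
- have mg : mfun g by apply: measurable_funTS; exact: continuous_measurable_fun.
  have mgk : mfun (fun t => g (t + k n)).
    apply: measurable_funTS; apply: continuous_measurable_fun => t.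
    apply: continuous_comp; last exact: cg.
    by apply: cvgD; [exact: cvg_id|exact: cvg_cst].
  have cc := @continuous_horner R ((chi n)^`()).
  split.
    apply: measurable_funD; apply: measurable_funM.
    + exact: abs_continuous_measurable.
    + by apply: measurable_funM => //; exact: measurable_funB.
    + exact: abs_continuous_measurable.
    + by apply: measurable_funTS; exact: continuous_measurable_fun.
  have [K K0 HK] : exists2 K, 0 <= K &
      forall t, 0 <= t <= T -> `|((chi n)^`()).[t]| <= K.
    by apply: within_bounded; exact: continuous_subspaceT.
  exists (n.+1%:R * (M + M) + M * K) => t ht.
  rewrite (le_trans (ler_normD _ _))// lerD//.
    rewrite normrM -[leRHS]mul1r ler_pM//.
      by have /andP[c0 c1] := chi01 n ht; rewrite ger0_norm.
    rewrite normrM ger0_norm// ler_wpM2l//.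
    by rewrite (le_trans (ler_normB _ _))// lerD.
  by rewrite normrM ler_pM ?q_le ?HK.
Unshelve. all: by end_near. Qed.

Lemma l2_dense f e : mfun f -> mu.-integrable D (fun x => (f x ^+ 2)%:E) ->
  0 < e -> exists v h, [/\ abs_continuous 0 T v, v 0 = 0 /\ v T = 0,
    forall t, 0 < t < T -> is_derive t (1 : R) v (h t),
    mfun h /\ exists K, forall t, 0 <= t <= T -> `|h t| <= K &
    (sqd T f v < e%:E)%E].
Proof.
move=> mf f2 e0.
(* Two nested uses of [sqd_lt_tri], each dividing the tolerance by 4. *)
have e4 : 0 < e / 4 by rewrite divr_gt0.
have e16 : 0 < e / 4 / 4 by rewrite divr_gt0.
have [M M0 hM] := truncate_approx mf f2 e4.
have mc := measurable_clamp M mf.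
have [g [cg gM hg]] := continuous_approx T0 mc M0 (fun x => clamp_le (f x) M0) e16.
have [v [h [acv v0 dv bh hv]]] := smooth_approx cg gM e16.
have mg : mfun g by apply: measurable_funTS; exact: continuous_measurable_fun.
have mv : mfun v by exact: abs_continuous_measurable.
exists v, h; split => //; apply: (sqd_lt_tri mf mc mv e0 hM).
exact: (sqd_lt_tri mc mg mv e4 hg hv).
Qed.

End SmoothApproximation.

(** * Dirac operators with a bounded weight *)

Section PlaneMatrices.
Context {R : realType}.
Local Notation i0 := (ord0 : 'I_2).
Local Notation i1 := (lift ord0 ord0 : 'I_2).
Local Notation J := (Jmx R).

Lemma sum2 (V : nmodType) (F : 'I_2 -> V) : \sum_i F i = F i0 + F i1.
Proof. by rewrite !big_ord_recl big_ord0 addr0. Qed.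

Lemma ord2P (P : 'I_2 -> Prop) : P i0 -> P i1 -> forall i, P i.
Proof.
move=> p0 p1 i; case: (unliftP ord0 i) => [j ->|-> //].
by rewrite (ord1 j).
Qed.

Lemma mul22E (A B : 'M[R]_2) i j :
  (A *m B) i j = A i i0 * B i0 j + A i i1 * B i1 j.
Proof. by rewrite mxE sum2. Qed.

Lemma mul2cE (A : 'M[R]_2) (v : 'cV[R]_2) i j :
  (A *m v) i j = A i i0 * v i0 j + A i i1 * v i1 j.
Proof. by rewrite mxE sum2. Qed.

Lemma JE : (J i0 i0 = 0) * (J i0 i1 = -1) * (J i1 i0 = 1) * (J i1 i1 = 0).
Proof. by rewrite !mxE/= !subrr sub0r subr0. Qed.

Lemma NJmulE (x : 'cV[R]_2) : ((- (J *m x)) i0 ord0 = x i1 ord0) *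
  ((- (J *m x)) i1 ord0 = - x i0 ord0).
Proof. by split; rewrite [LHS]mxE mul2cE !JE; ring. Qed.

Lemma JJ : J *m J = - 1%:M.
Proof.
apply/matrixP => i j; rewrite mul22E; move: i j.
by do 2!apply: ord2P; rewrite !JE !mxE/=; ring.
Qed.

Lemma dotJE (v w : 'cV[R]_2) :
  (v^T *m J *m w) ord0 ord0 = v i1 ord0 * w i0 ord0 - v i0 ord0 * w i1 ord0.
Proof. by rewrite -mulmxA mxE sum2 !mul2cE !JE !mxE; ring. Qed.

(* Both vectors are multiples of [u]. *)
Lemma dotJ_parallel (u v w : 'cV[R]_2) : u != 0 ->
  (v^T *m J *m u) ord0 ord0 = 0 -> (w^T *m J *m u) ord0 ord0 = 0 ->
  (v^T *m J *m w) ord0 ord0 = 0.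
Proof.
rewrite !dotJE => u0 hv hw.
have [a0|a0] := eqVneq (u i0 ord0) 0; last first.
  apply: (mulfI a0); rewrite mulr0.
  transitivity (w i0 ord0 * (v i1 ord0 * u i0 ord0 - v i0 ord0 * u i1 ord0) -
    v i0 ord0 * (w i1 ord0 * u i0 ord0 - w i0 ord0 * u i1 ord0)).
    by ring.
  by rewrite hv hw !mulr0 subrr.
have a1 : u i1 ord0 != 0.
  apply: contra_neq u0 => u1; apply/matrixP => i j.
  by rewrite (ord1 j) [RHS]mxE; move: i; apply: ord2P.
apply: (mulfI a1); rewrite mulr0.
transitivity (w i1 ord0 * (v i1 ord0 * u i0 ord0 - v i0 ord0 * u i1 ord0) -
  v i1 ord0 * (w i1 ord0 * u i0 ord0 - w i0 ord0 * u i1 ord0)).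
  by ring.
by rewrite hv hw !mulr0 subrr.
Qed.

Lemma wdotE (W : R -> 'M[R]_2) v w t : wdot W v w t =
  v t i0 ord0 * (W t *m w t) i0 ord0 + v t i1 ord0 * (W t *m w t) i1 ord0.
Proof. by rewrite /wdot -mulmxA mxE sum2 !mxE. Qed.

Lemma wdot_sym (W : R -> 'M[R]_2) v w t : (W t)^T = W t ->
  wdot W v w t =
  w t i0 ord0 * (W t *m v t) i0 ord0 + w t i1 ord0 * (W t *m v t) i1 ord0.
Proof.
move=> Ws; rewrite wdotE !mul2cE.
have -> : W t i1 i0 = W t i0 i1 by rewrite -[in LHS]Ws mxE.
by ring.
Qed.

Lemma intvE (T : R) : intv T%:E = `[0, T[%classic.
Proof. by apply/seteqP; split => t /=; rewrite in_itv/= => /andP. Qed.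

(** The hypothesis says that [- J *m Y^T *m J] is a left inverse of [Y]; for square matrices it is
    then a right inverse. *)
Lemma symplectic_tr (Y : 'M[R]_2) : Y^T *m J *m Y = J -> Y *m J *m Y^T = J.
Proof.
move=> YJ.
have : (- J *m Y^T *m J) *m Y = 1%:M.
  by rewrite -!mulmxA [Y^T *m _]mulmxA YJ mulNmx JJ opprK.
move=> /mulmx1C; rewrite !mulmxA mulmxN !mulNmx => h.
have : (Y *m J *m Y^T *m J) *m J = - J.
  by rewrite -[_ *m J in X in X *m J]opprK h mulNmx mul1mx.
by rewrite -mulmxA JJ mulmxN mulmx1 => /oppr_inj.
Qed.

End PlaneMatrices.

(** * Square-integrable functions on a bounded interval *)

Section SquareIntegrable.
Context {R : realType}.
Local Notation mu := (@lebesgue_measure R).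
Variable T : R.
Hypothesis T0 : 0 < T.
Local Notation D := (`[0, T[%classic : set (measurableTypeR R)).
Local Notation mfun f := (measurable_fun D (f : measurableTypeR R -> R)).
Implicit Types f g h : R -> R.

Let mD : measurable D. Proof. exact: measurable_itv. Qed.

Definition sqint f := mfun f /\ mu.-integrable D (fun x => (f x ^+ 2)%:E).

Lemma le_integrableR f g : mfun f -> (forall x, D x -> `|f x| <= g x) ->
  mu.-integrable D (EFin \o g) -> mu.-integrable D (EFin \o f).
Proof.
move=> mf fg; apply: le_integrable => //; first exact/measurable_EFinP.
move=> x Dx; rewrite /= lee_fin (le_trans (fg x Dx))//; exact: ler_norm.
Qed.

Lemma integrableDR f g : mu.-integrable D (EFin \o f) ->
  mu.-integrable D (EFin \o g) -> mu.-integrable D (EFin \o (f \+ g)).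
Proof. by move=> fi gi; apply: eq_integrable (integrableD _ fi gi). Qed.

Lemma integrableZR k f : mu.-integrable D (EFin \o f) ->
  mu.-integrable D (EFin \o (fun x => k * f x)).
Proof. by move=> fi; apply: eq_integrable (integrableZl _ k fi). Qed.

Lemma integrableBR f g : mu.-integrable D (EFin \o f) ->
  mu.-integrable D (EFin \o g) -> mu.-integrable D (EFin \o (f \- g)).
Proof. by move=> fi gi; apply: eq_integrable (integrableB _ fi gi). Qed.

Lemma sqintM f g : sqint f -> sqint g ->
  mu.-integrable D (EFin \o (fun x => f x * g x)).
Proof.
move=> [mf f2] [mg g2]; apply: le_integrableR (integrableDR f2 g2).
  exact: measurable_funM.
move=> x _ /=; rewrite ler_norml -subr_ge0; apply/andP; split.
  have -> : f x * g x - - (f x ^+ 2 + g x ^+ 2) =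
    ((f x + g x) ^+ 2 + f x ^+ 2 + g x ^+ 2) / 2 by field.
  by rewrite divr_ge0// !addr_ge0// sqr_ge0.
rewrite -subr_ge0.
have -> : f x ^+ 2 + g x ^+ 2 - f x * g x =
    ((f x - g x) ^+ 2 + f x ^+ 2 + g x ^+ 2) / 2 by field.
by rewrite divr_ge0// !addr_ge0// sqr_ge0.
Qed.

Lemma bounded_sqint f K : mfun f -> (forall x, D x -> `|f x| <= K) -> sqint f.
Proof.
move=> mf fK; split => //.
apply: (@le_integrableR (fun x => f x ^+ 2) (fun=> K ^+ 2)).
- exact: measurable_funX.
- move=> x Dx; have := fK x Dx; rewrite normrX => h.
  by rewrite ler_pXn2r// nnegrE// (le_trans _ h).
- apply: measurable_bounded_integrable => //; first exact: muDy.
  by exists (K ^+ 2); split; [exact: num_real|move=> M KM x _;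
    rewrite ger0_norm ?sqr_ge0// ltW].
Qed.

Lemma sqint_integrable f : sqint f -> mu.-integrable D (EFin \o f).
Proof.
move=> sf; have s1 : sqint (cst 1).
  by apply: (@bounded_sqint _ 1) => // x _; rewrite normr1.
by apply: eq_integrable (sqintM sf s1) => // x _ /=; rewrite mulr1.
Qed.

Lemma sqintMb f g K : mfun g -> (forall x, D x -> `|g x| <= K) -> sqint f ->
  sqint (fun x => g x * f x).
Proof.
move=> mg gK [mf f2]; split; first exact: measurable_funM.
apply: (@le_integrableR (fun x => (g x * f x) ^+ 2)) (integrableZR (K ^+ 2) f2).
  exact/measurable_funX/measurable_funM.
move=> x Dx; rewrite ger0_norm ?sqr_ge0// exprMn ler_wpM2r ?sqr_ge0//.
have := gK x Dx => h; rewrite -real_normK ?num_real//.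
by rewrite ler_pXn2r// nnegrE// (le_trans _ h).
Qed.

Lemma sqintZ k f : sqint f -> sqint (fun x => k * f x).
Proof. by apply: (@sqintMb _ _ `|k|). Qed.

Lemma sqintD f g : sqint f -> sqint g -> sqint (f \+ g).
Proof.
move=> sf sg; have [[mf f2] [mg g2]] := (sf, sg).
split; first exact: measurable_funD.
have := integrableDR (integrableDR f2 g2) (integrableZR 2 (sqintM sf sg)).
by apply: eq_integrable => // x _ /=; congr EFin; ring.
Qed.

Lemma sqintB f g : sqint f -> sqint g -> sqint (f \- g).
Proof.
move=> sf sg; have := sqintD sf (sqintZ (-1) sg).
congr sqint; apply/funext => x /=; by rewrite mulN1r.
Qed.

Lemma abs_continuous_sqint f : abs_continuous 0 T f -> sqint f.
Proof.
move=> acf; have [K _ HK] := abs_continuous_bounded acf.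
apply: (@bounded_sqint _ K); first exact: abs_continuous_measurable.
by move=> x; rewrite /= in_itv/= => /andP[x0 /ltW xT]; apply: HK; rewrite x0.
Qed.

Lemma integrable_closed h : mu.-integrable D (EFin \o h) ->
  mu.-integrable `[0, T] (EFin \o h).
Proof.
move=> ih; have mh : mfun h by move: (measurable_int mu ih) => /measurable_EFinP.
have [||||_ ] := @negligible_integrable _ (measurableTypeR R) R mu `[0, T]
   [set T] (EFin \o h).
- exact: measurable_set1.
- exact: measurable_itv.
- by apply/measurable_EFinP/measurable_fun_itv_bndo_bndcP.
- exact: lebesgue_measure_set1.
apply; rewrite (_ : _ `\` _ = D)//; apply/seteqP.
split => x /=; rewrite !in_itv/=.
  by move=> [/andP[-> xT] /eqP nx]; rewrite lt_neqAle nx.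
move=> /andP[-> xT]; split; first exact: ltW.
by move=> xE; rewrite xE ltxx in xT.
Qed.

(** Expand the nonnegative integral of [(f - k) ^+ 2] at the mean [k = I / T], where it is
    smallest. *)
Lemma cauchy_schwarz f : sqint f ->
  (\int[mu]_(x in D) f x) ^+ 2 <= T * \int[mu]_(x in D) (f x ^+ 2).
Proof.
move=> sf; have fi := sqint_integrable sf; have [mf f2] := sf.
set I := \int[mu]_(x in D) f x; set S := \int[mu]_(x in D) (f x ^+ 2).
pose k := I / T.
have ck : mu.-integrable D (EFin \o cst (k ^+ 2)).
  apply: measurable_bounded_integrable => //; first exact: muDy.
  by exists (k ^+ 2); split; [exact: num_real|move=> M KM x _;
    rewrite /= ger0_norm ?sqr_ge0// ltW].
have : 0 <= \int[mu]_(x in D) ((f x ^+ 2 + (- (2 * k)) * f x) + cst (k ^+ 2) x).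
  apply: Rintegral_ge0 => x _ /=.
  have -> : f x ^+ 2 + - (2 * k) * f x + k ^+ 2 = (f x - k) ^+ 2 by ring.
  exact: sqr_ge0.
have i1' := integrableZR (- (2 * k)) fi.
rewrite RintegralD//; last exact: integrableDR f2 i1'.
rewrite RintegralD// RintegralZl// Rintegral_cst//.
rewrite (_ : fine (mu D) = T); last by rewrite muD.
rewrite -/I -/S => h.
have Tn : T != 0 by rewrite gt_eqF.
have : 0 <= T * (S + - (2 * k) * I + k ^+ 2 * T) by rewrite mulr_ge0// ltW.
have -> : T * (S + - (2 * k) * I + k ^+ 2 * T) = T * S - I ^+ 2.
  by rewrite /k; field.
by rewrite subr_ge0.
Qed.

End SquareIntegrable.

(** * Self-adjointness and spectrum for a weight bounded above and below *)

Section DiracOperator.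
Context {R : realType}.
Local Notation mu := (@lebesgue_measure R).
Local Notation i0 := (ord0 : 'I_2).
Local Notation i1 := (lift ord0 ord0 : 'I_2).
Local Notation J := (Jmx R).
Variable T : R.
Hypothesis T0 : 0 < T.
Local Notation D := (`[0, T[%classic : set (measurableTypeR R)).
Local Notation mfun f := (measurable_fun D (f : measurableTypeR R -> R)).

Let mD : measurable D. Proof. exact: measurable_itv. Qed.

(** An integrable derivative has a primitive on the closed interval, and on [[0, T)] the function
    differs from it by the constant [f 0]. Domain functions thus get a value at [T], which replaces
    the limit in the boundary condition. *)
Lemma loc_abs_continuous_ext (f h : R -> R) : loc_abs_continuous T%:E f ->
  mu.-integrable D (EFin \o h) ->
  {ae mu, forall t : R, 0 < t < T -> is_derive t (1 : R) f (h t)} ->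
  exists F : R -> R, [/\ abs_continuous 0 T F, forall t, 0 <= t < T -> F t = f t &
    {ae mu, forall t : R, 0 < t < T -> is_derive t (1 : R) F (h t)}].
Proof.
move=> acf ih df; have ih' := integrable_closed ih.
have [F [acF F0 FE dF]] := primitive_ex ih'.
exists (fun t => f 0 + F t); split.
- exact: abs_continuousD (@abs_continuous_cst R 0 T (f 0)) acF.
- move=> t /andP[t0 tT]; rewrite FE ?ltW//.
  have [->|tn0] := eqVneq t 0; first by rewrite set_itv1 Rintegral_set1 addr0.
  have t0' : 0 < t by rewrite lt_neqAle eq_sym tn0.
  rewrite (@abs_continuous_FTC _ t f h t0' _ _ _ t) ?t0 ?lexx//.
  + by apply: acf; rewrite intvE /= in_itv/= t0.
  + apply: integrableS ih'; [exact: measurable_itv|exact: measurable_itv|].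
    by apply: subset_itvl; rewrite bnd_simp ltW.
  + apply: ae_sub df => s hs /andP[s0 st]; apply: hs.
    by rewrite s0 (lt_trans st).
- apply: ae_sub dF => t ht /ht dt.
  have := @is_deriveD _ _ _ (cst (f 0)) F t 1 0 _ _ dt.
  by rewrite add0r; apply; exact: is_derive_cst.
Qed.

Lemma abs_continuous_left (f : R -> R) : abs_continuous 0 T f ->
  f s @[s --> T^'-] --> f T.
Proof.
by move=> /abs_continuous_within /(continuous_within_itvP _ T0)[].
Qed.

Variables W V : R -> 'M[R]_2.
Variables m M : R.
Hypothesis m0 : 0 < m.
Hypothesis mW : forall i j, mfun (fun t => W t i j).
Hypothesis mV : forall i j, mfun (fun t => V t i j).
Hypothesis WV : forall t, W t *m V t = 1%:M.
Hypothesis Wsym : forall t, (W t)^T = W t.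
Hypothesis WM : forall t i j, D t -> `|W t i j| <= M.
Hypothesis VM : forall t i j, D t -> `|V t i j| <= M.
Hypothesis Wm : forall t (x : 'cV[R]_2), D t ->
  m * (x i0 ord0 ^+ 2 + x i1 ord0 ^+ 2) <= (x^T *m W t *m x) ord0 ord0.

Local Notation sq v := (forall i, sqint T (fun t => v t i ord0)).
Implicit Types v w g h : R -> 'cV[R]_2.

Lemma sq_mul K (A : R -> 'M[R]_2) w : (forall i j, mfun (fun t => A t i j)) ->
  (forall t i j, D t -> `|A t i j| <= K) -> sq w ->
  sq (fun t => A t *m w t).
Proof.
move=> mA AM sw i.
have -> : (fun t => (A t *m w t) i ord0) =
   (fun t => A t i i0 * w t i0 ord0) \+ (fun t => A t i i1 * w t i1 ord0).
  by apply/funext => t; rewrite mul2cE.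
by apply: sqintD; apply: (@sqintMb _ _ _ _ K) => // t Dt; exact: AM.
Qed.

Lemma wdot_integrable v w : sq v -> sq w ->
  mu.-integrable D (EFin \o wdot W v w).
Proof.
move=> sv sw; have sWw := sq_mul mW WM sw.
have := integrableDR (sqintM (sv i0) (sWw i0)) (sqintM (sv i1) (sWw i1)).
by apply: eq_integrable => // t _ /=; rewrite wdotE.
Qed.

(** [Wm] bounds the weighted square from below and [WM] from above, so the weight does not affect
    membership. *)
Lemma L2P v : L2 T%:E W v <-> sq v.
Proof.
split=> [[mv iv] i|sv].
  rewrite intvE in mv iv; split; first exact: mv.
  have iv' := integrableZR m^-1 iv.
  apply: le_integrableR iv'; first by apply: measurable_funX; exact: mv.
  move=> t Dt; rewrite ger0_norm ?sqr_ge0// ler_pdivlMl//.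
  apply: le_trans (Wm (v t) Dt); rewrite ler_pM2l//; move: i.
  by apply: ord2P; rewrite ?lerDl ?lerDr sqr_ge0.
split; rewrite intvE; first by move=> i; have [] := sv i.
exact: wdot_integrable.
Qed.

Lemma ipE v w : ip T%:E W v w = \int[mu]_(t in D) wdot W v w t.
Proof. by rewrite /ip intvE. Qed.

Lemma ipC v w : ip T%:E W v w = ip T%:E W w v.
Proof.
rewrite !ipE; apply: eq_Rintegral => t _.
by rewrite (wdot_sym v w (Wsym t)) wdotE.
Qed.

Lemma ip_ael v v' w : sq v -> sq v' -> sq w -> L2_eq T%:E v v' ->
  ip T%:E W v w = ip T%:E W v' w.
Proof.
move=> sv sv' sw vv'; rewrite !ipE /Rintegral; congr fine.
apply: ae_eq_integral => //.
- exact: (measurable_int mu (wdot_integrable sv sw)).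
- exact: (measurable_int mu (wdot_integrable sv' sw)).
- apply: ae_sub vv' => t h Dt; rewrite intvE in h.
  by rewrite /wdot h.
Qed.

Lemma ip_aer v w w' : sq v -> sq w -> sq w' -> L2_eq T%:E w w' ->
  ip T%:E W v w = ip T%:E W v w'.
Proof. by move=> sv sw sw' ww'; rewrite ipC (ip_ael _ sw' _ ww')// ipC. Qed.

(** Multiplying by [W t] and by the inverse [- J] of [J] gives [v' = - J W w], whose two components
    are listed. *)
Lemma odeP v w t :
  (derivable v t 1 /\ w t = invmx (W t) *m J *m v^`()%classic t) <->
  (is_derive t (1 : R) (fun s => v s i0 ord0) ((W t *m w t) i1 ord0) /\
   is_derive t (1 : R) (fun s => v s i1 ord0) (- (W t *m w t) i0 ord0)).
Proof.
have [Wu _] := mulmx1_unit (WV t).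
split.
  move=> [dv ->].
  rewrite -!mulmxA mulKVmx// !mul2cE !JE !mul0r add0r addr0 mul1r mulN1r opprK.
  rewrite derive1E derive_mx// !mxE.
  by have /derivable_mxP dv' := dv; split; exact: derivableP.
move=> [d0 d1].
have dv : derivable v t 1.
  by apply/derivable_mxP => i j; rewrite (ord1 j); move: i; apply: ord2P;
    exact: ex_derive.
split => //; rewrite derive1E derive_mx// -mulmxA.
rewrite -[LHS](mulKmx Wu); congr (_ *m _).
apply/matrixP => i j; rewrite (ord1 j); move: i.
have e0 := derive_val (is_derive := d0); have e1 := derive_val (is_derive := d1).
by apply: ord2P; rewrite [RHS]mul2cE !JE [X in _ * X + _]mxE [X in _ + _ * X]mxE e0 e1; ring.
Qed.

Lemma measurable_bigmaxr (I : Type) (s : seq I) (f : I -> R -> R) :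
  (forall i, mfun (f i)) -> mfun (fun t => \big[Num.max/0]_(i <- s) f i t).
Proof.
move=> mf; elim: s => [|i s IH].
  rewrite (_ : (fun=> _) = cst 0); first exact: measurable_cst.
  by apply/funext => t; rewrite big_nil.
rewrite (_ : (fun=> _) = (fun t => Num.max (f i t)
    (\big[Num.max/0]_(j <- s) f j t))); first exact: measurable_maxr.
by apply/funext => t; rewrite big_cons.
Qed.

(** Discharges the premise in [boundary_cond], so that the condition at [T] is in force. *)
Lemma W_norm_integrable :
  mu.-integrable (intv T%:E) (fun t => (`|W t|)%:E).
Proof.
rewrite intvE; apply: measurable_bounded_integrable => //; first exact: muDy.
  have -> : (fun t => `|W t|) =
      fun t => \big[Num.max/0]_(x : 'I_2 * 'I_2) `|W t x.1 x.2|.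
    by apply/funext => t; rewrite [LHS]mx_normrE.
  by apply: measurable_bigmaxr => x; exact: measurableT_comp.
exists M; split; [exact: num_real|move=> K MK t Dt].
rewrite /= ger0_norm ?normr_ge0// (le_trans _ (ltW MK))//.
rewrite [leLHS]mx_normrE bigmax_le//.
  exact: le_trans (WM i0 i0 Dt).
by move=> x _; exact: WM.
Qed.

Variables u0 u1 : 'cV[R]_2.
Hypothesis u00 : u0 != 0.
Hypothesis u10 : u1 != 0.

Local Notation A := (dirac_op T%:E W u0 u1).

Definition ode v w := {ae mu, forall t : R, 0 < t < T ->
   is_derive t (1 : R) (fun s => v s i0 ord0) ((W t *m w t) i1 ord0) /\
   is_derive t (1 : R) (fun s => v s i1 ord0) (- (W t *m w t) i0 ord0)}.

(* The closed-interval normal form of a pair in the graph. *)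
Definition graph_pair v w := [/\
  forall i, abs_continuous 0 T (fun t => v t i ord0), sq w, ode v w,
  ((v 0)^T *m J *m u0) ord0 ord0 = 0 & ((v T)^T *m J *m u1) ord0 ord0 = 0].

Lemma bc_left v : (forall i, abs_continuous 0 T (fun t => v t i ord0)) ->
  ((v s)^T *m J *m u1) ord0 ord0 @[s --> T^'-] -->
    ((v T)^T *m J *m u1) ord0 ord0.
Proof.
move=> acv; rewrite dotJE.
have -> : (fun s => ((v s)^T *m J *m u1) ord0 ord0) =
    (fun s => v s i1 ord0 * u1 i0 ord0 - v s i0 ord0 * u1 i1 ord0).
  by apply/funext => s; rewrite dotJE.
by apply: cvgB; apply: cvgMl; exact: abs_continuous_left (acv _).
Qed.

Lemma ae_neq (a : R) : {ae mu, forall t : R, t != a}.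
Proof.
exists [set a]; split; [exact: measurable_set1|exact: lebesgue_measure_set1|].
by move=> t /= /negP; rewrite negbK => /eqP.
Qed.

(** A locally absolutely continuous representative extends to [[0, T]], because its derivative
    [- J W w] is square integrable. By continuity the limit condition at [T] is the equation for the
    extended value. *)
Lemma graph_pairP v w : A v w <->
  sq v /\ exists2 v0, L2_eq T%:E v v0 & graph_pair v0 w.
Proof.
split=> [[/L2P sv [v0 vv0 [acv /L2P sv0 /L2P sw odev [bc0 bcT]]]]|].
  split=> //.
  have odev' : ode v0 w.
    apply: ae_sub odev => t ht /andP[t0 tT]; apply/odeP/ht.
    by rewrite intvE /= in_itv/= ltW.
  have sWw := sq_mul mW WM sw.
  have ode0 : {ae mu, forall t : R, 0 < t < T ->
      is_derive t (1 : R) (fun s => v0 s i0 ord0) ((W t *m w t) i1 ord0)}.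
    by apply: ae_sub odev' => t ht /ht[].
  have ode1 : {ae mu, forall t : R, 0 < t < T ->
      is_derive t (1 : R) (fun s => v0 s i1 ord0) (- (W t *m w t) i0 ord0)}.
    by apply: ae_sub odev' => t ht /ht[].
  have [F0 [acF0 F0E dF0]] := loc_abs_continuous_ext (acv i0)
    (sqint_integrable T0 (sWw i1)) ode0.
  have iN : mu.-integrable D (EFin \o (fun t => - (W t *m w t) i0 ord0)).
    have := integrableZR (-1) (sqint_integrable T0 (sWw i0)).
    by apply: eq_integrable => // t _ /=; rewrite mulN1r.
  have [F1 [acF1 F1E dF1]] := loc_abs_continuous_ext (acv i1) iN
    ode1.
  pose F t : 'cV[R]_2 := \col_i (if i == i0 then F0 t else F1 t).
  have Fi0 : (fun t => F t i0 ord0) = F0 by apply/funext => t; rewrite mxE.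
  have Fi1 : (fun t => F t i1 ord0) = F1 by apply/funext => t; rewrite mxE.
  have Fv t : 0 <= t < T -> F t = v0 t.
    move=> ht; apply/matrixP => i j; rewrite (ord1 j); move: i.
    by apply: ord2P; rewrite mxE/= (F0E, F1E).
  exists F.
    move: vv0; rewrite /L2_eq /ae_on; apply: ae_sub => t h ht; rewrite h// Fv//.
    by move: ht; rewrite intvE /= in_itv.
  split.
  - by apply: ord2P; rewrite (Fi0, Fi1).
  - exact: sw.
  - by apply: ae_sub2 dF0 dF1 => t h0 h1 ht; rewrite Fi0 Fi1; split; auto.
  - by rewrite Fv// lexx.
  - have := bcT W_norm_integrable.
    have cF : ((F s)^T *m J *m u1) ord0 ord0 @[s --> T^'-] -->
       ((F T)^T *m J *m u1) ord0 ord0.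
      by apply: bc_left; apply: ord2P; rewrite (Fi0, Fi1).
    move=> cv; apply: (cvg_unique _ cF); first exact: Rhausdorff.
    apply: cvg_trans cv; apply: near_eq_cvg; near=> s.
    rewrite Fv//; apply/andP; split; last by near: s; exact: nbhs_left_lt.
    by near: s; apply: nbhs_left_ge.
move=> [sv [v0 vv0 [acv sw odev bc0 bcT]]].
have sv0 : sq v0 by move=> i; exact: abs_continuous_sqint.
split; first exact/L2P.
exists v0 => //; split => //.
- move=> i s; rewrite intvE /= in_itv/= => /andP[s0 sT].
  by apply: abs_continuousS (acv i) => //; exact: ltW.
- exact/L2P.
- exact/L2P.
- apply: ae_sub2 odev (ae_neq 0) => t ht t0.
  rewrite intvE /= in_itv/= => /andP[tge0 tT]; apply/odeP; apply: ht.
  by rewrite lt_neqAle eq_sym t0 tge0.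
- split => // _; rewrite -bcT; exact: bc_left.
Unshelve. all: by end_near. Qed.

Lemma graph_pair_op v w : graph_pair v w -> A v w.
Proof.
move=> gp; have [acv _ _ _ _] := gp; apply/graph_pairP.
split; first by move=> i; exact: abs_continuous_sqint.
by exists v => //; apply: aeW.
Qed.

(** Lagrange's identity: the Wronskian [B] has derivative [wdot W g w - wdot W v h]. It vanishes at
    0, where both functions are parallel to [u0], and at [T], where both are parallel to [u1]. *)
Lemma graph_pair_sym v w g h : graph_pair v w -> graph_pair g h ->
  ip T%:E W w g = ip T%:E W v h.
Proof.
move=> [acv sw odev v0 vT] [acg sh odeg g0 gT].
have sv : sq v by move=> i; exact: abs_continuous_sqint.
have sg : sq g by move=> i; exact: abs_continuous_sqint.
pose B t := v t i0 ord0 * g t i1 ord0 - v t i1 ord0 * g t i0 ord0.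
have BE t : B t = - ((v t)^T *m J *m g t) ord0 ord0.
  by rewrite dotJE /B opprB.
have acB : abs_continuous 0 T B.
  by apply: abs_continuousB; apply: abs_continuousM.
have iB : mu.-integrable D (EFin \o (wdot W g w \- wdot W v h)).
  by apply: integrableBR; exact: wdot_integrable.
have dB : {ae mu, forall t : R, 0 < t < T ->
    is_derive t (1 : R) B ((wdot W g w \- wdot W v h) t)}.
  apply: ae_sub2 odev odeg => t hv hg /[dup] /hv [dv0 dv1] /hg [dg0 dg1].
  have d1 := is_deriveB (is_deriveM dv0 dg1) (is_deriveM dv1 dg0).
  apply: is_derive_eq; rewrite /= !wdotE /GRing.scale/=; ring.
have := abs_continuous_FTC T0 acB (integrable_closed iB) dB (s := T).
rewrite lexx ltW// => /(_ isT).
rewrite !BE (dotJ_parallel u10 vT gT) (dotJ_parallel u00 v0 g0) oppr0 add0r.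
rewrite -Rintegral_itv_bndo_bndc// RintegralB//; last 2 first.
- exact: wdot_integrable.
- exact: wdot_integrable.
by move/esym/eqP; rewrite subr_eq0 [in ip _ _ w g]ipC !ipE => /eqP.
Qed.

Lemma dirac_op_sq v w : A v w -> sq v /\ sq w.
Proof. by move=> /graph_pairP[sv [v0 _ [_ sw _ _ _]]]. Qed.

Lemma dirac_op_sym v w g h : A v w -> A g h -> ip T%:E W w g = ip T%:E W v h.
Proof.
move=> Avw Agh; have [sv sw] := dirac_op_sq Avw; have [sg sh] := dirac_op_sq Agh.
move: Avw Agh => /graph_pairP[_ [v0 vv0 gp]] /graph_pairP[_ [g0 gg0 gp']].
have sv0 : sq v0 by case: gp => acv _ _ _ _ i; exact: abs_continuous_sqint.
have sg0 : sq g0 by case: gp' => acv _ _ _ _ i; exact: abs_continuous_sqint.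
by rewrite (ip_aer sw sg sg0 gg0) (ip_ael sv sv0 sh vv0) (graph_pair_sym gp gp').
Qed.

Lemma dirac_op_aer v w w' : A v w -> sq w' -> L2_eq T%:E w w' -> A v w'.
Proof.
move=> /graph_pairP[sv [v0 vv0 [acv sw odev b0 bT]]] sw' ww'.
apply/graph_pairP; split => //; exists v0 => //; split => //.
apply: ae_sub2 odev ww' => t ht ht' /[dup] /ht h t0T.
rewrite -ht'// intvE /= in_itv/=; by have /andP[/ltW -> ->] := t0T.
Qed.

Lemma dirac_op_ael v v' w : A v w -> sq v' -> L2_eq T%:E v' v -> A v' w.
Proof.
move=> /graph_pairP[sv [v0 vv0 gp]] sv' v'v.
apply/graph_pairP; split => //; exists v0 => //.
by apply: ae_sub2 v'v vv0 => t h1 h2 ht; rewrite h1// h2.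
Qed.

Lemma sq_lin a g h : sq g -> sq h -> sq (fun t => g t - a *: h t).
Proof.
move=> sg sh i.
have -> : (fun t => (g t - a *: h t) i ord0) =
  (fun t => g t i ord0) \- (fun t => a * h t i ord0).
  by apply/funext => t; rewrite !mxE.
by apply: sqintB => //; exact: sqintZ.
Qed.

Lemma dirac_op_sub a v w g h : A v w -> A g h ->
  A (fun t => v t - a *: g t) (fun t => w t - a *: h t).
Proof.
move=> Avw Agh; have [sv sw] := dirac_op_sq Avw; have [sg sh] := dirac_op_sq Agh.
move: Avw Agh => /graph_pairP[_ [v0 vv0 gp]] /graph_pairP[_ [g0 gg0 gp']].
apply/graph_pairP; split; first exact: sq_lin.
exists (fun t => v0 t - a *: g0 t).
  by apply: ae_sub2 vv0 gg0 => t h1 h2 ht; rewrite h1// h2.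
case: gp gp' => [acv _ odev v00 vT] [acg _ odeg g00 gT].
have cE (x y : 'cV[R]_2) i : (x - a *: y) i ord0 = x i ord0 - a * y i ord0.
  by rewrite !mxE.
have fE i : (fun t => (v0 t - a *: g0 t) i ord0) =
    (fun t => v0 t i ord0) \- (a \*: (fun t => g0 t i ord0)).
  by apply/funext => t; rewrite cE.
split.
- move=> i; rewrite fE; apply: abs_continuousB => //.
  exact: abs_continuousZ.
- exact: sq_lin.
- apply: ae_sub2 odev odeg => t hv hg /[dup] /hv [dv0 dv1] /hg [dg0 dg1].
  rewrite !fE; split.
    apply: is_derive_eq (is_deriveB dv0 (is_deriveZ a dg0)) _.
    by rewrite mulmxBr -scalemxAr cE.
  apply: is_derive_eq (is_deriveB dv1 (is_deriveZ a dg1)) _.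
  by rewrite mulmxBr -scalemxAr cE /GRing.scale/=; ring.
- move: v00 g00; rewrite !dotJE !cE => e1 e2.
  transitivity (v0 0 i1 ord0 * u0 i0 ord0 - v0 0 i0 ord0 * u0 i1 ord0 -
    a * (g0 0 i1 ord0 * u0 i0 ord0 - g0 0 i0 ord0 * u0 i1 ord0)); first by ring.
  by rewrite e1 e2 mulr0 subr0.
- move: vT gT; rewrite !dotJE !cE => e1 e2.
  transitivity (v0 T i1 ord0 * u1 i0 ord0 - v0 T i0 ord0 * u1 i1 ord0 -
    a * (g0 T i1 ord0 * u1 i0 ord0 - g0 T i0 ord0 * u1 i1 ord0)); first by ring.
  by rewrite e1 e2 mulr0 subr0.
Qed.

Lemma ip_linl a v w g : sq v -> sq w -> sq g ->
  ip T%:E W (fun t => v t - a *: w t) g = ip T%:E W v g - a * ip T%:E W w g.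
Proof.
move=> sv sw sg; rewrite !ipE -RintegralZl//; last exact: wdot_integrable.
rewrite -RintegralB//; last 2 first.
- exact: wdot_integrable.
- by apply: integrableZR; exact: wdot_integrable.
by apply: eq_Rintegral => t _; rewrite !wdotE !mxE; ring.
Qed.

Lemma ip_linr a v w g : sq v -> sq w -> sq g ->
  ip T%:E W g (fun t => v t - a *: w t) = ip T%:E W g v - a * ip T%:E W g w.
Proof.
by move=> sv sw sg; rewrite ipC ip_linl// (ipC v) (ipC w).
Qed.

Lemma wdot_ge v t : D t ->
  m * (v t i0 ord0 ^+ 2 + v t i1 ord0 ^+ 2) <= wdot W v v t.
Proof. exact: Wm. Qed.

Lemma wdot_ge0 v t : D t -> 0 <= wdot W v v t.
Proof.
move=> Dt; apply: le_trans (wdot_ge v Dt).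
by rewrite mulr_ge0 ?addr_ge0 ?sqr_ge0// ltW.
Qed.

Lemma ip_ge0 v : 0 <= ip T%:E W v v.
Proof. by rewrite ipE; apply: Rintegral_ge0 => t; exact: wdot_ge0. Qed.

Lemma ip_eq0 v : sq v -> ip T%:E W v v = 0 -> L2_eq T%:E v (fun=> 0).
Proof.
move=> sv; rewrite ipE /Rintegral => ip0.
have iv := wdot_integrable sv sv.
have : (\int[mu]_(t in D) `|(wdot W v v t)%:E| = 0)%E.
  have e : (\int[mu]_(t in D) (wdot W v v t)%:E = 0)%E.
    by rewrite -[LHS]fineK ?ip0//; exact: integrable_fin_num.
  by rewrite -[RHS]e; apply: eq_integral => t; rewrite inE => Dt;
    rewrite gee0_abs ?lee_fin ?wdot_ge0.
move/(ae_eq_integral_abs mu mD (measurable_int mu iv)).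
rewrite /L2_eq /ae_on; apply: ae_sub => t h; rewrite intvE => Dt.
have := wdot_ge v Dt; have /= [->] := h Dt.
rewrite pmulr_rle0// => h0.
have e0 : v t i0 ord0 ^+ 2 = 0.
  have := sqr_ge0 (v t i1 ord0); have := sqr_ge0 (v t i0 ord0); lra.
have e1 : v t i1 ord0 ^+ 2 = 0.
  have := sqr_ge0 (v t i1 ord0); have := sqr_ge0 (v t i0 ord0); lra.
apply/matrixP => i j; rewrite (ord1 j) mxE; move: i.
by apply: ord2P; apply/eqP; rewrite -sqrf_eq0 (e0, e1).
Qed.

Variable Y : R -> R -> 'M[R]_2.
Hypothesis acY : forall l i j, abs_continuous 0 T (fun t => Y l t i j).
Hypothesis dY : forall l, {ae mu, forall t : R, 0 < t < T -> forall i j,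
  is_derive t (1 : R) (fun s => Y l s i j) ((- l *: (J *m W t *m Y l t)) i j)}.
Hypothesis Y0 : forall l, Y l 0 = 1%:M.
Hypothesis YJ : forall l t, (Y l t)^T *m J *m Y l t = J.

(** Characteristic function of the boundary problem. [Y l] is the fundamental matrix of
    [tau v = l v], so [Y l t *m u0] is the solution meeting the condition at 0, and [chi l] measures
    how far it misses the one at [T]. *)
Definition chi l := ((Y l T *m u0)^T *m J *m u1) ord0 ord0.

Lemma Y_bounded l : exists2 K, 0 <= K &
  forall t i j, 0 <= t <= T -> `|Y l t i j| <= K.
Proof.
have [a a0 ha] := abs_continuous_bounded (acY l i0 i0).
have [b b0 hb] := abs_continuous_bounded (acY l i0 i1).
have [c c0 hc] := abs_continuous_bounded (acY l i1 i0).
have [d d0 hd] := abs_continuous_bounded (acY l i1 i1).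
exists (a + b + c + d) => [|t i j ht]; first by rewrite !addr_ge0.
have := ha t ht; have := hb t ht; have := hc t ht; have := hd t ht.
by move: i j; do 2!apply: ord2P; lra.
Qed.

(* Variation of constants: [v = Y (c - J G)] with [G' = Y^T W g]. *)
Lemma variation_of_constants l v g (c : 'cV[R]_2) (G : R -> 'cV[R]_2) :
  sq g -> (forall i, abs_continuous 0 T (fun t => G t i ord0)) ->
  (forall i, {ae mu, forall t : R, 0 < t < T ->
    is_derive t (1 : R) (fun s => G s i ord0)
      (((Y l t)^T *m W t *m g t) i ord0)}) ->
  (forall t, v t = Y l t *m (c - J *m G t)) ->
  (forall i, abs_continuous 0 T (fun t => v t i ord0)) /\
  ode v (fun t => l *: v t + g t).
Proof.
move=> sg acG dG hv.
pose z0 t := c i0 ord0 + G t i1 ord0.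
pose z1 t := c i1 ord0 - G t i0 ord0.
have zE t : (c - J *m G t) i0 ord0 = z0 t /\ (c - J *m G t) i1 ord0 = z1 t.
  by split; rewrite mxE [X in _ + X]mxE mul2cE !JE /z0 /z1; ring.
have vE i : (fun t => v t i ord0) = (fun t => Y l t i i0 * z0 t + Y l t i i1 * z1 t).
  by apply/funext => t; rewrite hv mul2cE; have [-> ->] := zE t.
have acz0 : abs_continuous 0 T z0.
  exact: abs_continuousD (@abs_continuous_cst R 0 T (c i0 ord0)) (acG i1).
have acz1 : abs_continuous 0 T z1.
  exact: abs_continuousB (@abs_continuous_cst R 0 T (c i1 ord0)) (acG i0).
split.
  by move=> i; rewrite vE; apply: abs_continuousD; apply: abs_continuousM.
apply: ae_sub2 (dY l) (ae_sub2 (fun t p p' => conj p p') (dG i0) (dG i1)).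
move=> t hY [hG0 hG1] /[dup] t0T /[dup] /hY {}hY /[dup] /hG0 {}hG0 /hG1 {}hG1.
set q := (Y l t)^T *m W t *m g t in hG0 hG1.
have dz0 : is_derive t (1 : R) z0 (q i1 ord0).
  by have := is_deriveD (is_derive_cst (c i0 ord0) t 1) hG1; rewrite add0r.
have dz1 : is_derive t (1 : R) z1 (- q i0 ord0).
  by have := is_deriveB (is_derive_cst (c i1 ord0) t 1) hG0; rewrite sub0r.
have dv i : is_derive t (1 : R) (fun s => v s i ord0)
    ((- (J *m (W t *m (l *: v t + g t)))) i ord0).
  rewrite vE.
  have d1 := is_deriveD (is_deriveM (hY i i0) dz0) (is_deriveM (hY i i1) dz1).
  apply: is_derive_eq.
  (* With [q = Y^T W g], this identity collapses [Y *m (- (J *m q))] to [- J W g]. *)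
  have YJY := symplectic_tr (YJ l t).
  have -> : - (J *m (W t *m (l *: v t + g t))) =
    (- l *: (J *m W t *m Y l t)) *m (c - J *m G t) + Y l t *m (- (J *m q)).
    rewrite [W t *m _]mulmxDr [J *m (_ + _)]mulmxDr opprD; congr (_ + _).
      by rewrite -scalemxAl hv -!scalemxAr !mulmxA scaleNr.
    by rewrite mulmxN /q !mulmxA YJY.
  have [e0 e1] := zE t.
  rewrite [RHS]mxE [(_ *m (c - _)) i ord0]mul2cE e0 e1.
  rewrite [(Y l t *m (- _)) i ord0]mul2cE.
  rewrite !NJmulE.
  by rewrite /GRing.scale/=; ring.
by split; apply: is_derive_eq (dv _) _; rewrite NJmulE.
Qed.

Lemma primitive_sqr_le (q : R -> R) t : sqint T q -> 0 <= t <= T ->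
  (\int[mu]_(x in `[0, t]) q x) ^+ 2 <= T * \int[mu]_(x in D) (q x ^+ 2).
Proof.
move=> sq_q /andP[t0 tT]; have iq := integrable_closed (sqint_integrable T0 sq_q).
have mt : measurable (`[0, t]%classic : set (measurableTypeR R)).
  exact: measurable_itv.
have mT : measurable (`[0, T]%classic : set (measurableTypeR R)).
  exact: measurable_itv.
have sub : `[0, t]%classic `<=` `[0, T]%classic.
  by apply: subset_itvl; rewrite bnd_simp.
have iqt : mu.-integrable `[0, t] (EFin \o q) by exact: integrableS iq.
have h1 : `|\int[mu]_(x in `[0, t]) q x| <= \int[mu]_(x in D) `|q x|.
  apply: le_trans (le_normr_Rintegral mt iqt) _.
  rewrite Rintegral_itv_bndo_bndc; last first.
    exact: integrable_norm (sqint_integrable T0 sq_q).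
  have nT := integrable_norm iq; have nt := integrable_norm iqt.
  rewrite /Rintegral fine_le ?integrable_fin_num//.
  apply: ge0_subset_integral => //; first exact: (measurable_int mu nT).
have sabs : sqint T (fun x => `|q x|).
  have [mq q2] := sq_q; split; first exact: measurableT_comp.
  by apply: eq_integrable q2 => // x _; rewrite real_normK ?num_real.
have cs := cauchy_schwarz T0 sabs.
have e : \int[mu]_(x in D) (`|q x| ^+ 2) = \int[mu]_(x in D) (q x ^+ 2).
  by apply: eq_Rintegral => x _; rewrite real_normK ?num_real.
rewrite e in cs; apply: le_trans cs.
rewrite -[leLHS]real_normK ?num_real// ler_pXn2r ?nnegrE//.
exact: Rintegral_ge0.
Qed.

Lemma lin_sqr_le (a b c x y : R) : `|a| <= c -> `|b| <= c ->
  (a * x + b * y) ^+ 2 <= 2 * c ^+ 2 * (x ^+ 2 + y ^+ 2).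
Proof.
move=> ac bc.
have a2 : a ^+ 2 <= c ^+ 2.
  by rewrite -real_normK ?num_real// ler_pXn2r// nnegrE (le_trans _ ac).
have b2 : b ^+ 2 <= c ^+ 2.
  by rewrite -real_normK ?num_real// ler_pXn2r// nnegrE (le_trans _ bc).
apply: (@le_trans _ _ (2 * (a ^+ 2 * x ^+ 2 + b ^+ 2 * y ^+ 2))).
  rewrite -subr_ge0.
  have -> : 2 * (a ^+ 2 * x ^+ 2 + b ^+ 2 * y ^+ 2) - (a * x + b * y) ^+ 2 =
    (a * x - b * y) ^+ 2 by ring.
  exact: sqr_ge0.
by rewrite -mulrA ler_pM2l// mulrDr; apply: lerD; apply: ler_wpM2r => //;
  exact: sqr_ge0.
Qed.

Lemma mul_sqr_le (A : 'M[R]_2) (x : 'cV[R]_2) c i :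
  (forall i j, `|A i j| <= c) ->
  (A *m x) i ord0 ^+ 2 <= 2 * c ^+ 2 * (x i0 ord0 ^+ 2 + x i1 ord0 ^+ 2).
Proof. by move=> Ac; rewrite mul2cE; exact: lin_sqr_le. Qed.

Lemma wdot_le v t : D t ->
  wdot W v v t <= (1 + 2 * M ^+ 2) * (v t i0 ord0 ^+ 2 + v t i1 ord0 ^+ 2).
Proof.
move=> Dt; rewrite wdotE; set p := W t *m v t.
have h0 := mul_sqr_le (v t) i0 (fun i j => WM i j Dt).
have h1 := mul_sqr_le (v t) i1 (fun i j => WM i j Dt).
rewrite -/p in h0 h1.
have amgm (a b : R) : a * b <= (a ^+ 2 + b ^+ 2) / 2.
  by have := sqr_ge0 (a - b); rewrite sqrrB; lra.
have k0 := amgm (v t i0 ord0) (p i0 ord0).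
have k1 := amgm (v t i1 ord0) (p i1 ord0).
have := sqr_ge0 (v t i0 ord0); have := sqr_ge0 (v t i1 ord0).
rewrite mulrDl mul1r; lra.
Qed.

(** In the variation of constants take [G 0 = 0] and [c = k *: u0]. The condition at 0 then holds
    for every [k], while the one at [T] is a linear equation for [k] with coefficient [chi l]. *)
Lemma inhomogeneous_solution l : chi l != 0 -> exists2 C, 0 <= C & forall g, sq g ->
  exists2 v, graph_pair v (fun t => l *: v t + g t) &
    ip T%:E W v v <= C * ip T%:E W g g.
Proof.
move=> chi0; have [K K0 YK] := Y_bounded l.
pose a2 := u0 i0 ord0 ^+ 2 + u0 i1 ord0 ^+ 2.
pose B := `|u1 i0 ord0| + `|u1 i1 ord0|.
have a20 : 0 <= a2 by rewrite addr_ge0 ?sqr_ge0.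
(* With [I = ip g g]: [C1 * I] bounds the square of each component of [G], [C2 * (2 * C1 * I)]
   bounds [k ^+ 2], and [C3 * I] bounds the squared length of [v t]. The 8 in [C1] is three factors
   2: one from each application of a matrix to a vector, one from adding the two components of
   [W t *m g t]. *)
pose C1 := T * (8 * K ^+ 2 * M ^+ 2 / m).
pose C2 := 8 * B ^+ 2 * K ^+ 2 / chi l ^+ 2.
pose C3 := 4 * K ^+ 2 * (2 * (a2 * C2 + 1)) * (2 * C1).
have := (sqr_ge0 K, sqr_ge0 M, sqr_ge0 B) => -[[K2 M2] B2].
have C10 : 0 <= C1.
  apply: mulr_ge0; first exact: ltW.
  by apply: divr_ge0; [rewrite mulr_ge0// mulr_ge0|exact: ltW].
have C20 : 0 <= C2.
  by apply: divr_ge0; [rewrite mulr_ge0// mulr_ge0|exact: sqr_ge0].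
have C30 : 0 <= C3.
  apply: mulr_ge0; last exact: mulr_ge0.
  apply: mulr_ge0; first exact: mulr_ge0.
  by rewrite mulr_ge0// addr_ge0// mulr_ge0.
have M20 : 0 <= 1 + 2 * M ^+ 2 by rewrite addr_ge0// mulr_ge0.
exists (T * ((1 + 2 * M ^+ 2) * C3)) => [|g sg].
  by apply: mulr_ge0; [exact: ltW|exact: mulr_ge0].
set I := ip T%:E W g g.
have I0 : 0 <= I by exact: ip_ge0.
pose q t := (Y l t)^T *m W t *m g t.
have YKD t i j : D t -> `|Y l t i j| <= K.
  by rewrite /= in_itv/= => /andP[t0 /ltW tT]; apply: YK; rewrite t0.
have sWg := sq_mul mW WM sg.
have sqq : sq q.
  have mYT i j : mfun (fun t => (Y l t)^T i j).
    rewrite (_ : (fun _ => _) = (fun t => Y l t j i)).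
      exact: abs_continuous_measurable.
    by apply/funext => t; rewrite mxE.
  have YTK t i j : D t -> `|(Y l t)^T i j| <= K by rewrite mxE; exact: YKD.
  have := sq_mul mYT YTK sWg; rewrite /q => h i; have := h i.
  by under eq_fun do rewrite mulmxA.
have q2 i : \int[mu]_(t in D) (q t i ord0 ^+ 2) <= 8 * K ^+ 2 * M ^+ 2 / m * I.
  rewrite /I ipE -RintegralZl//; last exact: wdot_integrable.
  apply: le_Rintegral => //; first by have [] := sqq i.
    by apply: integrableZR; exact: wdot_integrable.
  move=> t Dt.
  have h0 := mul_sqr_le (g t) i0 (fun i j => WM i j Dt).
  have h1 := mul_sqr_le (g t) i1 (fun i j => WM i j Dt).
  have YTK i' j : `|(Y l t)^T i' j| <= K by rewrite mxE; exact: YKD.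
  have := mul_sqr_le (W t *m g t) i YTK; rewrite mulmxA -/(q t) => hq.
  have hw := wdot_ge g Dt; set s := _ + _ in h0 h1 hw.
  have KM0 : 0 <= 8 * K ^+ 2 * M ^+ 2 by rewrite mulr_ge0// mulr_ge0.
  have hs : s <= wdot W g g t / m by rewrite ler_pdivlMr// mulrC.
  apply: le_trans hq _.
  have h2 := ler_wpM2l KM0 hs.
  have K20 : 0 <= 2 * K ^+ 2 by rewrite mulr_ge0.
  have h3 := ler_wpM2l K20 (lerD h0 h1).
  have -> : 8 * K ^+ 2 * M ^+ 2 / m * wdot W g g t =
    8 * K ^+ 2 * M ^+ 2 * (wdot W g g t / m) by ring.
  apply: le_trans h2; apply: le_trans h3 _.
  by rewrite le_eqVlt; apply/orP; left; apply/eqP; ring.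
have prim i : exists F : R -> R, [/\ abs_continuous 0 T F, F 0 = 0,
    forall t, 0 <= t <= T -> F t ^+ 2 <= C1 * I &
    {ae mu, forall t : R, 0 < t < T -> is_derive t (1 : R) F (q t i ord0)}].
  have iq := integrable_closed (sqint_integrable T0 (sqq i)).
  have [F [acF F0 FE dF]] := primitive_ex iq; exists F; split => // t ht.
  rewrite FE; last by case/andP: ht.
  apply: le_trans (primitive_sqr_le (sqq i) ht) _.
  by rewrite /C1 -mulrA ler_pM2l.
have [G0 [acG0 G00 G0C dG0]] := prim i0.
have [G1 [acG1 G10 G1C dG1]] := prim i1.
pose G t : 'cV[R]_2 := \col_i (if i == i0 then G0 t else G1 t).
have Gi0 : (fun t => G t i0 ord0) = G0 by apply/funext => t; rewrite mxE.
have Gi1 : (fun t => G t i1 ord0) = G1 by apply/funext => t; rewrite mxE.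
have acG i : abs_continuous 0 T (fun t => G t i ord0).
  by move: i; apply: ord2P; rewrite (Gi0, Gi1).
have dG i : {ae mu, forall t : R, 0 < t < T ->
    is_derive t (1 : R) (fun s => G s i ord0) (q t i ord0)}.
  by move: i; apply: ord2P; rewrite (Gi0, Gi1).
have GS t : 0 <= t <= T ->
    G t i0 ord0 ^+ 2 + G t i1 ord0 ^+ 2 <= 2 * C1 * I.
  move=> ht; rewrite !mxE/=; have := G0C t ht; have := G1C t ht.
  by rewrite -mulrA; lra.
(* Since [v T = k *: (Y l T *m u0) - x], the condition at [T] reads [k * chi l = x^T J u1]. *)
pose x := Y l T *m (J *m G T).
pose k := (x^T *m J *m u1) ord0 ord0 / chi l.
have TT : 0 <= T <= T by rewrite lexx ltW.
have k2 : k ^+ 2 <= C2 * (2 * C1 * I).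
  have x2 i : x i ord0 ^+ 2 <= 2 * K ^+ 2 * (2 * C1 * I).
    apply: le_trans (mul_sqr_le _ i (fun i j => YK T i j TT)) _.
    rewrite ler_wpM2l ?mulr_ge0//.
    have -> : (J *m G T) i0 ord0 ^+ 2 + (J *m G T) i1 ord0 ^+ 2 =
      G T i0 ord0 ^+ 2 + G T i1 ord0 ^+ 2 by rewrite !mul2cE !JE; ring.
    exact: GS.
  have d2 : (x^T *m J *m u1) ord0 ord0 ^+ 2 <=
      2 * B ^+ 2 * (x i1 ord0 ^+ 2 + x i0 ord0 ^+ 2).
    rewrite dotJE.
    have -> : x i1 ord0 * u1 i0 ord0 - x i0 ord0 * u1 i1 ord0 =
      u1 i0 ord0 * x i1 ord0 + (- u1 i1 ord0) * x i0 ord0 by ring.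
    by apply: lin_sqr_le; rewrite ?normrN /B ?lerDl ?lerDr.
  rewrite /k expr_div_n ler_pdivrMr; last first.
    by rewrite lt_neqAle eq_sym sqr_ge0 sqrf_eq0 chi0.
  have -> : C2 * (2 * C1 * I) * chi l ^+ 2 = 8 * B ^+ 2 * K ^+ 2 * (2 * C1 * I).
    by rewrite /C2; field.
  apply: le_trans d2 _.
  have B20 : 0 <= 2 * B ^+ 2 by rewrite mulr_ge0.
  apply: le_trans (ler_wpM2l B20 (lerD (x2 i1) (x2 i0))) _.
  by rewrite le_eqVlt; apply/orP; left; apply/eqP; ring.
pose c := k *: u0.
pose v t := Y l t *m (c - J *m G t).
have [acv odev] := @variation_of_constants l v g c G sg acG dG (fun=> erefl).
have sv : sq v by move=> i; exact: abs_continuous_sqint.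
exists v.
  split => //.
  - move=> i; have -> : (fun t => (l *: v t + g t) i ord0) =
      (fun t => l * v t i ord0) \+ (fun t => g t i ord0).
      by apply/funext => t; rewrite [LHS]mxE [X in X + _]mxE.
    by apply: sqintD => //; exact: sqintZ.
  - rewrite /v Y0 mul1mx dotJE /c.
    have -> : G 0 = 0.
      apply/matrixP => i j; rewrite (ord1 j) [RHS]mxE; move: i.
      by apply: ord2P; rewrite mxE.
    by rewrite mulmx0 subr0 ![(k *: u0) _ _]mxE; ring.
  - have -> : v T = k *: (Y l T *m u0) - x.
      by rewrite /v mulmxBr /c -scalemxAr.
    rewrite dotJE.
    have e : k * chi l = (x^T *m J *m u1) ord0 ord0 by rewrite divfK.
    rewrite /chi !dotJE in e.
    set y := Y l T *m u0 in e *.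
    have yx i : (k *: y - x) i ord0 = k * y i ord0 - x i ord0.
      by rewrite [LHS]mxE [X in X + _]mxE [X in _ + X]mxE.
    move/eqP: e; rewrite -subr_eq0 => /eqP e.
    by rewrite !yx -[RHS]e; ring.
rewrite ipE.
have C40 : 0 <= (1 + 2 * M ^+ 2) * (C3 * I).
  by apply: mulr_ge0 => //; exact: mulr_ge0.
have cD : mu.-integrable D (EFin \o cst ((1 + 2 * M ^+ 2) * (C3 * I))).
  apply: measurable_bounded_integrable => //; first exact: muDy.
  by exists ((1 + 2 * M ^+ 2) * (C3 * I)); split; [exact: num_real|
    move=> N MN t _; rewrite /= ger0_norm// ltW].
apply: (@le_trans _ _ (\int[mu]_(t in D) cst ((1 + 2 * M ^+ 2) * (C3 * I)) t)).
  apply: le_Rintegral => //; first exact: wdot_integrable.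
  move=> t Dt; apply: le_trans (wdot_le v Dt) _; rewrite ler_wpM2l//.
  have ht : 0 <= t <= T.
    by move: Dt; rewrite /= in_itv/= => /andP[-> /ltW ->].
  have v2 i := mul_sqr_le (c - J *m G t) i (fun i j => YK t i j ht).
  have z2 : (c - J *m G t) i0 ord0 ^+ 2 + (c - J *m G t) i1 ord0 ^+ 2 <=
     2 * (a2 * C2 + 1) * (2 * C1 * I).
    have -> : (c - J *m G t) i0 ord0 = k * u0 i0 ord0 + G t i1 ord0.
      by rewrite mxE [X in _ + X]mxE [c _ _]mxE mul2cE !JE; ring.
    have -> : (c - J *m G t) i1 ord0 = k * u0 i1 ord0 - G t i0 ord0.
      by rewrite mxE [X in _ + X]mxE [c _ _]mxE mul2cE !JE; ring.
    have GSt := GS t ht.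
    have kk := ler_wpM2l a20 k2.
    have e0 := sqr_ge0 (k * u0 i0 ord0 - G t i1 ord0).
    have e1 := sqr_ge0 (k * u0 i1 ord0 + G t i0 ord0).
    have -> : 2 * (a2 * C2 + 1) * (2 * C1 * I) =
      2 * (a2 * (C2 * (2 * C1 * I))) + 2 * (2 * C1 * I) by ring.
    have -> : (k * u0 i0 ord0 + G t i1 ord0) ^+ 2 +
        (k * u0 i1 ord0 - G t i0 ord0) ^+ 2 =
      2 * (a2 * k ^+ 2) + 2 * (G t i0 ord0 ^+ 2 + G t i1 ord0 ^+ 2) -
      ((k * u0 i0 ord0 - G t i1 ord0) ^+ 2 +
       (k * u0 i1 ord0 + G t i0 ord0) ^+ 2) by rewrite /a2; ring.
    by move: e0 e1 kk GSt; lra.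
  have K20 : 0 <= 4 * K ^+ 2 by rewrite mulr_ge0.
  apply: le_trans (lerD (v2 i0) (v2 i1)) _.
  have := ler_wpM2l K20 z2; set s := _ + _ => hz.
  have -> : 2 * K ^+ 2 * s + 2 * K ^+ 2 * s = 4 * K ^+ 2 * s by ring.
  apply: le_trans hz _.
  by rewrite le_eqVlt; apply/orP; left; apply/eqP; rewrite /C3; ring.
rewrite Rintegral_cst//.
rewrite (_ : fine (mu D) = T); last by rewrite muD.
by rewrite le_eqVlt; apply/orP; left; apply/eqP; ring.
Qed.

Lemma dirac_op_solve l g : chi l != 0 -> sq g -> exists v w,
  A v w /\ (forall t, w t - l *: v t = g t).
Proof.
move=> chi0 sg; have [C _ H] := inhomogeneous_solution chi0; have [v gp _] := H g sg.
exists v, (fun t => l *: v t + g t); split; first exact: graph_pair_op.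
by move=> t; rewrite addrAC subrr add0r.
Qed.

(** Solve [(A - l) x = v]; by symmetry [ip v v = ip v ((A - l) x) = ip ((A - l) v) x = 0]. *)
Lemma dirac_op_kernel l v w : chi l != 0 -> A v w ->
  L2_eq T%:E (fun t => w t - l *: v t) (fun=> 0) -> L2_eq T%:E v (fun=> 0).
Proof.
move=> chi0 Avw wv; have [sv sw] := dirac_op_sq Avw; apply: ip_eq0 => //.
have [x [y [Axy yx]]] := dirac_op_solve chi0 sv; have [sx sy] := dirac_op_sq Axy.
have -> : ip T%:E W v v = ip T%:E W v (fun t => y t - l *: x t).
  by rewrite (_ : (fun t => y t - l *: x t) = v)//; apply/funext.
rewrite ip_linr// -(dirac_op_sym Avw Axy) -ip_linl//.
have s0 : sq (fun=> 0 : 'cV[R]_2).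
  move=> i; apply: (@bounded_sqint _ _ T0 _ 0).
    rewrite (_ : (fun=> _) = cst 0); first exact: measurable_cst.
    by apply/funext => t; rewrite mxE.
  by move=> t _; rewrite mxE normr0.
rewrite (ip_ael _ s0 sx wv); last exact: sq_lin.
rewrite ipE (_ : (fun=> _) = cst 0); last first.
  by apply/funext => t; rewrite wdotE !mxE !mul0r addr0.
by rewrite Rintegral_cst// mul0r.
Qed.

Lemma dirac_op_resolvent l : chi l != 0 -> resolvent_set T%:E W A l.
Proof.
move=> chi0; split.
- by move=> v w; exact: dirac_op_kernel.
- move=> g /L2P sg; have [v [w [Avw wv]]] := dirac_op_solve chi0 sg.
  by exists v, w; split => //; apply: aeW => t _.
- have [C C0 H] := inhomogeneous_solution chi0; exists C => v w Avw.
  have [sv sw] := dirac_op_sq Avw.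
  pose g t := w t - l *: v t; have sg : sq g by exact: sq_lin.
  have [x gp hx] := H g sg; have Axy := graph_pair_op gp.
  set y := (fun t => _) in gp Axy.
  have [sx sy] := dirac_op_sq Axy.
  (* Injectivity identifies [v] with the solution constructed from [g], so the bound for that
     solution carries over. *)
  suff vx : L2_eq T%:E v x.
    by rewrite (ip_ael sv sx sv vx) (ip_aer sx sv sx vx).
  have Ad : A (fun t => v t - 1 *: x t) (fun t => w t - 1 *: y t).
    exact: dirac_op_sub.
  have : L2_eq T%:E (fun t => v t - 1 *: x t) (fun=> 0).
    apply: (dirac_op_kernel chi0 Ad); apply: aeW => t _.
    by apply/matrixP => i j; rewrite /y /g !mxE; ring.
  rewrite /L2_eq /ae_on; apply: ae_sub => t h /h; rewrite scale1r.
  by move/eqP; rewrite subr_eq0 => /eqP.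
Qed.

(** One real [l] for which [A - l] is onto suffices. Given a pair [(g, h)] of the adjoint, solve
    [(A - l) x = h - l g]; then [g - x] is orthogonal to the range of [A - l], which is the whole
    space, so [g = x] lies in the domain. *)
Lemma dirac_op_adjoint l g h : chi l != 0 -> A g h <-> adjoint_op T%:E W A g h.
Proof.
move=> chi0; split.
  move=> Agh; have [sg sh] := dirac_op_sq Agh.
  split; [exact/L2P|exact/L2P|move=> v w Avw; exact: dirac_op_sym].
move=> [/L2P sg /L2P sh adj].
have [x [y [Axy yx]]] := dirac_op_solve chi0 (sq_lin l sh sg).
have [sx sy] := dirac_op_sq Axy.
pose d t := g t - 1 *: x t.
have sd : sq d by exact: sq_lin.
have d0 : L2_eq T%:E d (fun=> 0).
  apply: ip_eq0 => //.
  have [p [r [Apr rp]]] := dirac_op_solve chi0 sd; have [sp sr] := dirac_op_sq Apr.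
  have rpd : (fun t => r t - l *: p t) = d by apply/funext.
  rewrite -[X in ip _ _ X _]rpd ip_linl// !ip_linr//.
  rewrite (adj _ _ Apr) (dirac_op_sym Apr Axy).
  have yxE : (fun t => y t - l *: x t) = (fun t => h t - l *: g t).
    exact/funext.
  have := congr1 (ip T%:E W p) yxE.
  rewrite !ip_linr//; lra.
have gx : L2_eq T%:E g x.
  move: d0; rewrite /L2_eq /ae_on; apply: ae_sub => t e /e; rewrite /d scale1r.
  by move/eqP; rewrite subr_eq0 => /eqP.
have yh : L2_eq T%:E y h.
  move: gx; rewrite /L2_eq /ae_on; apply: ae_sub => t e /e gxt.
  by have := yx t; rewrite gxt => /addIr.
exact: (dirac_op_ael (dirac_op_aer Axy sh yh) sg gx).
Qed.

(** When [chi l] vanishes, [Y l t *m u0] meets both boundary conditions and is an eigenfunction. It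
    has no zero, because [Y l t] is symplectic and hence invertible. *)
Lemma dirac_op_eigen l : chi l = 0 -> ~ resolvent_set T%:E W A l.
Proof.
move=> chi0 [ker _ _].
pose v t := Y l t *m u0.
have s0 : sq (fun=> 0 : 'cV[R]_2).
  move=> i; apply: (@bounded_sqint _ _ T0 _ 0).
    rewrite (_ : (fun=> _) = cst 0); first exact: measurable_cst.
    by apply/funext => t; rewrite mxE.
  by move=> t _; rewrite mxE normr0.
have [|||acv odev] := @variation_of_constants l v (fun=> 0) u0 (fun=> 0) s0.
- move=> i; rewrite (_ : (fun _ => _) = cst 0); last first.
    by apply/funext => t; rewrite mxE.
  exact: abs_continuous_cst.
- by move=> i; apply: aeW => t _; rewrite mulmx0 mxE; exact: is_derive_cst.
- by move=> t; rewrite mulmx0 subr0.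
have sv : sq v by move=> i; exact: abs_continuous_sqint.
have Av : A v (fun t => l *: v t).
  apply: graph_pair_op; split => //.
  - move=> i; rewrite (_ : (fun _ => _) = (fun t => l * v t i ord0)).
      exact: sqintZ.
    by apply/funext => t; rewrite mxE.
  - by apply: ae_sub odev => t; rewrite addr0.
  - by rewrite /v Y0 mul1mx dotJE; ring.
have v0 : L2_eq T%:E v (fun=> 0).
  by apply: ker Av _; apply: aeW => t _; rewrite subrr.
have : mu D = 0.
  have [N [mN N0 NS]] := v0.
  apply: (subset_measure0 mD mN) => // t Dt; apply: NS => /= h.
  have vt : v t = 0 by apply: h; rewrite intvE.
  have := YJ l t => e.
  have : J *m u0 = 0 by rewrite -e -mulmxA -/(v t) vt mulmx0.
  move=> /(congr1 (mulmx J)); rewrite mulmxA JJ mulmx0 mulNmx mul1mx.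
  by move/eqP; rewrite oppr_eq0; exact/negP.
by rewrite (muD T0) => -[] /eqP; rewrite gt_eqF.
Qed.

Lemma dirac_op_spectrum : spectrum T%:E W A = [set l | chi l = 0].
Proof.
apply/seteqP; split => l /=.
  by move=> nr; apply/eqP; apply: contra_notT nr; exact: dirac_op_resolvent.
exact: dirac_op_eigen.
Qed.

(** Approximate each component by [l2_dense]. The approximants vanish at both ends and their
    derivatives [h] are bounded, so [V *m (J *m h)] is square integrable and represents the image
    under the operator. *)
Lemma dirac_op_dense : densely_defined T%:E W A.
Proof.
move=> g /L2P sg eps e0.
have M20 : 0 < 1 + 2 * M ^+ 2 by rewrite ltr_wpDr// mulr_ge0// sqr_ge0.
(* The first divisor is the factor in [wdot_le]; the half is shared by the two components. *)
pose e := eps / (1 + 2 * M ^+ 2) / 2.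
have e'0 : 0 < e by rewrite !divr_gt0.
have approx i : exists v h : R -> R, [/\ abs_continuous 0 T v,
    v 0 = 0 /\ v T = 0,
    forall t, 0 < t < T -> is_derive t (1 : R) v (h t), sqint T h &
    \int[mu]_(t in D) ((g t i ord0 - v t) ^+ 2) < e].
  have [mg g2] := sg i.
  have [v [h [acv v0 dv [mh [K hK]] hv]]] := l2_dense T0 mg g2 e'0.
  exists v, h; split => //.
    apply: (@bounded_sqint _ _ T0 _ K) => // t.
    by rewrite /= in_itv/= => /andP[t0 /ltW tT]; apply: hK; rewrite t0.
  have fin : sqd T (fun t => g t i ord0) v \is a fin_num.
    rewrite ge0_fin_numE ?(lt_trans hv) ?ltry//.
    by apply: integral_ge0 => x _; rewrite lee_fin sqr_ge0.
  by rewrite -lte_fin -[X in (X < _)%E]/((fine _)%:E) fineK.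
have [v0 [h0 [acv0 [v00 v0T] dv0 sh0 hv0]]] := approx i0.
have [v1 [h1 [acv1 [v10 v1T] dv1 sh1 hv1]]] := approx i1.
pose v t : 'cV[R]_2 := \col_i (if i == i0 then v0 t else v1 t).
pose h t : 'cV[R]_2 := \col_i (if i == i0 then h0 t else h1 t).
have vi0 : (fun t => v t i0 ord0) = v0 by apply/funext => t; rewrite mxE.
have vi1 : (fun t => v t i1 ord0) = v1 by apply/funext => t; rewrite mxE.
have acv i : abs_continuous 0 T (fun t => v t i ord0).
  by move: i; apply: ord2P; rewrite (vi0, vi1).
have sv : sq v by move=> i; exact: abs_continuous_sqint.
have sJh : sq (fun t => J *m h t).
  apply: ord2P.
    rewrite (_ : (fun _ => _) = (fun t => -1 * h1 t)); first exact: sqintZ.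
    by apply/funext => t; rewrite mul2cE !JE !mxE/=; ring.
  rewrite (_ : (fun _ => _) = h0)//.
  by apply/funext => t; rewrite mul2cE !JE !mxE/=; ring.
exists v, (fun t => V t *m (J *m h t)); split.
  apply: graph_pair_op; split => //.
  - exact: sq_mul mV VM sJh.
  - apply: aeW => t ht; rewrite mulmxA WV mul1mx vi0 vi1; split.
      by apply: is_derive_eq (dv0 t ht) _; rewrite mul2cE !JE !mxE/=; ring.
    by apply: is_derive_eq (dv1 t ht) _; rewrite mul2cE !JE !mxE/=; ring.
  - by rewrite dotJE !mxE/= v00 v10; ring.
  - by rewrite dotJE !mxE/= v0T v1T; ring.
pose d t := g t - v t.
have sd : sq d.
  move=> i; rewrite (_ : (fun _ => _) = (fun t => g t i ord0) \- (fun t => v t i ord0)).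
    exact: sqintB.
  by apply/funext => t; rewrite /d /= [LHS]mxE [X in _ + X = _]mxE.
have [_ d0] := sd i0; have [_ d1] := sd i1.
rewrite ipE -/d.
have le1 : \int[mu]_(t in D) wdot W d d t <= (1 + 2 * M ^+ 2) *
    (\int[mu]_(t in D) (d t i0 ord0 ^+ 2) + \int[mu]_(t in D) (d t i1 ord0 ^+ 2)).
  rewrite -RintegralD// -RintegralZl//; last exact: integrableDR d0 d1.
  apply: le_Rintegral => //; first exact: wdot_integrable.
    exact: integrableZR (integrableDR d0 d1).
  by move=> t Dt; exact: wdot_le.
apply: le_lt_trans le1 _; rewrite mulrC -ltr_pdivlMr//.
rewrite [ltRHS]splitr; apply: ltrD; [move: hv0|move: hv1]; congr (_ < _);
  by apply: eq_Rintegral => t _; rewrite !mxE.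
Qed.

Theorem dirac_op_self_adjoint : (exists l, chi l != 0) -> self_adjoint T%:E W A.
Proof. by move=> [l chi0]; split=> [|g h]; [exact: dirac_op_dense|exact: dirac_op_adjoint chi0]. Qed.

End DiracOperator.

(** * The inverse spectral problem on the circle *)

Section HyperbolicRecursion.
Variable C : numClosedFieldType.
Implicit Types (a b c w z E : C) (p q : {poly C}).

(* With [E = r e^(i phi / 2)], [r] real, this is the rotation of the boundary
   point [e^(i phi)] about [a] by the angle [2 arg w]. *)
Definition hrot a w E : C :=
  ((w - a * a^* * w^*) * E - a * (w - w^*) * E^*) / (1 - a * a^*).

Fixpoint hpath (a : nat -> C) w m : C :=
  if m is m'.+1 then hrot (a m') w (hpath a w m') else 1.

Lemma eq_hpath (a b : nat -> C) w m :
  (forall k, (k < m)%N -> a k = b k) -> hpath a w m = hpath b w m.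
Proof.
elim: m => //= m IH ab; rewrite IH ?ab// => k km; apply: ab.
exact: ltnW.
Qed.

Lemma disk_den a : `|a| < 1 -> 0 < 1 - a * a^*.
Proof. by move=> a1; rewrite -normCK subr_gt0 expr_lt1. Qed.

(** The coordinate [E - a * conj E] moves the centre [a] to 0, where a rotation is multiplication by
    [w]; [hrot] is this multiplication written back in [E]. *)
Lemma hrotE c a w E : `|a| < 1 ->
  c * (hrot a w E - a * (hrot a w E)^*) = w * (c * (E - a * E^*)).
Proof.
move=> /disk_den a1; rewrite /hrot.
have ne : 1 - a * a^* != 0 by rewrite gt_eqF.
rewrite rmorphM fmorphV !rmorphB !rmorphM !rmorphB !rmorphM /= !conjCK rmorph1.
have ne' : 1 - a^* * a != 0 by rewrite mulrC.
by field; exact: ne'.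
Qed.

Lemma normC_le_sqr z w : (`|z| <= `|w|) = (z * z^* <= w * w^*).
Proof. by rewrite -!normCK ler_pXn2r// nnegrE. Qed.

Lemma normC_lt_sqr z w : (`|z| < `|w|) = (z * z^* < w * w^*).
Proof. by rewrite -!normCK ltr_pXn2r// nnegrE. Qed.

Lemma blaschke_le r z : `|r| < 1 -> 1 <= `|z| -> `|1 - r^* * z| <= `|z - r|.
Proof.
move=> r1 z1; rewrite normC_le_sqr -subr_ge0.
rewrite !rmorphB rmorphM rmorph1 /= conjCK.
have -> : (z - r) * (z^* - r^*) - (1 - r^* * z) * (1 - r * z^*) =
   (z * z^* - 1) * (1 - r * r^*) by ring.
rewrite mulr_ge0//; last exact/ltW/disk_den.
by rewrite -normCK subr_ge0 expr_ge1.
Qed.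

(** The reversed polynomial [z ^+ m * conj (p (1 / conj z))] of [p = prod (z - r)] with [m] roots,
    in factored form so that it can be compared with [p] factor by factor. *)
Definition recip (s : seq C) : {poly C} := \prod_(r <- s) (1 - r^* *: 'X).

Lemma recip_circle (s : seq C) z : `|z| = 1 ->
  (recip s).[z] = z ^+ size s * (\prod_(r <- s) ('X - r%:P)).[z]^*.
Proof.
move=> z1; have zz : z * z^* = 1 by rewrite -normCK z1 expr1n.
rewrite /recip; elim: s => [|r s IH].
  by rewrite !big_nil !hornerC rmorph1 expr0 mulr1.
rewrite !big_cons !hornerM IH /= exprS.
have -> : (1 - r^* *: 'X).[z] = 1 - r^* * z by rewrite !hornerE.
have -> : ('X - r%:P).[z] = z - r by rewrite !hornerE.
by rewrite rmorphM rmorphB /= mulrACA mulrBr zz (mulrC z r^*).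
Qed.

Lemma recip_le (s : seq C) z : (forall r, r \in s -> `|r| < 1) -> 1 <= `|z| ->
  `|(recip s).[z]| <= `|(\prod_(r <- s) ('X - r%:P)).[z]|.
Proof.
move=> + z1; elim: s => [|r s IH] s1; first by rewrite /recip !big_nil.
rewrite /recip !big_cons !hornerM !normrM ler_pM//; last first.
  by apply: IH => x xs; apply: s1; rewrite inE xs orbT.
by rewrite !hornerE /= blaschke_le// s1// inE eqxx.
Qed.

Lemma size_recip (s : seq C) : (size (recip s) <= (size s).+1)%N.
Proof.
rewrite /recip; elim: s => [|r s IH]; first by rewrite big_nil size_poly1.
rewrite big_cons (leq_trans (size_polyMleq _ _))//.
have : (size (1 - r^* *: 'X)%R <= 2)%N.
  rewrite (leq_trans (size_polyD _ _))// geq_max size_poly1/= size_polyN.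
  by rewrite (leq_trans (size_scale_leq _ _))// size_polyX.
move=> h2; have := leq_add h2 IH; rewrite /= add2n; case: (_ + _)%N => // k; rewrite ltnS.
Qed.

Lemma recip_lead (s : seq C) : (recip s)`_(size s) = \prod_(r <- s) (- r^*).
Proof.
rewrite /recip; elim: s => [|r s IH]; first by rewrite !big_nil coef1.
rewrite !big_cons mulrBl mul1r coefB -IH /= -scalerAl coefZ mulrC.
rewrite nth_default ?size_recip// sub0r mulrC -commr_polyX mulNr.
by rewrite coefMX.
Qed.

(* The inverse Szego recursion: one step of the Schur-Cohn test. *)
Lemma schur_cohn p m : p \is monic -> size p = m.+2 ->
  (forall z, 1 <= `|z| -> p.[z] != 0) ->
  exists b q, [/\ `|b| < 1, q \is monic, size q = m.+1,
    forall z, 1 <= `|z| -> q.[z] != 0 &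
    forall z, `|z| = 1 -> p.[z] = z * q.[z] + b * z ^+ m * q.[z]^*].
Proof.
move=> pm sp pn0.
have [s] := closed_field_poly_normal p.
rewrite (monicP pm) scale1r => ps.
have ss : size s = m.+1.
  by move: sp; rewrite ps size_prod_XsubC => -[].
have s1 r : r \in s -> `|r| < 1.
  move=> rs; have [//|r1] := real_ltP (normr_real r) (real1 C).
  by have := pn0 r r1; rewrite ps -rootE root_prod_XsubC rs.
set b := p.[0].
have bE : b = \prod_(r <- s) - r.
  by rewrite /b ps horner_prod; apply: eq_bigr => r _; rewrite !hornerE.
have b1 : `|b| < 1.
  rewrite bE; case: s ss s1 {ps bE} => // r s _ s1.
  rewrite big_cons normrM normrN.
  have r1 : `|r| < 1 by apply: s1; rewrite inE eqxx.
  have : `|\prod_(j <- s) - j| <= 1.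
    rewrite normr_prod; rewrite big_seq Num.Theory.prodr_ile1// => j js.
    by rewrite normrN normr_ge0 ltW// s1// inE js orbT.
  move=> h; apply: le_lt_trans r1; rewrite ler_piMr//.
have bb : 0 < 1 - b * b^* by exact: disk_den.
(* [recip s] equals 1 at 0, so the constant terms cancel and [Q] is divisible by ['X]; its leading
   coefficient is [1 - b * conj b], which is divided out below. *)
set Q := p - b *: recip s.
have Q0 : root Q 0.
  rewrite rootE /Q hornerD hornerN hornerZ /recip horner_prod -/b.
  rewrite big1 ?mulr1 ?subrr// => r _; rewrite !hornerE; by rewrite ?mulr0 ?subr0.
have [q Qq] := factor_theorem _ _ Q0.
have {}Qq : Q = q * 'X by rewrite Qq subr0.
have sQ : (size Q <= m.+2)%N.
  rewrite (leq_trans (size_polyD _ _))// geq_max sp leqnn size_polyN /=.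
  by rewrite (leq_trans (size_scale_leq _ _))// -ss size_recip.
have lQ : Q`_m.+1 = 1 - b * b^*.
  rewrite /Q coefB coefZ -ss recip_lead ss.
  have -> : p`_m.+1 = 1 by move/monicP : pm; rewrite lead_coefE sp.
  congr (_ - _ * _); rewrite bE rmorph_prod; apply: eq_bigr => r _.
  by rewrite rmorphN.
have lq : q`_m = 1 - b * b^* by rewrite -lQ Qq coefMX.
have qn0 : q != 0.
  by apply: contra_eq_neq lq => ->; rewrite coef0 eq_sym gt_eqF.
have sq : size q = m.+1.
  apply/eqP; rewrite eqn_leq; apply/andP; split.
    by move: sQ; rewrite Qq size_mulX.
  rewrite ltnNge; apply: contra_eqN lq => /(nth_default 0) ->.
  by rewrite eq_sym gt_eqF.
have bn : (1 - b * b^*)^-1 != 0 by rewrite invr_eq0 gt_eqF.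
exists b, ((1 - b * b^*)^-1 *: q); split=> //.
- by rewrite monicE lead_coefZ lead_coefE sq lq mulVf// gt_eqF.
- by rewrite size_scale.
- move=> z z1; rewrite hornerZ mulf_neq0//.
  (* A comparison as in Rouche's theorem: off the open disk [recip s] is bounded by [p], and [b] is
     small. *)
  have : Q.[z] != 0.
    rewrite /Q hornerD hornerN hornerZ subr_eq0.
    have : `|b * (recip s).[z]| < `|p.[z]|.
      rewrite normrM; apply: le_lt_trans (_ : `|b| * `|p.[z]| < _).
        by rewrite ler_wpM2l// ps recip_le.
      by rewrite gtr_pMl// normr_gt0 pn0.
    by apply: contraTneq => <-; rewrite ltxx.
  by rewrite Qq hornerM mulf_eq0 negb_or => /andP[].
- move=> z z1.
  have zz : z * z^* = 1 by rewrite -normCK z1 expr1n.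
  have z0 : z != 0 by rewrite -normr_eq0 z1 oner_eq0.
  (* On the circle the reversed polynomial is [z ^+ m.+1 * conj p]. Thus [q] and its conjugate are
     combinations of [p] and its conjugate, and the claim becomes an identity between these. *)
  have Qz : q.[z] * z = p.[z] - b * (z ^+ m.+1 * p.[z]^*).
    by rewrite -[q.[z] * z]hornerMX -Qq /Q hornerD hornerN hornerZ
       recip_circle// -ps ss.
  have zbar : z^* = z^-1 by rewrite -[LHS]mul1r -(mulVf z0) -mulrA zz mulr1.
  have qE : q.[z] = (p.[z] - b * (z ^+ m.+1 * p.[z]^*)) / z.
    by rewrite -Qz mulfK.
  rewrite !hornerZ rmorphM fmorphV rmorphB rmorphM rmorph1 /= conjCK qE.
  rewrite !rmorphM rmorphB !rmorphM rmorphXn fmorphV /= conjCK zbar invrK.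
  have zm0 : z ^+ m != 0 by rewrite expf_neq0.
  rewrite exprVn !exprS invfM.
  have ne : 1 - b * b^* != 0 by rewrite gt_eqF.
  have ne' : 1 - b^* * b != 0 by rewrite mulrC.
  by field; apply/and3P; split.
Qed.

(** Up to a power of [w], [p] is a real-linear image of the endpoint of the path, with coefficients
    [c] and [a m]. The value [a m] that closes one stage is the centre of the next rotation, so by
    [hrotE] the rotation contributes only a factor [w], and the Schur-Cohn step then updates the two
    coefficients. *)
Lemma hpath_poly m p : p \is monic -> size p = m.+1 ->
  (forall z, 1 <= `|z| -> p.[z] != 0) ->
  exists (a : nat -> C) (c : C), [/\ forall k, `|a k| < 1, c != 0 &
    forall w, `|w| = 1 ->
      w ^+ m * (c * (hpath a w m - a m * (hpath a w m)^*)) = p.[w ^+ 2]].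
Proof.
elim: m p => [|m IH] p pm sp pn0.
  exists (fun=> 0), 1; split; [by rewrite normr0|exact: oner_neq0|].
  move=> w _ /=; rewrite expr0 !mul1r mul0r subr0.
  have /size_poly1P[x x0 px] : size p == 1%N by rewrite sp.
  by move/monicP : pm; rewrite px lead_coefC hornerC.
have [b [q [b1 qm sq qn0 pq]]] := schur_cohn pm sp pn0.
have [a [c [a1 c0 H]]] := IH _ qm sq qn0.
(* Read off by expanding [Y + b * conj Y] for [Y = c * (F - a m * conj F)] as
   [c' * F - d' * conj F]. *)
set c' := c - b * (c * a m)^*.
set d' := c * a m - b * c^*.
have dc : `|d'| < `|c'|.
  rewrite normC_lt_sqr -subr_gt0 /d' /c'.
  rewrite !(rmorphM, rmorphB) /= !conjCK.
  set e := a m.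
  have -> : (c - b * (c^* * e^*)) * (c^* - b^* * (c * e)) -
     (c * e - b * c^*) * (c^* * e^* - b^* * c) =
     c * c^* * (1 - e * e^*) * (1 - b * b^*) by ring.
  apply: mulr_gt0; last exact: disk_den.
  apply: mulr_gt0; last exact/disk_den/a1.
  by rewrite -normCK exprn_gt0// normr_gt0.
have c'0 : c' != 0 by rewrite -normr_gt0 (le_lt_trans _ dc).
exists (fun k => if (k <= m)%N then a k else d' / c'), c'; split=> //.
  move=> k; case: ifP => // _.
  by rewrite normrM normfV ltr_pdivrMr ?mul1r// normr_gt0.
move=> w w1; rewrite ltnn [hpath _ _ m.+1]/= leqnn.
rewrite (@eq_hpath _ a); last by move=> k /ltnW ->.
set E := hpath a w m in H *; set F := hrot _ _ _.
have FE : c * (F - a m * F^*) = w * (c * (E - a m * E^*)) by exact: hrotE.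
have ww : w * w^* = 1 by rewrite -normCK w1 expr1n.
have w0 : w != 0 by rewrite -normr_eq0 w1 oner_eq0.
have wbar : w^* = w^-1 by rewrite -[LHS]mul1r -(mulVf w0) -mulrA ww mulr1.
have -> : c' * (F - d' / c' * F^*) =
   c * (F - a m * F^*) + b * (c * (F - a m * F^*))^*.
  have -> : c' * (F - d' / c' * F^*) = c' * F - d' * F^* by field.
  rewrite /c' /d'; clearbody F; clear; set e := a m.
  rewrite !(rmorphM, rmorphB) /= conjCK; ring.
rewrite FE.
set Y := c * (E - a m * E^*) in H *.
have YE : Y = w ^- m * q.[w ^+ 2] by rewrite -H// mulKf// expf_neq0.
rewrite pq ?normrX ?w1 ?expr1n// YE !rmorphM fmorphV rmorphXn /= wbar.
have wm0 : w ^+ m != 0 by rewrite expf_neq0.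
have -> : (w ^+ 2) ^+ m = w ^+ m * w ^+ m by rewrite -exprM mul2n -addnn exprD.
rewrite (exprS w m) exprVn invrK; move: (q.[_]) => y.
by field; rewrite w0 wm0.
Qed.

(** * Equal weights at finitely many points of the circle *)

Section Interpolation.
Variables (m : nat) (z : 'I_m.+1 -> C).
Hypothesis z1 : forall k, `|z k| = 1.
Hypothesis z_inj : injective z.

Let Q k : {poly C} := \prod_(j | j != k) ('X - (z j)%:P).
Let P : {poly C} := \prod_j ('X - (z j)%:P).
(* [P' / deg P]: the orthogonal polynomial for equal weights at the [z k]. *)
Let Phi : {poly C} := m.+1%:R^-1 *: \sum_k Q k.

Let QE k x : (Q k).[x] = \prod_(j | j != k) (x - z j).
Proof. by rewrite horner_prod; apply: eq_bigr => j _; rewrite !hornerE. Qed.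

Let PQ k x : P.[x] = (x - z k) * (Q k).[x].
Proof.
rewrite QE /P horner_prod (bigD1 k)//=; congr (_ * _); first by rewrite !hornerE.
by apply: eq_bigr => j _; rewrite !hornerE.
Qed.

Let PhiE x : m.+1%:R * Phi.[x] = \sum_k (Q k).[x].
Proof. by rewrite hornerZ mulVKf ?pnatr_eq0// horner_sum. Qed.

Let size_Q k : size (Q k) = m.+1.
Proof.
rewrite /Q -big_filter size_prod_XsubC; have [e _ _ [_ ->]] := big_enumP.
by rewrite cardC1 card_ord.
Qed.

Let Q_lead k : (Q k)`_m = 1.
Proof.
have -> : m = (size (Q k)).-1 by rewrite size_Q.
by rewrite -lead_coefE /Q lead_coef_prod_XsubC.
Qed.

Let Phi_lead : Phi`_m = 1.
Proof.
rewrite coefZ coef_sum (eq_bigr (fun=> 1)); last by move=> k _; exact: Q_lead.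
by rewrite sumr_const card_ord mulVf// pnatr_eq0.
Qed.

Let size_Phi : size Phi = m.+1.
Proof.
apply/eqP; rewrite eqn_leq; apply/andP; split.
  rewrite (leq_trans (size_scale_leq _ _))// (leq_trans (size_sum _ _ _))//.
  by apply/bigmax_leqP => k _; rewrite size_Q.
rewrite ltnNge; apply: contra_eqN Phi_lead => /(nth_default 0) ->.
by rewrite eq_sym oner_eq0.
Qed.

Let Phi_monic : Phi \is monic.
Proof. by rewrite monicE lead_coefE size_Phi Phi_lead. Qed.

(** The map [x -> x / (x - z k)] carries the exterior of the disk into the half-plane of real part
    at least 1/2. *)
Let re_ge k x : 1 <= `|x| -> x != z k ->
  1 <= x / (x - z k) + (x / (x - z k))^*.
Proof.
move=> x1 xz; have d0 : x - z k != 0 by rewrite subr_eq0.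
have d1 : (x - z k)^* != 0 by rewrite conjC_eq0.
have dd : 0 < (x - z k) * (x - z k)^* by rewrite -normCK exprn_gt0// normr_gt0.
have -> : x / (x - z k) + (x / (x - z k))^* =
    (x * (x - z k)^* + x^* * (x - z k)) / ((x - z k) * (x - z k)^*).
  rewrite rmorphM fmorphV /=; move: (x - z k) d0 d1 => d d0 d1.
  by field; apply/andP.
rewrite ler_pdivlMr// mul1r -subr_ge0 rmorphB /=.
have zz : z k * (z k)^* = 1 by rewrite -normCK z1 expr1n.
have -> : x * (x^* - (z k)^*) + x^* * (x - z k) -
  (x - z k) * (x^* - (z k)^*) = x * x^* - z k * (z k)^* by ring.
by rewrite zz -normCK subr_ge0 expr_ge1.
Qed.

(** Gauss-Lucas through real parts: off the points [z k], [x * P' / P] is the sum of the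
    [x / (x - z k)] and has positive real part. At a point [z k] only [Q k] survives, nonzero since
    the points are distinct. *)
Let Phi_neq0 x : 1 <= `|x| -> Phi.[x] != 0.
Proof.
move=> x1; suff : m.+1%:R * Phi.[x] != 0.
  by rewrite mulf_eq0 negb_or => /andP[].
rewrite PhiE; have [[k /eqP xk]|nk] := altP (@existsP _ (fun k => x == z k)).
  rewrite (bigD1 k)//= big1 ?addr0 => [|j jk].
    rewrite QE; apply/prodf_neq0 => j jk; rewrite xk subr_eq0.
    by apply: contra jk => /eqP/z_inj ->.
  by rewrite QE (bigD1 k) 1?eq_sym//= xk subrr mul0r.
have {}nk k : x != z k by apply: contraNneq nk => ->; apply/existsP; exists k.
have Pn0 : P.[x] != 0.
  rewrite /P horner_prod; apply/prodf_neq0 => k _.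
  by rewrite !hornerE subr_eq0.
have S0 : \sum_k x / (x - z k) != 0.
  have : m.+1%:R <= \sum_k x / (x - z k) + (\sum_k x / (x - z k))^*.
    have -> : m.+1%:R = \sum_(k < m.+1) (1 : C) by rewrite sumr_const card_ord.
    rewrite rmorph_sum -big_split /=.
    by apply: ler_sum => k _; exact: re_ge.
  apply: contraTneq => ->; rewrite rmorph0 addr0.
  by rewrite lern0.
have -> : \sum_k (Q k).[x] = P.[x] * (\sum_k x / (x - z k)) / x.
  rewrite -mulrA mulr_suml mulr_sumr; apply: eq_bigr => k _.
  rewrite (PQ k); field; rewrite subr_eq0 nk andbT.
  by rewrite -normr_gt0 (lt_le_trans _ x1).
by rewrite !mulf_neq0// invr_eq0 -normr_gt0 (lt_le_trans _ x1).
Qed.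

Let beta : C := (-1) ^+ m * \prod_k z k.

(** On the circle each factor satisfies [x - z j = - z j * x * conj (x - z j)]; multiply over [j]
    other than [k]. *)
Let Q_conj k x : `|x| = 1 -> z k * (Q k).[x] = beta * x ^+ m * (Q k).[x]^*.
Proof.
move=> x1; have xx : x * x^* = 1 by rewrite -normCK x1 expr1n.
have card_m : m = #|predC1 k| by rewrite cardC1 card_ord.
rewrite /beta (bigD1 k)//= mulrCA -!mulrA; congr (_ * _).
rewrite !QE rmorph_prod /= [X in _ ^+ X * _]card_m [X in _ * (_ ^+ X * _)]card_m.
rewrite -!prodr_const -!big_split /=; apply: eq_bigr => j _.
have zz : z j * (z j)^* = 1 by rewrite -normCK z1 expr1n.
rewrite rmorphB /=.
have -> : -1 * (z j * (x * (x^* - (z j)^*))) =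
  x * (z j * (z j)^*) - z j * (x * x^*) by ring.
by rewrite zz xx !mulr1.
Qed.

(** Average [P = x * Q k - z k * Q k] over [k], using [Q_conj] on the second term. This is a Szego
    step with parameter [- beta] on the unit circle. *)
Let paraorthogonal x : `|x| = 1 ->
  P.[x] = x * Phi.[x] - beta * x ^+ m * Phi.[x]^*.
Proof.
move=> x1; have n0 : m.+1%:R != 0 :> C by rewrite pnatr_eq0.
apply: (mulfI n0); rewrite mulrBr [m.+1%:R * (x * _)]mulrCA PhiE.
rewrite [m.+1%:R * (_ * _)]mulrCA.
have -> : m.+1%:R * Phi.[x]^* = (\sum_k (Q k).[x])^*.
  by rewrite -PhiE rmorphM rmorph_nat.
have -> : m.+1%:R * P.[x] = \sum_(k < m.+1) P.[x].
  by rewrite sumr_const card_ord mulr_natl.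
rewrite rmorph_sum !mulr_sumr -sumrB /=.
by apply: eq_bigr => k _; rewrite (PQ k) mulrBl Q_conj.
Qed.

Lemma inverse_spectral : exists (a : nat -> C) (e : C),
  [/\ forall k, `|a k| < 1, e != 0 &
   forall w, `|w| = 1 -> hpath a w m.+1 * e^* \is Num.real <->
     exists k, w ^+ 2 = z k].
Proof.
have [a [c [a1 c0 H]]] := hpath_poly Phi_monic size_Phi Phi_neq0.
have beta1 : `|beta| = 1.
  rewrite normrM normrX normrN1 expr1n mul1r normr_prod.
  by rewrite big1.
(* Splitting [beta] as a square makes [P = 0] symmetric: up to a nonzero factor, [P] is
   [Y * conj e0] minus its conjugate. *)
pose e0 := sqrtC beta.
have e0e0 : e0 ^+ 2 = beta by rewrite sqrtCK.
have e01 : e0 * e0^* = 1 by rewrite -normCK -normrX e0e0 beta1.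
have e00 : e0 != 0 by apply: contra_eq_neq e01 => ->; rewrite mul0r eq_sym oner_eq0.
set am := a m in H.
have am1 : 0 < 1 - am * am^* by exact/disk_den/a1.
have amn : 1 - am * am^* != 0 by rewrite gt_eqF.
have amn' : 1 - am^* * am != 0 by rewrite mulrC.
(* The solution of the real-linear equation [Le], found by combining the equation with its
   conjugate. *)
pose e := (c^-1 * e0 + am * (c^-1 * e0)^*) / (1 - am * am^*).
have Le : c * (e - am * e^*) = e0.
  rewrite /e !(rmorphM, fmorphV, rmorphB, rmorphD, rmorph1) /= !conjCK.
  have cn : c^* != 0 by rewrite conjC_eq0.
  by field; apply/and3P; split.
exists a, e; split=> //.
  apply: contra_eq_neq Le => ->.
  by rewrite rmorph0 mulr0 subrr mulr0 eq_sym.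
move=> w w1.
have ww : w * w^* = 1 by rewrite -normCK w1 expr1n.
have w0 : w != 0 by rewrite -normr_eq0 w1 oner_eq0.
have wbar : w^* = w^-1 by rewrite -[LHS]mul1r -(mulVf w0) -mulrA ww mulr1.
have zeta1 : `|w ^+ 2| = 1 by rewrite normrX w1 expr1n.
set F := hpath a w m.+1.
have FE : c * (F - am * F^*) = w * (w ^- m * Phi.[w ^+ 2]).
  by rewrite /F /= hrotE// -H// mulKf// expf_neq0.
set Y := w * _ in FE.
have realE : (F * e^* \is Num.real) = (P.[w ^+ 2] == 0).
  have -> : (F * e^* \is Num.real) = (F * e^* - F^* * e == 0).
    by rewrite CrealE rmorphM /= conjCK subr_eq0 eq_sym.
  have -> : (F * e^* - F^* * e == 0) = (Y * e0^* - Y^* * e0 == 0).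
    (* A real-linear map multiplies the area form by its determinant, here
       [|c| ^+ 2 * (1 - |am| ^+ 2)], which is positive. *)
    have -> : Y * e0^* - Y^* * e0 =
        c * c^* * (1 - am * am^*) * (F * e^* - F^* * e).
      rewrite -Le -FE; move: (F) (am) (e); clear => {}F {}am {}e.
      by rewrite !(rmorphM, rmorphB) /= !conjCK; ring.
    rewrite [in RHS]mulf_eq0 orbC; case: eqP => //= _; apply/esym/negbTE.
    by rewrite !mulf_neq0// conjC_eq0.
  have -> : P.[w ^+ 2] = (Y * e0^* - Y^* * e0) * (w ^+ m.+1 * e0).
    have -> : (Y * e0^* - Y^* * e0) * (w ^+ m.+1 * e0) =
        Y * w ^+ m.+1 * (e0 * e0^*) - Y^* * w ^+ m.+1 * e0 ^+ 2 by ring.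
    rewrite e01 e0e0 paraorthogonal//.
    have -> : Y^* = w^-1 * (w ^+ m * Phi.[w ^+ 2]^*).
      by rewrite /Y !rmorphM fmorphV rmorphXn /= wbar exprVn invrK.
    have -> : (w ^+ 2) ^+ m = w ^+ m * w ^+ m.
      by rewrite -exprM mul2n -addnn exprD.
    rewrite /Y (exprS w m); have : w ^+ m != 0 by rewrite expf_neq0.
    move: (_.[_]) (w ^+ m) (beta) => y wm bt wm0.
    by field; apply/andP; split.
  by rewrite [in RHS]mulf_eq0 orbC mulf_eq0 expf_eq0/= (negbTE w0) (negbTE e00).
rewrite realE; split.
  rewrite /P horner_prod => /prodf_eq0[k _].
  by rewrite !hornerE subr_eq0 => /eqP; exists k.
by move=> [k wk]; rewrite (PQ k) wk subrr mul0r eqxx.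
Qed.

End Interpolation.
End HyperbolicRecursion.

(** * The Dirac operator of a piecewise constant path *)

Local Open Scope complex_scope.

Section UnitCircle.
Context {R : realType}.
Implicit Types (x y : R) (z : R[i]).

Lemma conjC_ReIm z : (z^*)%R = complex.Re z -i* complex.Im z.
Proof. by case: z. Qed.

Lemma expiD x y : expi (x + y) = expi x * expi y.
Proof.
rewrite /expi cosD sinD; apply/eqP; rewrite eq_complex /=.
by apply/andP; split; apply/eqP; ring.
Qed.

Lemma expi0 : expi 0 = 1 :> R[i].
Proof. by rewrite /expi cos0 sin0. Qed.

Lemma expi_neq0 x : expi x != 0.
Proof.
apply/eqP => e; have : expi (x - x) = 0 by rewrite expiD e mul0r.
by rewrite subrr expi0 => /eqP; rewrite oner_eq0.
Qed.

Lemma expiN x : expi (- x) = (expi x)^-1.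
Proof.
apply: (mulfI (expi_neq0 x)); rewrite -expiD subrr expi0 divff//.
exact: expi_neq0.
Qed.

Lemma conj_expi x : ((expi x)^*)%R = expi (- x).
Proof. by rewrite conjC_ReIm /expi /= cosN sinN. Qed.

Lemma norm_expi x : `|expi x| = 1.
Proof.
rewrite normc_def /= cos2Dsin2 sqrtr1; by [].
Qed.

Lemma cabs_expi x : cabs (expi x) = 1.
Proof. by rewrite /cabs /= cos2Dsin2 sqrtr1. Qed.

Lemma norm_cabs z : `|z| = (cabs z)%:C.
Proof. by rewrite normc_def; case: z. Qed.

Lemma cabs_sqr z : cabs z ^+ 2 = complex.Re z ^+ 2 + complex.Im z ^+ 2.
Proof. by case: z => a b; rewrite /cabs /= sqr_sqrtr// addr_ge0 ?sqr_ge0. Qed.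

Lemma cabs_lt1 z : `|z| < 1 -> cabs z < 1.
Proof. by rewrite norm_cabs ltcE /= => /andP[]. Qed.

Lemma expi_2pi (j : int) : expi (2 * pi * j%:~R : R) = 1.
Proof.
have nat_case (m : nat) : expi (2 * pi * m%:R : R) = 1.
  elim: m => [|m IH]; first by rewrite mulr0 expi0.
  rewrite (_ : m.+1%:R = m%:R + 1 :> R); last by rewrite natr1.
  rewrite mulrDr mulr1 expiD IH mul1r /expi mulr_natl cos2pi.
  by rewrite -[pi *+ 2]add0r sinD2pi sin0.
case: j => m; first exact: nat_case.
by rewrite NegzE rmorphN /= mulrN expiN nat_case invr1.
Qed.

(** Subtracting whole turns leaves [y] in [[0, 2 pi)] with cosine 1. The inverse cosine settles
    [[0, pi]] directly and the other half after one more turn is subtracted. *)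
Lemma expi_eq1 x : expi x = 1 -> exists j : int, x = 2 * pi * j%:~R.
Proof.
move=> ex; have pi0 := pi_gt0 R.
have p2 : 0 < 2 * pi :> R by rewrite mulr_gt0.
pose j := Num.floor (x / (2 * pi)); exists j.
pose y := x - 2 * pi * j%:~R.
have ey : expi y = 1 by rewrite /y expiD expiN expi_2pi invr1 mulr1.
have [cy _] : cos y = 1 /\ sin y = 0 by case: ey.
have y0 : 0 <= y.
  by rewrite /y subr_ge0 mulrC -ler_pdivlMr// floor_le_tmp.
have y2 : y < 2 * pi.
  have : x / (2 * pi) < (j + 1)%:~R by exact: floorD1_gt.
  by rewrite ltr_pdivrMr// intrD /y; lra.
suff : y = 0 by move/eqP; rewrite subr_eq0 => /eqP.
have [ypi|ypi] := leP y pi.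
  have : y \in `[0, pi] by rewrite in_itv/= y0.
  by move/cosK; rewrite cy acos1.
have : acos (cos (y - 2 * pi)) = - (y - 2 * pi).
  by apply: cosKN; apply/andP; split; lra.
have -> : cos (y - 2 * pi) = 1.
  by rewrite mulr_natl -cosD2pi subrK.
by rewrite acos1; lra.
Qed.

Lemma expi_inj_mod x y : expi x = expi y -> exists j : int, x = y + 2 * pi * j%:~R.
Proof.
move=> e; have [|j xy] := @expi_eq1 (x - y).
  by rewrite expiD expiN e divff// expi_neq0.
by exists j; rewrite -xy addrC subrK.
Qed.

Lemma expi_surj z : `|z| = 1 -> exists x, expi x = z.
Proof.
move=> z1; have : complex.Re z ^+ 2 + complex.Im z ^+ 2 = 1.
  by rewrite -cabs_sqr; move: z1; rewrite norm_cabs => -[->]; rewrite expr1n.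
case: z {z1} => a b /= ab.
have a1 : -1 <= a <= 1.
  by rewrite -ler_norml -(expr_le1 (n := 2))// real_normK ?num_real// -ab lerDl sqr_ge0.
have ca : cos (acos a) = a by rewrite acosK// in_itv.
have sa : sin (acos a) = `|b|.
  by rewrite sin_acos// -ab addrAC subrr add0r sqrtr_sqr.
have [b0|b0] := leP 0 b.
  by exists (acos a); rewrite /expi ca sa ger0_norm.
by exists (- acos a); rewrite /expi cosN sinN ca sa ltr0_norm// opprK.
Qed.

End UnitCircle.

(** * Clamped time and bounded Lipschitz functions *)

Section ClampedTime.
Context {R : realType}.
Implicit Types (f g : R -> R) (t : R).

(** [unit_clamp (t - k%:R)] is the part of step [k] completed at time [t]. With it one product over
    all steps is valid at every time: steps to come contribute the identity. *)
Definition unit_clamp t : R := Num.max 0 (Num.min 1 t).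

Lemma unit_clamp_le0 t : t <= 0 -> unit_clamp t = 0.
Proof. by move=> t0; rewrite /unit_clamp min_r ?max_l// (le_trans t0). Qed.

Lemma unit_clamp_ge1 t : 1 <= t -> unit_clamp t = 1.
Proof. by move=> t1; rewrite /unit_clamp min_l// max_r. Qed.

Lemma unit_clamp_id t : 0 <= t <= 1 -> unit_clamp t = t.
Proof. by move=> /andP[t0 t1]; rewrite /unit_clamp min_r// max_r. Qed.

Lemma unit_clamp_mono s t : s <= t -> unit_clamp s <= unit_clamp t.
Proof.
move=> st; have [s0|s0] := leP s 0.
  by rewrite (unit_clamp_le0 s0) /unit_clamp le_max lexx.
have [t1|t1] := leP 1 t; first by rewrite (unit_clamp_ge1 t1) /unit_clamp ge_max ler01 ge_min lexx.
by rewrite !unit_clamp_id//; lra.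
Qed.

Lemma unit_clamp_lip s t : `|unit_clamp t - unit_clamp s| <= `|t - s|.
Proof.
wlog st : s t / s <= t.
  move=> hw; have [/hw //|/ltW /hw] := leP s t.
  by rewrite distrC [X in _ <= X]distrC.
rewrite !ger0_norm ?subr_ge0 ?unit_clamp_mono//.
have [s0|s0] := leP s 0; have [t1|t1] := leP 1 t.
- by rewrite unit_clamp_ge1// unit_clamp_le0//; lra.
- rewrite (unit_clamp_le0 s0); have [t0|t0] := leP t 0; first by rewrite unit_clamp_le0//; lra.
  by rewrite unit_clamp_id; lra.
- rewrite (unit_clamp_ge1 t1); have [s1|s1] := leP 1 s; first by rewrite unit_clamp_ge1//; lra.
  by rewrite unit_clamp_id; lra.
- by rewrite !unit_clamp_id//; lra.
Qed.

Lemma eq_is_derive_itv f g (a b t d : R) : a < t < b ->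
  (forall s, a < s < b -> f s = g s) ->
  is_derive t (1 : R) f d -> is_derive t (1 : R) g d.
Proof.
move=> /andP[at_ tb] fg; apply: near_eq_is_derive; near=> s; apply: fg.
by apply/andP; split; near: s; [exact: lt_nbhsr|exact: lt_nbhsl].
Unshelve. all: by end_near. Qed.

Lemma is_derive_unit_clamp (j k : nat) t : j%:R < t < j.+1%:R ->
  is_derive t (1 : R) (fun s => unit_clamp (s - k%:R)) (k == j)%:R.
Proof.
move=> jtj.
have js : j.+1%:R = j%:R + 1 :> R by rewrite natr1.
have [->|kj] := eqVneq k j.
  apply: (@eq_is_derive_itv (fun s => s - j%:R) _ _ _ _ _ jtj).
    by move=> s; rewrite js => /andP[h1 h2]; rewrite unit_clamp_id//; lra.
  have := is_deriveB (is_derive_id t (1 : R)) (is_derive_cst (j%:R : R) t 1).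
  by rewrite subr0.
have [kltj|jltk] : (k < j)%N \/ (j < k)%N.
  by move: kj; rewrite neq_ltn => /orP.
- have kj1 : k%:R + 1 <= j%:R :> R by rewrite natr1 ler_nat.
  apply: (@eq_is_derive_itv (cst 1) _ _ _ _ _ jtj).
  by move=> s /andP[h1 h2]; rewrite unit_clamp_ge1//; lra.
- have kj1 : j.+1%:R <= k%:R :> R by rewrite ler_nat.
  apply: (@eq_is_derive_itv (cst 0) _ _ _ _ _ jtj).
  by move=> s /andP[h1 h2]; rewrite unit_clamp_le0//; lra.
Qed.

Lemma derive_lipschitz f df K x y :
  (forall z, is_derive z (1 : R) f (df z)) -> (forall z, `|df z| <= K) ->
  `|f y - f x| <= K * `|y - x|.
Proof.
move=> d dK; wlog xy : x y / x <= y.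
  move=> hw; have [/hw //|/ltW /hw] := leP x y.
  by rewrite distrC [X in _ <= _ * X]distrC.
have [|c _ ->] := @MVT_segment _ f df x y xy (fun z _ => d z).
  by apply: (@is_derive_within _ f df).
by rewrite normrM ler_wpM2r.
Qed.

(** Boundedness is included so that the class is closed under products. *)
Definition bounded_lipschitz f := exists2 K, (forall t, `|f t| <= K) &
  forall s t, `|f t - f s| <= K * `|t - s|.

Lemma bounded_lipschitz_cst k : bounded_lipschitz (cst k).
Proof. by exists `|k| => // s t; rewrite subrr normr0 mulr_ge0. Qed.

Lemma bounded_lipschitzD f g : bounded_lipschitz f -> bounded_lipschitz g -> bounded_lipschitz (fun t => f t + g t).
Proof.
move=> [K fK fL] [M gM gL]; exists (K + M) => [t|s t].
  by rewrite (le_trans (ler_normD _ _))// lerD.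
rewrite opprD addrACA (le_trans (ler_normD _ _))// mulrDl lerD//.
Qed.

Lemma bounded_lipschitzM f g : bounded_lipschitz f -> bounded_lipschitz g -> bounded_lipschitz (fun t => f t * g t).
Proof.
move=> [K fK fL] [M gM gL].
have K0 : 0 <= K by exact: le_trans (fK 0).
have M0 : 0 <= M by exact: le_trans (gM 0).
exists (K * M + 2 * (K * M)) => [t|s t].
  rewrite normrM (@le_trans _ _ (K * M)) ?ler_pM// lerDl.
  by rewrite !mulr_ge0.
have -> : f t * g t - f s * g s = (f t - f s) * g t + f s * (g t - g s) by ring.
rewrite (le_trans (ler_normD _ _))// !normrM.
have h1 : `|f t - f s| * `|g t| <= K * `|t - s| * M by rewrite ler_pM.
have h2 : `|f s| * `|g t - g s| <= K * (M * `|t - s|) by rewrite ler_pM.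
apply: le_trans (lerD h1 h2) _.
have -> : K * `|t - s| * M + K * (M * `|t - s|) = 2 * (K * M) * `|t - s| by ring.
by rewrite ler_wpM2r// lerDr mulr_ge0.
Qed.

Lemma bounded_lipschitz_abs_continuous f a b : bounded_lipschitz f -> abs_continuous a b f.
Proof.
move=> [K _ fL]; apply: (@lipschitz_abs_continuous _ _ _ _ K) => x y _ xy _.
by have := fL x y; rewrite [`|y - x|]ger0_norm// subr_ge0.
Qed.

Lemma bounded_lipschitz_unit_clamp (c : R) : bounded_lipschitz (fun t => unit_clamp (t - c)).
Proof.
exists 1 => [t|s t].
  have := @unit_clamp_mono; rewrite /unit_clamp ler_norml le_max ge_max ge_min lexx ler01 lerN10 //=.
rewrite mul1r (le_trans (unit_clamp_lip _ _))// opprB addrA subrK//.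
Qed.

Lemma bounded_lipschitz_comp f g df K : (forall z, is_derive z (1 : R) f (df z)) ->
  (forall z, `|df z| <= K) -> (forall z, `|f z| <= K) -> bounded_lipschitz g ->
  bounded_lipschitz (fun t => f (g t)).
Proof.
move=> d dK fK [M gM gL]; have K0 : 0 <= K by exact: le_trans (fK 0).
have M0 : 0 <= M by exact: le_trans (gM 0).
exists (K + K * M) => [t|s t]; first by rewrite (le_trans (fK _))// lerDl mulr_ge0.
rewrite (le_trans (derive_lipschitz _ _ d dK))//.
apply: (@le_trans _ _ (K * (M * `|t - s|))); first by rewrite ler_wpM2l.
by rewrite mulrA ler_wpM2r// lerDr.
Qed.

End ClampedTime.

(** * Hyperbolic rotations as real matrices *)

Section DiskMetric.
Context {R : realType}.
Local Notation i0 := (ord0 : 'I_2).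
Local Notation i1 := (lift ord0 ord0 : 'I_2).
Local Notation J := (Jmx R).
Implicit Types (z : R[i]) (s t l : R).

Definition disk_r z := complex.Re z ^+ 2 + complex.Im z ^+ 2.

(* [x^T (hmat z) x] is [|E - z E^*|^2 / (1 - |z|^2)] for [E = x0 - i x1]. *)
Definition hmat z : 'M[R]_2 := let p := complex.Re z in let q := complex.Im z in
  (1 - disk_r z)^-1 *: \matrix_(i, j)
    (if i == i0 then if j == i0 then (1 - p) ^+ 2 + q ^+ 2 else 2 * q
     else if j == i0 then 2 * q else (1 + p) ^+ 2 + q ^+ 2).

Lemma disk_rE z : `|z| < 1 -> 0 < 1 - disk_r z.
Proof.
move=> /cabs_lt1 z1; rewrite subr_gt0 /disk_r -cabs_sqr expr_lt1//.
by rewrite /cabs; case: z {z1} => a b; exact: sqrtr_ge0.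
Qed.

Lemma hmatE z : let p := complex.Re z in let q := complex.Im z in
  let d := (1 - disk_r z)^-1 in
  (hmat z i0 i0 = d * ((1 - p) ^+ 2 + q ^+ 2)) * (hmat z i0 i1 = d * (2 * q)) *
  (hmat z i1 i0 = d * (2 * q)) * (hmat z i1 i1 = d * ((1 + p) ^+ 2 + q ^+ 2)).
Proof. by rewrite !mxE. Qed.

Lemma hmat_sym z : (hmat z)^T = hmat z.
Proof. by apply/matrixP; do 2!apply: ord2P; rewrite mxE !hmatE. Qed.

Lemma hmat_det z : `|z| < 1 ->
  hmat z i0 i0 * hmat z i1 i1 - hmat z i0 i1 * hmat z i1 i0 = 1.
Proof.
move=> /disk_rE d0; have dn : 1 - disk_r z != 0 by rewrite gt_eqF.
rewrite !hmatE; rewrite /disk_r in dn *.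
by field.
Qed.

Lemma disk_rN z : disk_r (- z) = disk_r z.
Proof. by rewrite /disk_r; case: z => a b /=; rewrite !sqrrN. Qed.

(** The determinant is 1, and changing the sign of [z] swaps the diagonal and negates the
    off-diagonal entries, which gives the adjugate. *)
Lemma hmatK z : `|z| < 1 -> hmat z *m hmat (- z) = 1%:M.
Proof.
move=> z1; have d0 := disk_rE z1; have dn : 1 - disk_r z != 0 by rewrite gt_eqF.
have reN : complex.Re (- z) = - complex.Re z by case: z {z1 d0 dn}.
have imN : complex.Im (- z) = - complex.Im z by case: z {z1 d0 dn reN}.
apply/matrixP => i j; rewrite mul22E; move: i j.
by do 2!apply: ord2P; rewrite !hmatE disk_rN reN imN mxE /=; rewrite /disk_r in dn *; field.
Qed.

Lemma JHE z (H := hmat z) : ((J *m H) i0 i0 = - H i1 i0) * ((J *m H) i0 i1 = - H i1 i1) *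
  ((J *m H) i1 i0 = H i0 i0) * ((J *m H) i1 i1 = H i0 i1).
Proof. by do !split; rewrite mul22E !JE; ring. Qed.

Lemma N1E (i j : 'I_2) : (- 1%:M : 'M[R]_2) i j = - (i == j)%:R.
Proof. by rewrite !mxE. Qed.

Lemma symplectic_det (A : 'M[R]_2) :
  A^T *m J *m A = (A i0 i0 * A i1 i1 - A i0 i1 * A i1 i0) *: J.
Proof.
apply/matrixP => i j; rewrite -mulmxA mul22E [RHS]mxE !mul22E ![A^T _ _]mxE.
by move: i j; do 2!apply: ord2P; rewrite !JE; ring.
Qed.

(** [J *m hmat z] has trace 0, as [hmat z] is symmetric, and determinant 1; this is its
    Cayley-Hamilton equation. *)
Lemma JH_sqr z : `|z| < 1 -> (J *m hmat z) *m (J *m hmat z) = - 1%:M.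
Proof.
move=> z1; have hd := hmat_det z1.
have hs : hmat z i1 i0 = hmat z i0 i1 by rewrite !hmatE.
apply/matrixP => i j; rewrite mul22E; move: i j.
do 2!apply: ord2P; rewrite !JHE N1E -?hs/=.
- transitivity (- (hmat z i0 i0 * hmat z i1 i1 - hmat z i0 i1 * hmat z i1 i0)).
    by rewrite hs; ring.
  by rewrite hd.
- by rewrite hs; ring.
- by rewrite hs; ring.
- transitivity (- (hmat z i0 i0 * hmat z i1 i1 - hmat z i0 i1 * hmat z i1 i0)).
    by rewrite hs; ring.
  by rewrite hd.
Qed.

(** The eigenvalues are positive with product 1, so the smaller one is at least the inverse of the
    trace. *)
Lemma hmat_coercive z (x : 'cV[R]_2) : `|z| < 1 ->
  x i0 ord0 ^+ 2 + x i1 ord0 ^+ 2 <=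
  (hmat z i0 i0 + hmat z i1 i1) * (x^T *m hmat z *m x) ord0 ord0.
Proof.
move=> z1; have hd := hmat_det z1.
have hs : hmat z i1 i0 = hmat z i0 i1 by rewrite !hmatE.
rewrite -mulmxA [(_ *m _) ord0 ord0]mxE sum2 ![(x^T) _ _]mxE !mul2cE hs.
rewrite hs in hd.
set a := hmat z i0 i0 in hd *; set b := hmat z i0 i1 in hd *.
set c := hmat z i1 i1 in hd *; set u := x i0 ord0; set v := x i1 ord0.
rewrite -subr_ge0.
have -> : (a + c) * (u * (a * u + b * v) + v * (b * u + c * v)) -
    (u ^+ 2 + v ^+ 2) = (a * u + b * v) ^+ 2 + (b * u + c * v) ^+ 2 +
    (a * c - b * b - 1) * (u ^+ 2 + v ^+ 2) by ring.
by rewrite hd subrr mul0r addr0 addr_ge0 ?sqr_ge0.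
Qed.

(** By [JH_sqr] this is the matrix exponential of [- s *: (J *m hmat z)]. *)
Definition rotm z s : 'M[R]_2 := cos s *: 1%:M - sin s *: (J *m hmat z).

Lemma rotm0 z : rotm z 0 = 1%:M.
Proof. by rewrite /rotm cos0 sin0 scale1r scale0r subr0. Qed.

Lemma rotmE z s i j : rotm z s i j = cos s * (i == j)%:R - sin s * (J *m hmat z) i j.
Proof. by rewrite !mxE. Qed.

Lemma rotm_symplectic z s : `|z| < 1 -> (rotm z s)^T *m J *m rotm z s = J.
Proof.
move=> z1; have hd := hmat_det z1.
have hs : hmat z i1 i0 = hmat z i0 i1 by rewrite !hmatE.
have cs := cos2Dsin2 s.
rewrite symplectic_det !rotmE !JHE /= hs -[RHS]scale1r; congr (_ *: _).
transitivity (cos s ^+ 2 + sin s ^+ 2 *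
  (hmat z i0 i0 * hmat z i1 i1 - hmat z i0 i1 * hmat z i0 i1)); first by ring.
by move: hd; rewrite hs => ->; rewrite mulr1.
Qed.

End DiskMetric.

(** * Weight and transfer matrix of a piecewise constant path *)

Section PiecewiseRotation.
Context {R : realType}.
Local Notation mu := (@lebesgue_measure R).
Local Notation i0 := (ord0 : 'I_2).
Local Notation i1 := (lift ord0 ord0 : 'I_2).
Local Notation J := (Jmx R).
Variables (a : nat -> R[i]) (n : nat).
Hypothesis a1 : forall k, `|a k| < 1.
Hypothesis n0 : (0 < n)%N.
Implicit Types (t l : R).

(** Scales the weight so that one step has angle [l / (2n)]. The square of the corresponding unit
    number is [e ^ (i l / n)], which meets [e ^ (i lam k)] exactly for [l] in the required set. *)
Let w : R := (2 * n%:R)^-1.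
Let w0 : 0 < w. Proof. by rewrite invr_gt0 mulr_gt0// ltr0n. Qed.

Definition turn l (k : nat) t := w * l * unit_clamp (t - k%:R).

Fixpoint Ymat l m t : 'M[R]_2 :=
  if m is m'.+1 then rotm (a m') (turn l m' t) *m Ymat l m' t else 1%:M.

Definition Wpath t := w *: hmat (a (Num.truncn t)).
Definition Vpath t := w^-1 *: hmat (- a (Num.truncn t)).

Lemma hmat_trace_gt0 (z : R[i]) : `|z| < 1 -> 0 < hmat z i0 i0 + hmat z i1 i1.
Proof.
move=> z1; have d0 := disk_rE z1.
have di : 0 < (1 - disk_r z)^-1 by rewrite invr_gt0.
rewrite !hmatE -mulrDr pmulr_rgt0//.
set p := complex.Re z; set q := complex.Im z.
have := sqr_ge0 p; have := sqr_ge0 q; nra.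
Qed.

Lemma is_derive_rotm z (x : R) i j : `|z| < 1 ->
  is_derive x (1 : R) (fun s => rotm z s i j) (- ((J *m hmat z *m rotm z x) i j)).
Proof.
move=> z1; have -> : (fun s => rotm z s i j) =
    (fun s => cos s * (i == j)%:R - sin s * (J *m hmat z) i j).
  by apply/funext => s; rewrite rotmE.
have := JH_sqr z1; rewrite /rotm; move: (J *m hmat z) => K KK.
have -> : K *m (cos x *: 1%:M - sin x *: K) = cos x *: K + sin x *: 1%:M.
  by rewrite mulmxBr -!scalemxAr mulmx1 KK scalerN opprK.
have d1 := is_deriveM (is_derive_cos x) (is_derive_cst ((i == j)%:R : R) x 1).
have d2 := is_deriveM (is_derive_sin x) (is_derive_cst (K i j) x 1).
apply: is_derive_eq (is_deriveB d1 d2) _.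
by rewrite !mxE /GRing.scale /=; ring.
Qed.

Lemma bounded_lipschitz_rotm z l k i j : bounded_lipschitz (fun t => rotm z (turn l k t) i j).
Proof.
have bt : bounded_lipschitz (turn l k).
  by apply: bounded_lipschitzM; [exact: bounded_lipschitz_cst|exact: bounded_lipschitz_unit_clamp].
have -> : (fun t => rotm z (turn l k t) i j) =
    (fun t => cos (turn l k t) * (i == j)%:R + - (J *m hmat z) i j * sin (turn l k t)).
  by apply/funext => s; rewrite rotmE; ring.
apply: bounded_lipschitzD; apply: bounded_lipschitzM; try exact: bounded_lipschitz_cst.
  apply: (@bounded_lipschitz_comp _ _ _ _ 1 (@is_derive_cos R)) bt => x.
    by rewrite normrN ler_norml sin_geN1 sin_le1.
  by rewrite ler_norml cos_geN1 cos_le1.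
apply: (@bounded_lipschitz_comp _ _ _ _ 1 (@is_derive_sin R)) bt => x.
  by rewrite ler_norml cos_geN1 cos_le1.
by rewrite ler_norml sin_geN1 sin_le1.
Qed.

Lemma bounded_lipschitz_Ymat l m i j : bounded_lipschitz (fun t => Ymat l m t i j).
Proof.
elim: m i j => [|m IH] i j /=; first exact: bounded_lipschitz_cst.
have -> : (fun t => (rotm (a m) (turn l m t) *m Ymat l m t) i j) =
   (fun t => rotm (a m) (turn l m t) i i0 * Ymat l m t i0 j +
             rotm (a m) (turn l m t) i i1 * Ymat l m t i1 j).
  by apply/funext => t; rewrite mul22E.
by apply: bounded_lipschitzD; apply: bounded_lipschitzM => //; exact: bounded_lipschitz_rotm.
Qed.

Lemma Ymat_symplectic l m t : (Ymat l m t)^T *m J *m Ymat l m t = J.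
Proof.
elim: m => [|m IH] /=; first by rewrite trmx1 mul1mx mulmx1.
rewrite trmx_mul !mulmxA -[_ *m _ *m J]mulmxA -[_ *m _ *m rotm _ _]mulmxA.
by rewrite rotm_symplectic.
Qed.

Lemma Ymat0 l m : Ymat l m 0 = 1%:M.
Proof.
elim: m => //= m ->.
by rewrite /turn unit_clamp_le0 ?sub0r ?oppr_le0// mulr0 rotm0 mulmx1.
Qed.

(** During step [j] only factor [j] moves: the earlier factors are constant and the later ones are
    still the identity. The moving factor is therefore effectively the leftmost one, where the
    generator must appear; if it is not among the first [m] factors the product is constant. *)
Lemma is_derive_Ymat l m (j : nat) t i i' : j%:R < t < j.+1%:R ->
  is_derive t (1 : R) (fun s => Ymat l m s i i')
    (if (j < m)%N then (- l *: (J *m Wpath t *m Ymat l m t)) i i' else 0).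
Proof.
move=> jtj; have tj : Num.truncn t = j.
  by apply: truncn_def; have /andP[/ltW -> ->] := jtj.
elim: m i i' => [|m IH] i i' /=; first exact: is_derive_cst.
have -> : (fun s => (rotm (a m) (turn l m s) *m Ymat l m s) i i') =
   (fun s => rotm (a m) (turn l m s) i i0 * Ymat l m s i0 i' +
             rotm (a m) (turn l m s) i i1 * Ymat l m s i1 i').
  by apply/funext => s; rewrite mul22E.
have dt : is_derive t (1 : R) (turn l m) (w * l * (m == j)%:R).
  have := is_deriveZ (w * l) (is_derive_unit_clamp m jtj).
  by rewrite /GRing.scale /=.
pose dr i i' := is_derive1_comp
  (is_derive_rotm (turn l m t) i i' (a1 m)) dt.
have dY := is_deriveD (is_deriveM (dr i i0) (IH i0 i'))
                      (is_deriveM (dr i i1) (IH i1 i')).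
apply: is_derive_eq dY _.
rewrite /GRing.scale /= /Wpath tj.
move: (Ymat l m t) => B; have f0 : (false%:R : R) = 0 by [].
have [jm|mj|jm] := ltngtP j m.
- have -> : turn l m t = 0.
    rewrite /turn unit_clamp_le0 ?mulr0// subr_le0; have /andP[_ /ltW tj1] := jtj.
    by rewrite (le_trans tj1)// ler_nat.
  rewrite ltnS (ltnW jm) f0 !mulr0 !addr0 rotm0 mul1mx.
  move: (scalemx _ _) => X.
  by move: i; apply: ord2P; rewrite [1%:M _ _]mxE [X in _ + X * _]mxE /=; ring.
- by rewrite ltnS leqNgt mj /= f0 !mulr0 !addr0.
- rewrite ltnS jm leqnn !mulr0 !add0r.
  have -> : J *m (w *: hmat (a m)) *m (rotm (a m) (turn l m t) *m B) =
      w *: (J *m hmat (a m) *m rotm (a m) (turn l m t) *m B).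
    by rewrite -scalemxAr -!scalemxAl !mulmxA.
  move: (J *m hmat (a m) *m _) => X.
  rewrite -/((- l) *: _) scalerA [RHS]mxE mul22E (_ : true%:R = 1 :> R)//; ring.
Qed.

Lemma Ymat_abs_continuous l m b i j : abs_continuous 0 b (fun t => Ymat l m t i j).
Proof. exact/bounded_lipschitz_abs_continuous/bounded_lipschitz_Ymat. Qed.

Lemma ae_nat : {ae mu, forall t : R, forall k : nat, t != k%:R}.
Proof.
have : mu.-negligible [set (k%:R : R) | k in [set: nat]].
  apply: negligible_countable; apply: (sub_countable (card_image_le _ _)).
  exact: countableP.
move=> [N [mN N0 NS]]; exists N; split => // t /= h; apply: NS => /=.
move: h => /existsNP[k /negP]; rewrite negbK => /eqP tk.
by exists k.
Qed.

Lemma ode_Ymat l : {ae mu, forall t : R, 0 < t < n%:R -> forall i j,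
  is_derive t (1 : R) (fun s => Ymat l n s i j)
    ((- l *: (J *m Wpath t *m Ymat l n t)) i j)}.
Proof.
apply: ae_sub ae_nat => t tn /andP[t0 tltn] i j.
have /andP[h1 h2] := truncn_itv (ltW t0).
have := @is_derive_Ymat l n (Num.truncn t) t i j.
rewrite h2 lt_neqAle eq_sym tn h1 truncn_lt_nat ?ltW// tltn; exact.
Qed.

Lemma Wpath_sym t : (Wpath t)^T = Wpath t.
Proof. by rewrite /Wpath linearZ /= hmat_sym. Qed.

Lemma WVpath t : Wpath t *m Vpath t = 1%:M.
Proof.
rewrite /Wpath /Vpath -scalemxAl -scalemxAr hmatK// scalerA divff ?scale1r//.
by rewrite gt_eqF.
Qed.

Local Notation D := (`[0, n%:R[%classic : set (measurableTypeR R)).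

Lemma measurable_step (G : nat -> R) :
  measurable_fun D ((fun t => G (Num.truncn t)) : measurableTypeR R -> R).
Proof.
apply: (@eq_measurable_fun _ _ _ _ _
   (fun t : R => \sum_(k < n) G k * \1_(`[k%:R, k.+1%:R[%classic) t)).
  move=> t; rewrite inE /= in_itv /= => /andP[t0 tn].
  have tk : (Num.truncn t < n)%N by rewrite truncn_lt_nat.
  rewrite (bigD1 (Ordinal tk))//= big1 ?addr0 => [|k kt].
    by rewrite indicE mem_set ?mulr1//= in_itv/= truncn_itv.
  rewrite indicE memNset ?mulr0//= in_itv/= -truncn_eq// => /eqP e.
  by move: kt; rewrite -val_eqE/= e eqxx.
apply: measurable_sum => k; apply: measurable_funM; first exact: measurable_cst.
by apply: measurable_indic; exact: measurable_itv.
Qed.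

Lemma bounded_step (G : nat -> R) t : D t ->
  `|G (Num.truncn t)| <= \sum_(k < n) `|G k|.
Proof.
rewrite /= in_itv /= => /andP[t0 tn].
have tk : (Num.truncn t < n)%N by rewrite truncn_lt_nat.
by rewrite (bigD1 (Ordinal tk))//= lerDl sumr_ge0.
Qed.

Lemma measurable_Wpath i j : measurable_fun D ((fun t => Wpath t i j) : measurableTypeR R -> R).
Proof. exact: (measurable_step (fun k => (w *: hmat (a k)) i j)). Qed.

Lemma measurable_Vpath i j : measurable_fun D ((fun t => Vpath t i j) : measurableTypeR R -> R).
Proof. exact: (measurable_step (fun k => (w^-1 *: hmat (- a k)) i j)). Qed.

Lemma WVpath_bounded : exists M, forall t i j, D t ->
  `|Wpath t i j| <= M /\ `|Vpath t i j| <= M.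
Proof.
pose G k := \sum_i \sum_j (`|(w *: hmat (a k)) i j| + `|(w^-1 *: hmat (- a k)) i j|).
exists (\sum_(k < n) `|G k|) => t i j Dt.
have G0 k i' : 0 <= \sum_j (`|(w *: hmat (a k)) i' j| + `|(w^-1 *: hmat (- a k)) i' j|).
  by apply: sumr_ge0 => j' _; rewrite addr_ge0.
have h : `|(w *: hmat (a (Num.truncn t))) i j| +
    `|(w^-1 *: hmat (- a (Num.truncn t))) i j| <= G (Num.truncn t).
  rewrite /G (bigD1 i)//= (bigD1 j)//= -addrA lerDl addr_ge0//.
    by apply: sumr_ge0 => j' _; rewrite addr_ge0.
  by apply: sumr_ge0 => j' _.
have hb := bounded_step G Dt.
have hG := ler_norm (G (Num.truncn t)).
by split; apply: le_trans hb; apply: le_trans hG; apply: le_trans h;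
  rewrite ?lerDl ?lerDr.
Qed.

Lemma Wpath_coercive : exists2 m, 0 < m & forall t (x : 'cV[R]_2), D t ->
  m * (x i0 ord0 ^+ 2 + x i1 ord0 ^+ 2) <= (x^T *m Wpath t *m x) ord0 ord0.
Proof.
pose G k := hmat (a k) i0 i0 + hmat (a k) i1 i1.
pose S := \sum_(k < n) `|G k|.
(* [S] bounds the trace of each [hmat (a k)] with [k < n], the constant of [hmat_coercive]. *)
exists (w / (S + 1)) => [|t x Dt].
  by rewrite divr_gt0// ltr_wpDl// sumr_ge0.
have S1 : 0 < S + 1 by rewrite ltr_wpDl// sumr_ge0.
rewrite mulrAC ler_pdivrMr// /Wpath -scalemxAr -scalemxAl mxE -mulrA ler_pM2l//.
set k := Num.truncn t; set y := (_ *m _) ord0 ord0.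
have hc := hmat_coercive x (a1 k); rewrite -/y in hc.
have GS : G k <= S by exact: le_trans (ler_norm _) (bounded_step G Dt).
have y0 : 0 <= y.
  have t0 := hmat_trace_gt0 (a1 k).
  rewrite -(pmulr_rge0 _ t0); apply: le_trans hc.
  by rewrite addr_ge0 ?sqr_ge0.
apply: le_trans hc _; rewrite mulrC ler_wpM2l//.
by rewrite (le_trans GS)// lerDl.
Qed.

End PiecewiseRotation.

(** * From the transfer matrix to the spectrum *)

Section DiracSpectrum.
Context {R : realType}.
Local Notation mu := (@lebesgue_measure R).
Local Notation i0 := (ord0 : 'I_2).
Local Notation i1 := (lift ord0 ord0 : 'I_2).
Local Notation J := (Jmx R).

Definition vecC (x : 'cV[R]_2) : R[i] := x i0 ord0 -i* x i1 ord0.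

(** The bridge from the differential equation to the recursion: the transfer matrix of a step acts
    on [vecC] as the rotation about its centre. *)
Lemma vecC_rotm (z : R[i]) s x : `|z| < 1 ->
  vecC (rotm z s *m x) = hrot z (expi s) (vecC x).
Proof.
move=> z1; have d0 := disk_rE z1.
have dn : 1 - disk_r z != 0 by rewrite gt_eqF.
have zz : 1 - z * (z^*)%R = (1 - disk_r z)%:C.
  rewrite /disk_r conjC_ReIm; case: z {z1 d0 dn} => p q /=.
  by apply/eqP; rewrite eq_complex /=; apply/andP; split; apply/eqP; ring.
have cn : (1 - disk_r z)%:C != 0 by rewrite eq_complex /= negb_and dn.
apply: (mulIf cn); rewrite /hrot zz divfK//.
rewrite /vecC !mul2cE !rotmE !JHE !hmatE !conjC_ReIm /expi /=.
case: z {z1 d0 zz cn} dn => p q; rewrite /disk_r /= => dn.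
apply/eqP; rewrite eq_complex /=.
by apply/andP; split; apply/eqP; field.
Qed.

Variables (n : nat) (lam : 'I_n -> R).
Hypothesis n0 : (0 < n)%N.

Let w : R := (2 * n%:R)^-1.

Lemma vecC_Ymat (a : nat -> R[i]) l m (u : 'cV[R]_2) : (forall k, `|a k| < 1) ->
  vecC u = 1 -> (m <= n)%N ->
  vecC (Ymat a n l m n%:R *m u) = hpath a (expi (w * l)) m.
Proof.
move=> a1 u1; elim: m => [|m IH] mn /=; first by rewrite mul1mx.
rewrite -mulmxA (vecC_rotm _ _ (a1 m)) (IH (ltnW mn)).
congr (hrot _ (expi _) _).
rewrite /turn unit_clamp_ge1 ?mulr1// lerBrDr addrC natr1 ler_nat//.
Qed.

Lemma unitary_pointsP l : unitary_points lam l <->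
  exists k, expi (w * l) ^+ 2 = expi (lam k).
Proof.
have nn : n%:R != 0 :> R by rewrite pnatr_eq0 -lt0n.
have e2 : expi (w * l) ^+ 2 = expi (l / n%:R).
  by rewrite expr2 -expiD; congr expi; rewrite /w; field.
rewrite e2; split.
  move=> [k [j ->]]; exists k.
  have -> : (n%:R * lam k + 2 * pi * n%:R * j%:~R) / n%:R = lam k + 2 * pi * j%:~R.
    by field.
  by rewrite expiD expi_2pi mulr1.
move=> [k /expi_inj_mod[j lj]]; exists k, j.
by rewrite -[LHS](divfK nn) lj; ring.
Qed.

(** Supplies the real point with [chi] nonzero from which self-adjointness is proved; the set is
    countable and the line is not. *)
Lemma unitary_points_proper : exists l, ~ unitary_points lam l.
Proof.
apply: contrapT => /forallNP h.
have : countable [set: R].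
  apply: (@sub_countable _ _ _ (range (fun kj : 'I_n * int =>
    n%:R * lam kj.1 + 2 * pi * n%:R * kj.2%:~R))).
    apply: subset_card_le => x _; have /contrapT[k [j ->]] := h x.
    by exists (k, j).
  by apply: (sub_countable (card_image_le _ _)); exact: countableP.
move=> /countable_lebesgue_measure0 R0.
have : (mu `[0%R, 1%R]%classic <= 0)%E.
  rewrite -R0; apply: le_measure => //; apply: mem_set; first exact: measurable_itv.
  exact: measurableT.
by rewrite lebesgue_measure_itv/= lte_fin ltr01 oppr0 adde0 lee_fin ler10.
Qed.

Lemma dirac_exists (a : nat -> R[i]) (e : R[i]) : (forall k, `|a k| < 1) ->
  e != 0 ->
  (forall z : R[i], `|z| = 1 -> hpath a z n * (e^*)%R \is Num.real <->
     exists k, z ^+ 2 = expi (lam k)) ->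
  exists (T : \bar R) (W : R -> 'M[R]_2) (u0 u1 : 'cV[R]_2),
     [/\ dirac_data T W u0 u1,
         self_adjoint T W (dirac_op T W u0 u1) &
         spectrum T W (dirac_op T W u0 u1) = unitary_points lam].
Proof.
move=> a1 e0 H.
(* Chosen so that [vecC u0 = 1], the start of [hpath], and [vecC u1 = e]. *)
pose u0 : 'cV[R]_2 := \col_i (if i == i0 then 1 else 0).
pose u1 : 'cV[R]_2 := \col_i (if i == i0 then complex.Re e else - complex.Im e).
have T0 : 0 < n%:R :> R by rewrite ltr0n.
have u00 : u0 != 0.
  by apply/eqP => /matrixP/(_ i0 ord0); rewrite !mxE /= => /eqP; rewrite oner_eq0.
have u10 : u1 != 0.
  apply: contra_neq e0 => u1e.
  have h0 := congr1 (fun x : 'cV[R]_2 => x i0 ord0) u1e.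
  have h1 := congr1 (fun x : 'cV[R]_2 => x i1 ord0) u1e.
  rewrite !mxE /= in h0 h1; apply/eqP; rewrite eq_complex /= h0 eqxx.
  by move/eqP: h1; rewrite oppr_eq0.
have [M HM] := @WVpath_bounded R a n.
have [m m0 Hm] := Wpath_coercive a1 n0.
have WM t i j Dt := (HM t i j Dt).1.
have VM t i j Dt := (HM t i j Dt).2.
have mW := @measurable_Wpath R a n.
have mV := @measurable_Vpath R a n.
have WV := @WVpath R a n a1 n0.
have Ws := @Wpath_sym R a n.
pose Y l t := Ymat a n l n t.
have acY l i j : abs_continuous 0 n%:R (fun t => Y l t i j).
  exact: Ymat_abs_continuous.
have dY l := @ode_Ymat R a n a1 l.
have Y0 l : Y l 0 = 1%:M by exact: Ymat0.
have YJ l t : (Y l t)^T *m J *m Y l t = J by exact: Ymat_symplectic.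
have u0C : vecC u0 = 1 by rewrite /vecC !mxE /= oppr0.
(* [chi] is minus the imaginary part of [E * conj e], where [E] is the endpoint of [hpath]. *)
have chiE l : chi n%:R u0 u1 Y l = 0 <-> unitary_points lam l.
  rewrite unitary_pointsP -H ?norm_expi//.
  rewrite -(vecC_Ymat l a1 u0C (leqnn n)) /chi dotJE -/(Y l n%:R).
  set x := Y l n%:R *m u0.
  rewrite conjC_ReIm /vecC.
  have -> : (x i0 ord0 -i* x i1 ord0) * (complex.Re e -i* complex.Im e) =
    (x i0 ord0 * complex.Re e - x i1 ord0 * complex.Im e) +i*
    - (x i1 ord0 * complex.Re e + x i0 ord0 * complex.Im e).
    by apply/eqP; rewrite eq_complex /=; apply/andP; split; apply/eqP; ring.
  rewrite complex_real oppr_eq0 ![u1 _ _]mxE /= mulrN opprK.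
  by split=> [->|/eqP].
exists (n%:R)%:E, (Wpath a n), u0, u1; split.
- split => //.
    by move=> i j; rewrite intvE; exact: mW.
  move=> t; rewrite intvE => Dt; split; first exact: Ws.
  move=> x x0; apply: lt_le_trans (Hm t x Dt); rewrite pmulr_rgt0//.
  have [xi0|xi0] := eqVneq (x i0 ord0) 0.
    have xi1 : x i1 ord0 != 0.
      apply: contra_neq x0 => xi1; apply/matrixP => i j.
      by rewrite (ord1 j) [RHS]mxE; move: i; apply: ord2P.
    by rewrite ltr_wpDl ?sqr_ge0// lt_neqAle eq_sym sqrf_eq0 xi1 sqr_ge0.
  by rewrite ltr_pwDl ?sqr_ge0// lt_neqAle eq_sym sqrf_eq0 xi0 sqr_ge0.
- apply: (dirac_op_self_adjoint T0 m0 mW mV WV Ws WM VM Hm u00 u10 acY dY Y0 YJ).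
  have [l hl] := unitary_points_proper; exists l.
  by apply/eqP => /chiE.
- rewrite (dirac_op_spectrum T0 m0 mW WV Ws WM Hm u00 u10 acY dY Y0 YJ).
  by apply/seteqP; split => l /chiE.
Qed.

End DiracSpectrum.

(** * The hyperbolic carousel *)

Section RotationLift.
Context {R : realType}.
Implicit Types (z E : R[i]) (x y s psi : R).

Definition arg_den z x := 1 - complex.Re z * cos x - complex.Im z * sin x.
Definition arg_num z x := complex.Im z * cos x - complex.Re z * sin x.

(* Lift to the real line of the action of [E |-> E - z E^*] on [E / E^*], that
   is, of the disk automorphism sending [z] to 0. *)
Definition center_lift z x := x - 2 * atan (arg_num z x / arg_den z x).

Lemma arg_den_num z x : arg_den z x -i* arg_num z x = 1 - z * expi (- x).
Proof.
rewrite /arg_den /arg_num /expi cosN sinN; case: z => p q.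
by apply/eqP; rewrite eq_complex /=; apply/andP; split; apply/eqP; ring.
Qed.

Lemma dist_expi z x : cabs (expi x - z) ^+ 2 = arg_den z x ^+ 2 + arg_num z x ^+ 2.
Proof.
rewrite cabs_sqr /arg_den /arg_num; have := cos2Dsin2 x; case: z => p q /=.
set c := cos x; set s := sin x => cs.
transitivity ((c ^+ 2 + s ^+ 2) - 2 * (p * c + q * s) + (p ^+ 2 + q ^+ 2)).
  by ring.
transitivity (1 - 2 * (p * c + q * s) + (p ^+ 2 + q ^+ 2) * (c ^+ 2 + s ^+ 2)).
  by rewrite cs mulr1.
by ring.
Qed.

Lemma disk_r_cabs z : disk_r z = cabs z ^+ 2.
Proof. by rewrite cabs_sqr. Qed.

Lemma cabs_ge0 z : 0 <= cabs z.
Proof. by rewrite /cabs; case: z => a b; exact: sqrtr_ge0. Qed.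

Lemma arg_den_ge z x : 1 - cabs z <= arg_den z x.
Proof.
rewrite /arg_den -addrA -opprD lerD2l lerN2.
have h : (complex.Re z * cos x + complex.Im z * sin x) ^+ 2 <= cabs z ^+ 2.
  rewrite cabs_sqr -subr_ge0.
  have -> : complex.Re z ^+ 2 + complex.Im z ^+ 2 -
      (complex.Re z * cos x + complex.Im z * sin x) ^+ 2 =
    (complex.Re z * sin x - complex.Im z * cos x) ^+ 2 +
    (complex.Re z ^+ 2 + complex.Im z ^+ 2) * (1 - (cos x ^+ 2 + sin x ^+ 2))
      - (complex.Re z ^+ 2 * sin x ^+ 2 + complex.Im z ^+ 2 * cos x ^+ 2) 
      + (complex.Re z ^+ 2 * sin x ^+ 2 + complex.Im z ^+ 2 * cos x ^+ 2) by ring.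
  by rewrite cos2Dsin2 subrr mulr0 addr0 subrK sqr_ge0.
apply: le_trans (ler_norm _) _.
by rewrite -(ler_pXn2r (n := 2))// ?nnegrE ?cabs_ge0// real_normK ?num_real.
Qed.

(** Keeps [1 - z * expi (- x)] in the right half-plane, so that the [atan] in [center_lift] is a
    smooth global branch of its argument up to sign. *)
Lemma arg_den_gt0 z x : `|z| < 1 -> 0 < arg_den z x.
Proof. by move=> /cabs_lt1 z1; rewrite (lt_le_trans _ (arg_den_ge z x))// subr_gt0. Qed.

Lemma disk_r_arg_den z x : 1 - disk_r z = 2 * arg_den z x - (arg_den z x ^+ 2 + arg_num z x ^+ 2).
Proof.
rewrite /disk_r /arg_den /arg_num; have := cos2Dsin2 x.
set c := cos x; set s := sin x; set p := complex.Re z; set q := complex.Im z => cs.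
transitivity (1 - (p ^+ 2 + q ^+ 2) * (c ^+ 2 + s ^+ 2)); first by rewrite cs mulr1.
by ring.
Qed.

Lemma is_deriveV_pt (f : R -> R) x d : f x != 0 -> is_derive x (1 : R) f d ->
  is_derive x (1 : R) (fun y => (f y)^-1) (- (f x)^-2 * d).
Proof.
move=> f0 [df ed]; split; first exact: derivableV.
by rewrite deriveV// ed.
Qed.

(** The derivative of a disk automorphism along the circle is the Poisson kernel; [disk_r_arg_den]
    turns its numerator into the expression produced by differentiating [atan]. *)
Lemma is_derive_center_lift z x : `|z| < 1 ->
  is_derive x (1 : R) (center_lift z) ((1 - cabs z ^+ 2) / cabs (expi x - z) ^+ 2).
Proof.
move=> z1; have d0 := arg_den_gt0 x z1; have dn : arg_den z x != 0 by rewrite gt_eqF.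
rewrite dist_expi -disk_r_cabs (disk_r_arg_den z x).
have s0 : arg_den z x ^+ 2 + arg_num z x ^+ 2 != 0.
  by rewrite gt_eqF// ltr_pwDl ?sqr_ge0// exprn_gt0.
set p := complex.Re z; set q := complex.Im z.
have dden : is_derive x (1 : R) (arg_den z) (- arg_num z x).
  apply: is_derive_eq (is_deriveB (is_deriveB (is_derive_cst (1 : R) x 1)
    (is_deriveZ p (is_derive_cos x))) (is_deriveZ q (is_derive_sin x))) _.
  by rewrite /arg_num /GRing.scale /=; ring.
have dnum : is_derive x (1 : R) (arg_num z) (arg_den z x - 1).
  apply: is_derive_eq (is_deriveB (is_deriveZ q (is_derive_cos x))
    (is_deriveZ p (is_derive_sin x))) _.
  by rewrite /arg_den /GRing.scale /=; ring.
have dq : is_derive x (1 : R) (fun y => arg_num z y / arg_den z y) _ :=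
  is_deriveM dnum (is_deriveV_pt dn dden).
have da : is_derive x (1 : R) (fun y => atan (arg_num z y / arg_den z y)) _ :=
  @is_derive1_comp _ _ (fun y => arg_num z y / arg_den z y) x _ _
    (is_derive1_atan (arg_num z x / arg_den z x)) dq.
apply: is_derive_eq (is_deriveB (is_derive_id x (1 : R)) (is_deriveZ 2 da)) _.
rewrite /GRing.scale /=.
have s1 : 1 + (arg_num z x / arg_den z x) ^+ 2 != 0.
  by rewrite gt_eqF// ltr_pwDl ?sqr_ge0.
move: (arg_den z x) (arg_num z x) dn s0 s1 => d m dn s0 s1.
have -> : 1 + (m / d) ^+ 2 = (d ^+ 2 + m ^+ 2) / d ^+ 2 by field.
by field; rewrite s0 dn.
Qed.

Lemma sin_atan (y : R) : sin (atan y) = y * cos (atan y).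
Proof.
rewrite -{2}(atanK y) /tan divfK// gt_eqF//.
by rewrite cos_gt0_pihalf// atan_gtNpi2 atan_ltpi2.
Qed.

Lemma expi_atan (y : R) : expi (- atan y) = (cos (atan y))%:C * (1 -i* y).
Proof.
rewrite /expi cosN sinN sin_atan.
by apply/eqP; rewrite eq_complex /=; apply/andP; split; apply/eqP; ring.
Qed.

(* [x] is an angle of the axis of [E], that is, of the boundary point
   [E / E^*]. *)
Definition is_angle x E := expi x * (E^*)%R = E.

Lemma is_angle_shift x s E : is_angle x E -> is_angle (x + 2 * s) (expi s * E).
Proof.
rewrite /is_angle rmorphM /= conj_expi => h; rewrite -[in RHS]h.
rewrite (_ : x + 2 * s = s + (x + s)); last by ring.
rewrite !expiD -!mulrA; congr (_ * _); congr (_ * _).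
by rewrite mulrA -expiD subrr expi0 mul1r.
Qed.

Lemma is_angle_scale x (r : R) E : r != 0 -> is_angle x (r%:C * E) -> is_angle x E.
Proof.
rewrite /is_angle rmorphM /= => r0; rewrite conjC_ReIm /= oppr0 mulrCA => /mulfI; apply.
by apply/eqP => -[] /eqP; rewrite (negbTE r0).
Qed.

Lemma expi_center_lift z x : `|z| < 1 ->
  expi (center_lift z x - x) * (arg_den z x +i* arg_num z x) = arg_den z x -i* arg_num z x.
Proof.
move=> z1; have d0 := arg_den_gt0 x z1; have dn : arg_den z x != 0 by rewrite gt_eqF.
set y := arg_num z x / arg_den z x.
have c0 : 0 < cos (atan y) by rewrite cos_gt0_pihalf// atan_gtNpi2 atan_ltpi2.
have -> : center_lift z x - x = - atan y + - atan y by rewrite /center_lift -/y; ring.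
have w : arg_den z x -i* arg_num z x = (arg_den z x)%:C * (1 -i* y).
  by apply/eqP; rewrite eq_complex /= /y; apply/andP; split; apply/eqP; field.
have w' : arg_den z x +i* arg_num z x = (arg_den z x)%:C * (1 +i* y).
  by apply/eqP; rewrite eq_complex /= /y; apply/andP; split; apply/eqP; field.
rewrite w w' mulrCA; congr (_ * _); rewrite expiD !expi_atan.
have := cos2Dsin2 (atan y); rewrite sin_atan => cs.
apply/eqP; rewrite eq_complex /=; apply/andP; split; apply/eqP.
  transitivity (cos (atan y) ^+ 2 + (y * cos (atan y)) ^+ 2); first by ring.
  by [].
transitivity (- y * (cos (atan y) ^+ 2 + (y * cos (atan y)) ^+ 2)); first by ring.
by rewrite cs mulr1.
Qed.

Lemma is_angle_center_lift z x E : `|z| < 1 -> is_angle x E -> is_angle (center_lift z x) (E - z * (E^*)%R).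
Proof.
move=> z1; rewrite /is_angle rmorphB rmorphM /= conjCK => h.
have w := arg_den_num z x; have w' : arg_den z x +i* arg_num z x = 1 - (z^*)%R * expi x.
  rewrite -[LHS](_ : ((arg_den z x -i* arg_num z x)^*)%R = _); last by rewrite conjC_ReIm /= opprK.
  by rewrite w rmorphB rmorph1 rmorphM /= conj_expi opprK.
have -> : (E^*)%R - (z^*)%R * E = (arg_den z x +i* arg_num z x) * (E^*)%R.
  by rewrite -{2}h w'; ring.
rewrite -[center_lift z x](subrK x) expiD -mulrA (mulrCA (expi x)) h mulrA expi_center_lift// w.
by rewrite mulrBl mul1r -mulrA -{2}h (mulrA (expi _)) -expiD addNr expi0 mul1r.
Qed.

(** The automorphism for [- z] inverts the one for [z]; the point is that this holds on the line,
    not just modulo [2 pi]. The two arguments of [atan] turn out to be opposite, so the corrections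
    cancel exactly. *)
Lemma center_liftN z x : `|z| < 1 -> center_lift (- z) (center_lift z x) = x.
Proof.
move=> z1; have d0 := arg_den_gt0 x z1; have dn : arg_den z x != 0 by rewrite gt_eqF.
have s0 : arg_den z x ^+ 2 + arg_num z x ^+ 2 != 0.
  by rewrite gt_eqF// ltr_pwDl ?sqr_ge0// exprn_gt0.
have := expi_center_lift x z1; set y := center_lift z x => ey.
have r0 := disk_rE z1; have rd := disk_r_arg_den z x.
have k : arg_den (- z) y -i* arg_num (- z) y =
    ((1 - disk_r z) / (arg_den z x ^+ 2 + arg_num z x ^+ 2))%:C * (arg_den z x +i* arg_num z x).
  rewrite arg_den_num mulNr opprK.
  have zE : z * expi (- x) = 1 - (arg_den z x -i* arg_num z x) by rewrite arg_den_num opprB addrC subrK.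
  have wn : arg_den z x -i* arg_num z x != 0 by rewrite eq_complex /= (negbTE dn).
  apply: (mulIf wn).
  have -> : (1 + z * expi (- y)) * (arg_den z x -i* arg_num z x) =
     (arg_den z x -i* arg_num z x) + (1 - (arg_den z x -i* arg_num z x)) * (arg_den z x +i* arg_num z x).
    rewrite -zE mulrDl mul1r -{2}ey; congr (_ + _).
    rewrite mulrA; congr (_ * _); rewrite -mulrA -expiD. congr (_ * expi _); ring.
  apply/eqP; rewrite eq_complex /= rd; apply/andP; split; apply/eqP; field; exact: s0.
move/eqP: k; rewrite eq_complex /= => /andP[/eqP k1 /eqP /(canRL (@opprK _)) k2].
rewrite /center_lift -/y; have -> : arg_num (- z) y / arg_den (- z) y = - (arg_num z x / arg_den z x).
  rewrite k1 k2; move: (1 - disk_r z) r0 (arg_den z x) (arg_num z x) dn s0 => r r0 d m dn s0.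
  by rewrite !mul0r !subr0 addr0; field; rewrite dn s0 gt_eqF.
by rewrite atanN /y /center_lift; ring.
Qed.

Definition lift_speed z x := (1 - cabs z ^+ 2) / cabs (expi x - z) ^+ 2.

Lemma cabsN z : cabs (- z) = cabs z.
Proof.
apply/eqP; rewrite -(eqrXn2 (n := 2)) ?cabs_ge0// !cabs_sqr.
by case: z => p q /=; rewrite !sqrrN.
Qed.

Lemma disk_num_gt0 z : `|z| < 1 -> 0 < 1 - cabs z ^+ 2.
Proof. by move=> /disk_rE; rewrite disk_r_cabs. Qed.

Lemma dist_expi_ge z x : `|z| < 1 -> (1 - cabs z) ^+ 2 <= cabs (expi x - z) ^+ 2.
Proof.
move=> z1; rewrite dist_expi (@le_trans _ _ (arg_den z x ^+ 2)) ?lerDl ?sqr_ge0//.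
rewrite ler_pXn2r ?nnegrE ?arg_den_ge// ?ltW ?arg_den_gt0// subr_gt0.
exact: cabs_lt1.
Qed.

Lemma dist_expi_gt0 z x : `|z| < 1 -> 0 < cabs (expi x - z) ^+ 2.
Proof.
move=> z1; apply: lt_le_trans (dist_expi_ge x z1).
by rewrite exprn_gt0// subr_gt0; exact: cabs_lt1.
Qed.

Lemma lift_speed_gt0 z x : `|z| < 1 -> 0 < lift_speed z x.
Proof. by move=> z1; rewrite divr_gt0 ?disk_num_gt0 ?dist_expi_gt0. Qed.

Definition lift_speed_max z := (1 - cabs z ^+ 2) / (1 - cabs z) ^+ 2.

Lemma lift_speed_le z x : `|z| < 1 -> `|lift_speed z x| <= lift_speed_max z.
Proof.
move=> z1; have /ltW/ger0_norm-> := lift_speed_gt0 x z1; rewrite /lift_speed /lift_speed_max.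
rewrite ler_wpM2l//; first by rewrite ltW// disk_num_gt0.
rewrite lef_pV2 ?posrE ?dist_expi_ge ?dist_expi_gt0//.
by rewrite exprn_gt0// subr_gt0; exact: cabs_lt1.
Qed.

Lemma center_lift_lt z x y : `|z| < 1 -> x < y -> center_lift z x < center_lift z y.
Proof.
move=> z1 xy; rewrite -subr_gt0.
have [|c _ ->] := @MVT_segment _ (center_lift z) (lift_speed z) x y (ltW xy)
  (fun t _ => is_derive_center_lift t z1).
  by apply: (@is_derive_within _ (center_lift z) (lift_speed z)) => t _; exact: is_derive_center_lift.
by rewrite mulr_gt0 ?lift_speed_gt0// subr_gt0.
Qed.

Lemma center_lift_le z x y : `|z| < 1 -> x <= y -> center_lift z x <= center_lift z y.
Proof. by move=> z1; rewrite le_eqVlt => /predU1P[->//|/center_lift_lt-/(_ _ z1)/ltW]. Qed.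

Lemma center_lift_lip z x y : `|z| < 1 -> `|center_lift z y - center_lift z x| <= lift_speed_max z * `|y - x|.
Proof.
move=> z1; apply: (@derive_lipschitz _ _ (lift_speed z)) => t; first exact: is_derive_center_lift.
exact: lift_speed_le.
Qed.

(* Lift of the hyperbolic rotation about [z] by [psi]: conjugate by
   [center_lift] to a rotation about 0. *)
Definition rot_lift z psi x := center_lift (- z) (center_lift z x + psi).

Lemma rot_lift0 z x : `|z| < 1 -> rot_lift z 0 x = x.
Proof. by move=> z1; rewrite /rot_lift addr0 center_liftN. Qed.

Lemma rot_lift_le z psi psi' x x' : `|z| < 1 -> psi <= psi' -> x <= x' ->
  rot_lift z psi x <= rot_lift z psi' x'.
Proof. by move=> z1 h h'; rewrite center_lift_le ?normrN// lerD// center_lift_le. Qed.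

Lemma rot_lift_lt z psi psi' x x' : `|z| < 1 -> psi < psi' -> x <= x' ->
  rot_lift z psi x < rot_lift z psi' x'.
Proof. by move=> z1 h h'; rewrite center_lift_lt ?normrN// ler_ltD// center_lift_le. Qed.

Lemma rot_lift_lip z psi psi' x x' : `|z| < 1 ->
  `|rot_lift z psi x - rot_lift z psi' x'| <= lift_speed_max z * (lift_speed_max z * `|x - x'| + `|psi - psi'|).
Proof.
move=> z1; have K0 : 0 <= lift_speed_max z by rewrite (le_trans (normr_ge0 _) (lift_speed_le 0 z1)).
have zN : `|- z| < 1 by rewrite normrN.
apply: le_trans (center_lift_lip _ _ zN) _; rewrite {1}/lift_speed_max cabsN ler_wpM2l// opprD addrACA.
by rewrite (le_trans (ler_normD _ _))// lerD2r center_lift_lip.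
Qed.

(** Differentiating the identity [center_lift z] after [center_lift (- z)] shows that the speed is
    the reciprocal of [lift_speed] at the image point. This is the carousel equation at unit angular
    speed. *)
Lemma is_derive_rot_lift z psi x : `|z| < 1 ->
  is_derive psi (1 : R) (fun p => rot_lift z p x)
    (cabs (expi (rot_lift z psi x) - z) ^+ 2 / (1 - cabs z ^+ 2)).
Proof.
move=> z1; have zN : `|- z| < 1 by rewrite normrN.
set u := center_lift z x + psi.
have du : is_derive psi (1 : R) (fun p => center_lift z x + p) 1.
  apply: is_derive_eq (is_deriveD (is_derive_cst (center_lift z x) psi (1 : R))
    (is_derive_id psi (1 : R))) _.
  by rewrite add0r.
have d1 : is_derive psi (1 : R) (fun p => center_lift (- z) (center_lift z x + p)) _ :=
  @is_derive1_comp _ _ (fun p => center_lift z x + p) psi _ _ (is_derive_center_lift u zN) du.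
apply: is_derive_eq d1 _; rewrite mulr1.
have d2 : is_derive u (1 : R) (fun v => center_lift z (center_lift (- z) v)) _ :=
  @is_derive1_comp _ _ (center_lift (- z)) u _ _ (is_derive_center_lift (center_lift (- z) u) z1) (is_derive_center_lift u zN).
have d3 : is_derive u (1 : R) (fun v => center_lift z (center_lift (- z) v)) 1.
  have -> : (fun v => center_lift z (center_lift (- z) v)) = id.
    by apply/funext => v; rewrite -{1}(opprK z) center_liftN.
  exact: is_derive_id.
have := @derive_val _ _ _ _ _ _ _ d2; rewrite (@derive_val _ _ _ _ _ _ _ d3) => e.
rewrite -/(rot_lift z psi x) in e |- *.
have p0 := lift_speed_gt0 (rot_lift z psi x) z1; rewrite /lift_speed in p0.
apply: (mulfI (lt0r_neq0 p0)); rewrite -[LHS]e.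
by rewrite mulrA divfK ?divff ?gt_eqF ?disk_num_gt0 ?dist_expi_gt0.
Qed.

(** Conjugating the shift by [2 * s] with [center_lift] gives [hrot] up to the real factor
    [1 - cabs z ^+ 2], which leaves the axis unchanged. *)
Lemma is_angle_rot_lift z s x E : `|z| < 1 -> is_angle x E -> is_angle (rot_lift z (2 * s) x) (hrot z (expi s) E).
Proof.
move=> z1 h; have zN : `|- z| < 1 by rewrite normrN.
have := is_angle_center_lift zN (is_angle_shift s (is_angle_center_lift z1 h)); rewrite -/(rot_lift z (2 * s) x).
have -> : expi s * (E - z * (E^*)%R) - - z * ((expi s * (E - z * (E^*)%R))^*)%R =
   (1 - cabs z ^+ 2)%:C * hrot z (expi s) E.
  have sE : ((expi s)^*)%R = (expi s)^-1 by rewrite conj_expi expiN.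
  have z2 : (1 - cabs z ^+ 2)%:C = 1 - z * (z^*)%R.
    by rewrite -normCK norm_cabs rmorphB rmorph1 rmorphXn.
  have := disk_den z1; rewrite z2 /hrot rmorphM rmorphB rmorphM /= conjCK.
  move: (z^*)%R (E^*)%R ((expi s)^*)%R => z' E' s' h0.
  by field; rewrite gt_eqF.
by apply: is_angle_scale; rewrite gt_eqF ?disk_num_gt0.
Qed.

End RotationLift.

(** * The lifted angle of the moving boundary point *)

Section CarouselPhase.
Context {R : realType}.
Variables (n0 : nat) (a : nat -> R[i]).
Hypothesis a_lt1 : forall k, `|a k| < 1.
Local Notation n := n0.+1.
Implicit Types (psi : nat -> R) (l t : R) (m k : nat).

Fixpoint path_lift psi m : R := if m is k.+1 then rot_lift (a k) (psi k) (path_lift psi k) else 0.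

Lemma eq_path_lift psi psi' m : (forall k, (k < m)%N -> psi k = psi' k) -> path_lift psi m = path_lift psi' m.
Proof.
elim: m => //= m IH e; rewrite e// IH// => k km; apply: e; exact: leqW.
Qed.

Lemma path_lift_stop psi j m : (forall k, (j <= k)%N -> psi k = 0) -> (j <= m)%N ->
  path_lift psi m = path_lift psi j.
Proof.
move=> e; elim: m => [|m IH]; first by rewrite leqn0 => /eqP->.
rewrite leq_eqVlt => /predU1P[->//|]; rewrite ltnS => jm.
by rewrite /= e// rot_lift0// IH.
Qed.

Lemma path_lift_le psi psi' m : (forall k, psi k <= psi' k) -> path_lift psi m <= path_lift psi' m.
Proof. by move=> e; elim: m => //= m IH; exact: rot_lift_le. Qed.

Lemma path_lift_lt psi psi' m k : (forall k, psi k <= psi' k) -> psi k < psi' k -> (k < m)%N ->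
  path_lift psi m < path_lift psi' m.
Proof.
move=> e ek; elim: m => //= m IH; rewrite ltnS leq_eqVlt => /predU1P[<-|/IH lt].
  by rewrite rot_lift_lt// path_lift_le.
apply: (@lt_le_trans _ _ (rot_lift (a m) (psi m) (path_lift psi' m))); last exact: rot_lift_le.
by rewrite center_lift_lt ?normrN// ltrD2r center_lift_lt.
Qed.

(** A bound uniform in the angles serves twice: for the dependence on time and for that on [l]. *)
Lemma path_lift_lip m : exists2 K, 0 <= K & forall psi psi' (d : R),
  (forall k, `|psi k - psi' k| <= d) -> `|path_lift psi m - path_lift psi' m| <= K * d.
Proof.
elim: m => [|m [K K0 IH]] /=.
  by exists 0 => // psi psi' d e; rewrite subrr normr0 mul0r.
have M0 : 0 <= lift_speed_max (a m) by rewrite (le_trans (normr_ge0 _) (lift_speed_le 0 (a_lt1 m))).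
exists (lift_speed_max (a m) * (lift_speed_max (a m) * K + 1)) => [|psi psi' d e].
  by rewrite mulr_ge0// addr_ge0// mulr_ge0.
apply: le_trans (rot_lift_lip _ _ _ _ (a_lt1 m)) _.
rewrite -[X in _ <= X]mulrA; apply: ler_wpM2l => //; rewrite mulrDl mul1r; apply: lerD => //.
by rewrite -[X in _ <= X]mulrA; apply: ler_wpM2l => //; exact: IH.
Qed.

(** Twice [turn], because the lift follows [E / conj E] rather than [E]. *)
Definition phase_steps l t k := l / n%:R * unit_clamp (t - k%:R).

Definition phase l t := path_lift (phase_steps l t) n.

Lemma unit_clamp_ge0 t : 0 <= unit_clamp t.
Proof. by rewrite /unit_clamp le_max lexx. Qed.

Lemma unit_clamp_le1 t : unit_clamp t <= 1.
Proof. by rewrite /unit_clamp ge_max ge_min lexx ler01. Qed.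

Lemma phase_0t t : phase 0 t = 0.
Proof.
rewrite /phase (@path_lift_stop _ 0)// => k _; by rewrite /phase_steps !mul0r.
Qed.

Lemma phase_t0 l : phase l 0 = 0.
Proof.
rewrite /phase (@path_lift_stop _ 0)// => k _; rewrite /phase_steps unit_clamp_le0 ?mulr0//.
Qed.

Lemma phase_lip_t l : exists K, forall s t, `|phase l t - phase l s| <= K * `|t - s|.
Proof.
have [K K0 HK] := path_lift_lip n; exists (K * `|l / n%:R|) => s t; rewrite -mulrA.
apply: HK => k; rewrite /phase_steps -mulrBr normrM ler_wpM2l//.
by rewrite (le_trans (unit_clamp_lip _ _))// opprB addrA subrK.
Qed.

Lemma phase_lip_l t : exists K, forall l l', `|phase l t - phase l' t| <= K * `|l - l'|.
Proof.
have [K K0 HK] := path_lift_lip n; exists K => l l'.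
apply: HK => k; rewrite /phase_steps -mulrBl normrM -mulrBl normrM -mulrA ler_piMr//.
rewrite [X in _ * X]ger0_norm ?unit_clamp_ge0// mulr_ile1 ?unit_clamp_ge0 ?unit_clamp_le1//.
by rewrite ger0_norm// invf_le1 ?ler1n ?ltr0n.
Qed.

Lemma phase_lt_l l l' : l < l' -> phase l n%:R < phase l' n%:R.
Proof.
move=> ll; have h k : phase_steps l n%:R k <= phase_steps l' n%:R k.
  by rewrite ler_wpM2r ?unit_clamp_ge0// ler_pM2r ?invr_gt0// ltW.
apply: (path_lift_lt h _ (ltn0Sn n0)); rewrite /phase_steps subr0 unit_clamp_ge1 ?ler1n// !mulr1.
by rewrite ltr_pM2r ?invr_gt0.
Qed.

(* [truncn s] is the index of the step containing [s]. *)
Lemma unit_clamp_step_lt s t : 0 <= s -> s < t -> unit_clamp (s - (Num.truncn s)%:R) < unit_clamp (t - (Num.truncn s)%:R).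
Proof.
move=> s0 st; have /andP[h1 h2] := truncn_itv s0.
have e : (Num.truncn s).+1%:R = (Num.truncn s)%:R + 1 :> R by rewrite natr1.
rewrite e in h2; set k := (Num.truncn s)%:R in h1 h2 *.
rewrite (unit_clamp_id (t := s - k)); last by lra.
by have [t1|t1] := leP 1 (t - k); [rewrite unit_clamp_ge1//; lra|rewrite unit_clamp_id; lra].
Qed.

Lemma phase_lt_t l s t : 0 < l -> 0 <= s -> s < t -> t <= n%:R -> phase l s < phase l t.
Proof.
move=> l0 s0 st tn; have ln : 0 < l / n%:R by rewrite divr_gt0.
have sn : (Num.truncn s < n)%N.
  by rewrite -(ltr_nat R) (le_lt_trans _ (lt_le_trans st tn))// truncn_le.
apply: (path_lift_lt _ _ sn) => [k|]; rewrite /phase_steps ?ler_pM2l ?ltr_pM2l ?unit_clamp_step_lt//.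
by rewrite unit_clamp_mono// lerD2r ltW.
Qed.

Lemma phase_gt_t l s t : l < 0 -> 0 <= s -> s < t -> t <= n%:R -> phase l t < phase l s.
Proof.
move=> l0 s0 st tn; have ln : l / n%:R < 0 by rewrite pmulr_llt0// invr_gt0.
have sn : (Num.truncn s < n)%N.
  by rewrite -(ltr_nat R) (le_lt_trans _ (lt_le_trans st tn))// truncn_le.
apply: (path_lift_lt _ _ sn) => [k|]; rewrite /phase_steps ?ler_nM2l ?ltr_nM2l ?unit_clamp_step_lt//.
by rewrite unit_clamp_mono// lerD2r ltW.
Qed.

Lemma is_derive_phase l t (j : nat) : (j < n)%N -> j%:R < t < j.+1%:R ->
  is_derive t (1 : R) (phase l)
    (l / n%:R * cabs (expi (phase l t) - a j) ^+ 2 / (1 - cabs (a j) ^+ 2)).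
Proof.
(* [P] is the angle at time [j]: during step [j] the earlier steps are complete and the later ones
   have not begun. *)
move=> jn jt; pose P := path_lift (fun=> l / n%:R) j.
have e s : j%:R < s < j.+1%:R -> rot_lift (a j) (l / n%:R * unit_clamp (s - j%:R)) P = phase l s.
  move=> /andP[h1 h2]; rewrite /phase (@path_lift_stop _ j.+1)//=; last first.
    move=> k jk; rewrite /phase_steps unit_clamp_le0 ?mulr0// subr_le0 (le_trans (ltW h2))//.
    by rewrite ler_nat.
  congr rot_lift; rewrite /P; apply: eq_path_lift => k kj; rewrite /phase_steps unit_clamp_ge1 ?mulr1//.
  by rewrite lerBrDr addrC natr1 (le_trans _ (ltW h1))// ler_nat.
apply: (eq_is_derive_itv jt e).
have d1 := is_deriveZ (l / n%:R) (is_derive_unit_clamp j jt).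
have d2 : is_derive t (1 : R) (fun s => rot_lift (a j) (l / n%:R * unit_clamp (s - j%:R)) P) _ :=
  @is_derive1_comp _ (fun p => rot_lift (a j) p P) (fun s => l / n%:R * unit_clamp (s - j%:R)) t _ _
    (is_derive_rot_lift _ P (a_lt1 j)) d1.
apply: is_derive_eq d2 _; rewrite e// eqxx /GRing.scale /=.
by rewrite mulr1 mulrC mulrA.
Qed.

Lemma is_angle_path_lift m (s : R) : is_angle (path_lift (fun=> 2 * s) m) (hpath a (expi s) m).
Proof.
elim: m => [|m IH] /=; first by rewrite /is_angle expi0 rmorph1 mulr1.
exact: is_angle_rot_lift.
Qed.

Lemma is_angle_phase l : is_angle (phase l n%:R) (hpath a (expi (((2 * n%:R)^-1) * l)) n).
Proof.
rewrite /phase (@eq_path_lift _ (fun=> 2 * ((2 * n%:R)^-1 * l))); first exact: is_angle_path_lift.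
move=> k kn; rewrite /phase_steps unit_clamp_ge1 ?mulr1.
  by field; rewrite addrC natr1 pnatr_eq0.
by rewrite lerBrDr addrC natr1 ler_nat.
Qed.

End CarouselPhase.

(** * Counting integer levels of a continuous function *)

Section LevelCounting.
Context {R : realType}.
Implicit Types (h : R -> R) (S : set R) (m M k : int).

(** The intermediate value theorem and injectivity make [h] a bijection from [S] onto the integers
    in []m, M]]. The minimum and maximum let one statement cover increasing and decreasing [h]. *)
Lemma counting_levels h (a b : R) S m M : a <= b -> m <= M ->
  {within `[a, b], continuous h} ->
  (forall s t, a <= s <= b -> a <= t <= b -> h s = h t -> s = t) ->
  (forall k, m < k <= M -> Num.min (h a) (h b) <= k%:~R <= Num.max (h a) (h b)) ->
  (forall s, S s <-> a <= s <= b /\ exists2 k, m < k <= M & h s = k%:~R) ->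
  counting S = ((M - m)%:~R : R)%:E.
Proof.
move=> ab mM hc hinj hk SE; pose K := `|(M - m)%R|%N.
have KE : (K : int) = M - m by rewrite gez0_abs// subr_ge0.
pose q (i : nat) : int := m + 1 + i%:Z.
have qK i : (i < K)%N -> m < q i <= M.
  by move=> iK; have : (i%:Z < K%:Z)%R by []; rewrite KE /q; lia.
pose s i := xget 0 [set x | S x /\ h x = (q i)%:~R].
have sP i : (i < K)%N -> S (s i) /\ h (s i) = (q i)%:~R.
  move=> iK; apply: (@xgetPex _ 0 [set x | S x /\ h x = (q i)%:~R]).
  have [c cab hc'] := IVT ab hc (hk _ (qK i iK)); exists c; split => //.
  by apply/SE; split; [move: cab; rewrite in_itv|exists (q i); first exact: qK].
have S_img : S = [set s i | i in `I_K].
  apply/seteqP; split => [x Sx|x [i /= iK <-]]; last by case: (sP i iK).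
  have [xab [k /andP[mk kM] hx]] := (SE x).1 Sx.
  exists `|(k - m - 1)%R|%N => /=.
    by rewrite /K; lia.
  have iK : (`|(k - m - 1)%R| < K)%N by rewrite /K; lia.
  have [Si hi] := sP _ iK.
  apply: hinj => //; first by case: ((SE _).1 Si).
  by rewrite hi hx /q; congr intmul; lia.
have sinj : {in `I_K &, injective s}.
  move=> i j; rewrite !inE /= => iK jK e.
  have [_ hi] := sP i iK; have [_ hj] := sP j jK.
  move: hi; rewrite e hj => /intr_inj; rewrite /q; lia.
have SK : (S #= `I_K)%card by rewrite S_img; exact: inj_card_eq.
have fS : finite_set S by apply/finite_setP; exists K.
rewrite /counting asboolT// (card_fset_set SK); congr EFin.
by rewrite -KE.
Qed.

Lemma lipschitz_within h K (a b : R) : (forall s t, `|h t - h s| <= K * `|t - s|) ->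
  {within `[a, b], continuous h}.
Proof.
move=> hL; apply: continuous_subspaceT => x.
apply/(@cvgrPdist_lt _ R^o) => eps e0.
have K0 : 0 <= K by have := hL 0 1; rewrite subr0 normr1 mulr1; exact: le_trans.
have K1 : 0 < K + 1 by rewrite ltr_wpDl.
near=> t; apply: le_lt_trans (hL _ _) _.
apply: (@le_lt_trans _ _ ((K + 1) * `|x - t|)); first by rewrite ler_wpM2r// lerDl.
rewrite mulrC -ltr_pdivlMr//; near: t.
by apply/nbhs_ballP; exists (eps / (K + 1)) => //=; rewrite divr_gt0.
Unshelve. all: by end_near. Qed.

Lemma floor_lt_int (x : R) k : (Num.floor x < k) = (x < k%:~R).
Proof. by rewrite !ltNge floor_ge_int. Qed.

End LevelCounting.

(** * Hits of the target point *)

Section Carousel.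
Context {R : realType}.
Variables (n0 : nat) (lam : 'I_n0.+1 -> R) (a : nat -> R[i]) (e : R[i]).
Local Notation n := n0.+1.
Hypothesis a_lt1 : forall k, `|a k| < 1.
Hypothesis e_neq0 : e != 0.
Hypothesis pathP : forall z : R[i], `|z| = 1 -> hpath a z n * (e^*)%R \is Num.real <->
     exists k, z ^+ 2 = expi (lam k).
Hypothesis lam0 : ~ unitary_points lam 0.
Implicit Types (l s t : R) (k : int).

Let nT : 0 < n%:R :> R. Proof. by rewrite ltr0n. Qed.

(** If a rotation sent [E] to 0, [hrotE] would give [E = a m * conj E], impossible for nonzero [E]
    since [a m] has norm below 1. It allows [E / conj E] to be formed. *)
Lemma hpath_neq0 (z : R[i]) m : `|z| = 1 -> hpath a z m != 0.
Proof.
move=> z1; elim: m => [|m IH] /=; first exact: oner_neq0.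
apply: contra_neq IH => h.
have := hrotE 1 z (hpath a z m) (a_lt1 m); rewrite h rmorph0 mulr0 subr0 mulr0.
move/esym/eqP; rewrite mul1r mulf_eq0 -(normr_eq0 z) z1 oner_eq0 /= subr_eq0 => /eqP hE.
apply/eqP; rewrite -normr_eq0; apply/eqP.
have := congr1 Num.norm hE; rewrite normrM norm_conjC => /eqP.
rewrite -subr_eq0 -{1}[`|hpath _ _ _|]mul1r -mulrBl mulf_eq0 subr_eq0 => /orP[/eqP h1|/eqP//].
by have := a_lt1 m; rewrite -h1 ltxx.
Qed.

(** The boundary point whose axis is the line spanned by [e]. *)
Let eta1 : R[i] := e / (e^*)%R.

Lemma conj_e_neq0 : (e^*)%R != 0. Proof. by rewrite conjC_eq0. Qed.

Lemma norm_eta1 : `|eta1| = 1.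
Proof. by rewrite /eta1 normf_div norm_conjC divff// normr_eq0. Qed.

(** [E / conj E = e / conj e] says exactly that [E * conj e] is real, the criterion of [pathP]. *)
Lemma phase_hitP l : expi (phase n0 a l n%:R) = eta1 <-> unitary_points lam l.
Proof.
have w1 := norm_expi ((2 * n%:R)^-1 * l).
rewrite (unitary_pointsP lam (ltn0Sn n0)) -(pathP w1).
have E0 := hpath_neq0 n w1; have := is_angle_phase n0 a_lt1 l; rewrite /is_angle.
move: (hpath _ _ _) E0 => E E0 hE; have c0 : (E^*)%R != 0 by rewrite conjC_eq0.
rewrite CrealE rmorphM /= conjCK.
have -> : expi (phase n0 a l n%:R) = E / (E^*)%R by apply: (mulIf c0); rewrite divfK.
split=> [|/eqP] h.
  by move/eqP: h; rewrite /eta1 eqr_div ?conj_e_neq0// => /eqP->; rewrite mulrC.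
by apply/eqP; rewrite /eta1 eqr_div ?conj_e_neq0// -h mulrC.
Qed.

(** For [l = 0] the point rests at 1, so [eta1 = 1] would make 0 one of the points. *)
Lemma eta1_neq1 : 1 != eta1.
Proof.
apply/eqP => h; apply: lam0; apply/phase_hitP.
by rewrite phase_0t// expi0.
Qed.

Let th := xget 0 [set x : R | expi x = eta1].
Let thE : expi th = eta1.
Proof.
by apply: (@xgetPex _ 0 [set x : R | expi x = eta1]); exact: expi_surj norm_eta1.
Qed.

(* Number of turns past [eta1]; it is an integer exactly at the hits. *)
Let y l t := (phase n0 a l t - th) / (2 * pi).

Let pi2 : 0 < 2 * pi :> R. Proof. by rewrite mulr_gt0// pi_gt0. Qed.

Lemma hit_intP l t : expi (phase n0 a l t) = eta1 <-> exists k, y l t = k%:~R.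
Proof.
rewrite -thE; split=> [/expi_inj_mod[k hk]|[k hk]].
  by exists k; rewrite /y hk addrC addKr mulrC mulKf// gt_eqF.
have -> : phase n0 a l t = th + 2 * pi * k%:~R.
  by rewrite -hk /y mulrC divfK ?gt_eqF// addrC subrK.
by rewrite expiD expi_2pi mulr1.
Qed.

Let y_lt l t l' t' : phase n0 a l t < phase n0 a l' t' -> y l t < y l' t'.
Proof. by move=> h; rewrite /y ltr_pM2r ?invr_gt0// ltrD2r. Qed.

Let y_lip l t l' t' : `|y l t - y l' t'| = `|phase n0 a l t - phase n0 a l' t'| / (2 * pi).
Proof.
rewrite /y -mulrBl normrM [X in _ * X]gtr0_norm ?invr_gt0//.
by congr (`|_| / _); ring.
Qed.

Let y0 := y 0 n%:R.
Let yt0 l : y l 0 = y0.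
Proof. by rewrite /y0 /y phase_t0// phase_0t. Qed.

(** Every parameter starts at the level [y0], so no hit occurs at time 0. *)
Let y0_nint k : y0 != k%:~R.
Proof.
apply/eqP => h; apply: lam0; apply/phase_hitP/hit_intP; by exists k.
Qed.

Let y_ex_lip_l : exists2 K, 0 < K & forall l l', `|y l n%:R - y l' n%:R| <= K * `|l - l'|.
Proof.
have [K HK] := phase_lip_l n0 a_lt1 n%:R.
have K0 : 0 <= K.
  by have := HK 1 0; rewrite subr0 normr1 mulr1; exact: le_trans.
exists ((K + 1) / (2 * pi)) => [|l l']; first by rewrite divr_gt0// ltr_wpDl.
rewrite y_lip mulrAC ler_wpM2r ?invr_ge0 ?(ltW pi2)// (le_trans (HK _ _))//.
by rewrite ler_wpM2r// lerDl.
Qed.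

(** As [y l n%:R] is continuous and increasing in [l], its floor is right-continuous; subtracting
    the floor of [y0] normalises the value at 0. *)
Definition carousel_count l : R := (Num.floor (y l n%:R) - Num.floor y0)%:~R.

Let y_ltl l l' : l < l' -> y l n%:R < y l' n%:R.
Proof. by move=> ll; apply: y_lt; exact: phase_lt_l. Qed.

Lemma carousel_count_points (b c : R) : b < c ->
  counting (unitary_points lam `&` `]b, c]) = (carousel_count c - carousel_count b)%:E.
Proof.
move=> bc; have [K K0 HK] := y_ex_lip_l.
have -> : carousel_count c - carousel_count b =
    (Num.floor (y c n%:R) - Num.floor (y b n%:R))%:~R.
  by rewrite /carousel_count -intrB; congr intmul; ring.
have ybc := y_ltl bc.
apply: (@counting_levels _ (fun l => y l n%:R) b c) => //.
- exact: ltW.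
- by rewrite floor_ge_int (le_trans (ge_floor _))// ltW.
- exact: (@lipschitz_within _ _ K).
- move=> s t _ _; have [/y_ltl|/y_ltl|//] := ltgtP s t.
    by move=> /[swap]->; rewrite ltxx.
  by move=> /[swap]->; rewrite ltxx.
- move=> k; rewrite floor_lt_int floor_ge_int => /andP[h1 h2].
  by rewrite ge_min (ltW h1) /= le_max h2 orbT.
- move=> s; rewrite /setI /= in_itv /= -phase_hitP hit_intP.
  split.
    move=> [[k hk] /andP[bs sc]]; rewrite (ltW bs) sc; split => //; exists k => //.
    rewrite floor_lt_int floor_ge_int -hk (y_ltl bs) /=.
    by move: sc; rewrite le_eqVlt => /predU1P[->//|/y_ltl/ltW].
  move=> [/andP[bs sc] [k /andP[k1 k2] hk]]; split; first by exists k.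
  rewrite sc andbT lt_neqAle bs andbT; apply/eqP => sb.
  by move: k1; rewrite floor_lt_int -hk -sb ltxx.
Qed.

Lemma near_right_level l : \forall x \near l^'+,
  l < x /\ y x n%:R < (Num.floor (y l n%:R) + 1)%:~R.
Proof.
have [K K0 HK] := y_ex_lip_l.
pose d := (Num.floor (y l n%:R) + 1)%:~R - y l n%:R.
have d0 : 0 < d by rewrite subr_gt0 floorD1_gt.
near=> x; have lx : l < x by near: x; exact: nbhs_right_gt.
split => //.
have : x - l < d / K by near: x; apply: nbhs_right_ltDr; rewrite divr_gt0.
rewrite ltr_pdivlMr// mulrC => h.
have := le_trans (ler_norm _) (HK x l); rewrite [`|x - l|]gtr0_norm ?subr_gt0// => h'.
by have := le_lt_trans h' h; rewrite ltrD2r.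
Unshelve. all: by end_near. Qed.

Let y_inj_t l s t : l != 0 -> 0 <= s <= n%:R -> 0 <= t <= n%:R -> y l s = y l t -> s = t.
Proof.
move=> l0 /andP[s0 sn] /andP[t0 tn] e'.
have h s' t' : 0 <= s' -> s' < t' -> t' <= n%:R -> y l s' != y l t'.
  move=> s'0 st tn'; have [lneg|lpos|l0'] := ltgtP l 0; last by rewrite l0' eqxx in l0.
    by rewrite gt_eqF// y_lt// phase_gt_t.
  by rewrite lt_eqF// y_lt// phase_lt_t.
have [st|ts|//] := ltgtP s t.
  by have := h _ _ s0 st tn; rewrite e' eqxx.
by have := h _ _ t0 ts sn; rewrite e' eqxx.
Qed.

Let y_cont_t l : {within `[0, n%:R], continuous (y l)}.
Proof.
have [K HK] := phase_lip_t n0 a_lt1 l; apply: (@lipschitz_within _ _ (K / (2 * pi))) => s t.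
by rewrite y_lip mulrAC ler_wpM2r ?invr_ge0 ?(ltW pi2).
Qed.

(** Time [n] lies outside the interval, so the hits are the integers strictly between [y0] and
    [y x n%:R]. The largest of these is at most the floor of [y l n%:R], and that floor itself lies
    strictly below [y x n%:R] because [l < x]; this is where the limit from the right enters. *)
Lemma hits_pos l x : 0 <= l -> l < x -> y x n%:R < (Num.floor (y l n%:R) + 1)%:~R ->
  signed_hits n%:R%:E eta1 (phase n0 a) x = (carousel_count l)%:E.
Proof.
move=> l0 lx yx; have x0 := le_lt_trans l0 lx.
have yl0 : y0 <= y l n%:R.
  by move: l0; rewrite le_eqVlt => /predU1P[<-//|/y_ltl/ltW].
have ylx := y_ltl lx; have yx0 : y x 0 = y0 by [].
rewrite /signed_hits gtr0_sg// mul1e.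
apply: (@counting_levels _ (y x) 0 n%:R) => //.
- by rewrite floor_ge_int (le_trans (ge_floor _)).
- by move=> s t; apply: y_inj_t; rewrite gt_eqF.
- move=> k; rewrite floor_lt_int floor_ge_int => /andP[k1 k2].
  by rewrite yx0 ge_min (ltW k1) /= le_max (le_trans k2 (ltW ylx)) orbT.
move=> s; rewrite /= hit_intP intvE /= in_itv /=; split.
  move=> [/andP[s0 sn] [k hk]]; rewrite s0 ltW//; split => //; exists k => //.
  have ys : y x s < y x n%:R by apply: y_lt; exact: phase_lt_t.
  rewrite floor_lt_int -ltzD1 -(ltr_int R) -hk (lt_trans ys yx) andbT.
  rewrite lt_neqAle -{2}yx0 hk y0_nint -hk /=.
  move: s0; rewrite le_eqVlt => /predU1P[<-//|s0].
  by apply/ltW/y_lt/phase_lt_t => //; exact: ltW.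
move=> [/andP[s0 sn] [k /andP[k1 k2] hk]]; split; last by exists k.
rewrite s0 /= lt_neqAle sn andbT; apply/eqP => sE.
by move: k2; rewrite floor_ge_int -hk sE leNgt ylx.
Qed.

(** The motion is now downward and the hits are the integers strictly between [y x n%:R] and [y0].
    As [y l n%:R < y x n%:R] stay below the same next integer, these are the integers above the
    floor of [y l n%:R]; the sign restores the order of the difference. *)
Lemma hits_neg l x : l < x -> x < 0 -> y x n%:R < (Num.floor (y l n%:R) + 1)%:~R ->
  signed_hits n%:R%:E eta1 (phase n0 a) x = (carousel_count l)%:E.
Proof.
move=> lx x0 yx; have yx0 : y x 0 = y0 by [].
have yxy0 : y x n%:R < y0 by exact: y_ltl.
have ylx := y_ltl lx.
rewrite /signed_hits ltr0_sg//.
rewrite (@counting_levels _ (y x) 0 n%:R _ (Num.floor (y l n%:R)) (Num.floor y0)) //.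
- by rewrite mulN1e -EFinN; congr EFin; rewrite /carousel_count -rmorphN opprB.
- by rewrite floor_ge_int (le_trans (ge_floor _))// ltW// (lt_trans ylx).
- by move=> s t; apply: y_inj_t; rewrite lt_eqF.
- move=> k; rewrite floor_ge_int => /andP[k1 k2].
  rewrite yx0 le_max k2 /= andbT ge_min (le_trans (ltW yx)) ?orbT//.
  by rewrite ler_int lezD1.
move=> s; rewrite /= hit_intP intvE /= in_itv /=; split.
  move=> [/andP[s0 sn] [k hk]]; rewrite s0 ltW//; split => //; exists k => //.
  have ys : y x n%:R < y x s by apply: y_lt; exact: phase_gt_t.
  rewrite floor_lt_int floor_ge_int -hk (lt_trans ylx ys) /= -yx0.
  move: s0; rewrite le_eqVlt => /predU1P[<-//|s0].
  by apply/ltW/y_lt/phase_gt_t => //; exact: ltW.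
move=> [/andP[s0 sn] [k /andP[k1 k2] hk]]; split; last by exists k.
rewrite s0 /= lt_neqAle sn andbT; apply/eqP => sE.
by move: yx hk; rewrite sE => + hk; rewrite hk ltr_int ltzD1 => /(lt_le_trans k1); rewrite ltxx.
Qed.

Lemma carousel_hits l :
  signed_hits n%:R%:E eta1 (phase n0 a) x @[x --> l^'+] --> (carousel_count l)%:E.
Proof.
apply: cvg_near_cst; have [l0|l0] := leP 0 l.
  by near=> x; have [] : l < x /\ y x n%:R < (Num.floor (y l n%:R) + 1)%:~R;
    [near: x; exact: near_right_level|exact: hits_pos].
near=> x; have [] : l < x /\ y x n%:R < (Num.floor (y l n%:R) + 1)%:~R.
  by near: x; exact: near_right_level.
by move=> lx; apply: hits_neg => //; near: x; exact: nbhs_right_lt.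
Unshelve. all: by end_near. Qed.

Let g t := a (Num.truncn t).
(** The rate for which [2 * f * l] is [l / n], the angle per unit of time in [phase_steps]. *)
Let f : R -> R := cst (2 * n%:R)^-1.

Lemma carousel_phaseP : carousel_phase n%:R%:E g 1 f (phase n0 a).
Proof.
move=> l; split; first by rewrite phase_t0// expi0.
  move=> s _; have [K HK] := phase_lip_t n0 a_lt1 l.
  apply: (@lipschitz_abs_continuous _ _ _ _ K) => x z _ xz _.
  by rewrite (le_trans (HK x z))// [`|z - x|]ger0_norm// subr_ge0.
rewrite /ae_on; apply: ae_sub ae_nat => t tn; rewrite intvE /= in_itv /= => /andP[t0 tltn].
have /andP[h1 h2] := truncn_itv t0.
have tk : (Num.truncn t < n)%N by rewrite truncn_lt_nat.
have h3 : (Num.truncn t)%:R < t by rewrite lt_neqAle eq_sym tn h1.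
have h : (Num.truncn t)%:R < t < (Num.truncn t).+1%:R by rewrite h3.
apply: is_derive_eq (is_derive_phase a_lt1 l tk h) _.
have -> // : 2 * f t * l = l / n%:R.
by rewrite /f /=; field; rewrite addrC natr1 pnatr_eq0.
Qed.

Lemma carousel_dataP : carousel_data n%:R%:E g 1 eta1 f.
Proof.
split.
- by rewrite lte_fin.
- split.
  + by rewrite intvE; exact: (measurable_step (fun j => complex.Re (a j))).
  + by rewrite intvE; exact: (measurable_step (fun j => complex.Im (a j))).
  + by move=> t _; exact/cabs_lt1/a_lt1.
  + move=> s sT; exists (\big[Num.max/0]_(k < n) cabs (a k)).
      by apply/bigmax_ltP; split => // j _; exact/cabs_lt1/a_lt1.
    move=> t /andP[t0 ts]; have tn : t < n%:R.
      by apply: le_lt_trans ts _; case: sT; rewrite lte_fin.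
    have tk : (Num.truncn t < n)%N by rewrite truncn_lt_nat.
    exact: (@le_bigmax _ _ _ 0 (fun k : 'I_n => cabs (a k)) (Ordinal tk)).
- split; last exact: eta1_neq1.
    by have := cabs_expi (0 : R); rewrite expi0.
  by rewrite -thE cabs_expi.
- by move=> t _; rewrite /f /= invr_gt0 mulr_gt0.
- move=> s _; apply/measurable_bounded_integrable => //.
  + by rewrite [X in (X < _)%E](lebesgue_measure_itv (`[0, s])) /=; case: ifP => // _; rewrite ltry.
  + exact: measurable_cst.
  + exact: bounded_cst.
Qed.

Lemma carousel_path_piecewise_constant : piecewise_constant n%:R%:E g.
Proof.
exists [seq i%:R | i <- iota 0 n.+1] => s t; rewrite !intvE /= !in_itv /=.
move=> /andP[s0 sn] /andP[t0 tn] st h; congr a.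
apply/eqP; rewrite eqn_leq le_truncn//= leqNgt; apply/negP => hlt.
have tk : (Num.truncn t < n)%N by rewrite truncn_lt_nat.
have tbrk : (Num.truncn t)%:R \in ([seq i%:R | i <- iota 0 n.+1] : seq R).
  by apply: map_f; rewrite mem_iota add0n leqW.
have /negP := h _ tbrk; apply.
have /andP[-> _] := truncn_itv t0; have /andP[_ s1] := truncn_itv s0.
by rewrite andbT (lt_le_trans s1)// ler_nat.
Qed.

Lemma carousel_exists :
   exists (T : \bar R) (g : R -> R[i]) (eta0 eta1 : R[i]) (f : R -> R),
     [/\ carousel_data T g eta0 eta1 f,
         piecewise_constant T g &
         carousel_produces T g eta0 eta1 f (unitary_points lam)].
Proof.
exists n%:R%:E, g, 1, eta1, f; split; [exact: carousel_dataP|exact: carousel_path_piecewise_constant|].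
exists carousel_count; last by move=> b c; exact: carousel_count_points.
by exists (phase n0 a); [exact: carousel_phaseP|exact: carousel_hits].
Qed.

End Carousel.

Theorem theorem2 (R : realType) (n : nat) (n_gt0 : (0 < n)%N)
    (V : 'M[R[i]]_n) (V_unitary : V \is unitarymx)
    (lam : 'I_n -> R)
    (lam_eigen : forall k, eigenvalue V (expi (lam k)))
    (lam_distinct : injective (fun k => expi (lam k))) :
  (exists (T : \bar R) (W : R -> 'M[R]_2) (u0 u1 : 'cV[R]_2),
     [/\ dirac_data T W u0 u1,
         self_adjoint T W (dirac_op T W u0 u1) &
         spectrum T W (dirac_op T W u0 u1) = unitary_points lam]) /\
  (~ unitary_points lam 0 ->
   exists (T : \bar R) (g : R -> R[i]) (eta0 eta1 : R[i]) (f : R -> R),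
     [/\ carousel_data T g eta0 eta1 f,
         piecewise_constant T g &
         carousel_produces T g eta0 eta1 f (unitary_points lam)]).
Proof.
case: n n_gt0 V V_unitary lam lam_eigen lam_distinct => // n _ V _ lam _ lam_inj.
have [a [e [a_lt1 e_neq0 pathP]]] := inverse_spectral (fun k => norm_expi (lam k)) lam_inj.
split; first exact: dirac_exists a_lt1 e_neq0 pathP.
exact: carousel_exists a_lt1 e_neq0 pathP.
Qed.
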